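(* The following decision problem is strongly NP-complete: given an edge-weighted directed planar graph $G=(V,E)$ with weight function $w:E\to\mathbb{Z}_{\ge 0}$, interdiction cost function $c:E\to\mathbb{Z}_{\ge 0}$, an integer budget $B>0$, two distinct vertices $u,v\in V$, and an integer $k\ge 0$, decide whether $\rho_B^E(G,u,v)>k$.
   Context: $\rho(H,u,v)$ denotes the total weight of a shortest directed path from $u$ to $v$ in an edge-weighted directed graph $H$. For $I\subseteq E$, $G\setminus I$ is $G$ with the edges of $I$ deleted. The Directed Shortest Path Edge Interdiction Problem asks for $I\subseteq E$ with $c(I)=\sum_{e\in I}c(e)\le B$ maximizing $\rho(G\setminus I,u,v)$; $\rho_B^E(G,u,v)$ denotes this optimal value. Strongly NP-complete means NP-complete even when all numbers in the input are bounded by a polynomial in the input size. *)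

(* Defs.v *)
From mathcomp Require Import all_boot all_order all_algebra all_fingroup.
From mathcomp Require Import constructive_ereal.

Set Implicit Arguments.
Unset Strict Implicit.
Unset Printing Implicit Defensive.

Import Order.TTheory GRing.Theory Num.Theory.

Inductive move := MoveLeft | Stay | MoveRight.

Record machine := Machine {
  tapes : nat; (* the machine has [tapes.+1] tapes *)
  symbol : finType;
  blank : symbol;
  bit : bool -> symbol;
  bit_inj : injective bit;
  bit_nonblank : forall b, bit b != blank;
  state : finType;
  start : state;
  halting : pred state;
  transition : state -> {ffun 'I_tapes.+1 -> symbol} ->
               state * {ffun 'I_tapes.+1 -> symbol * move} }.

(* A two-way infinite tape is a pair [(l, r)]: [r] lists the cells from the
   scanned one rightwards, [l] the cells from the left neighbour of the scanned
   one leftwards, and all cells not listed are blank. *)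
Definition tape (M : machine) : Type := (seq (symbol M) * seq (symbol M))%type.

Definition scan (M : machine) (t : tape M) : symbol M := head (blank M) t.2.

Definition write_move (M : machine) (t : tape M) (a : symbol M * move) :
    tape M :=
  let: (l, r) := (t.1, a.1 :: behead t.2) in
  match a.2 with
  | MoveLeft => (behead l, head (blank M) l :: r)
  | Stay => (l, r)
  | MoveRight => (head (blank M) r :: l, behead r)
  end.

Definition config (M : machine) : Type :=
  (state M * {ffun 'I_(tapes M).+1 -> tape M})%type.

(* Halting configurations are fixed points, so being in a halting state after
   exactly [t] iterations means having halted within [t] steps. *)
Definition step (M : machine) (c : config M) : config M :=
  if halting c.1 then c
  else let: (q, act) := transition c.1 [ffun i => scan (c.2 i)] in
       (q, [ffun i => write_move (c.2 i) (act i)]).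

(* The i-th input word is written on the i-th tape, the other tapes are blank. *)
Definition initial (M : machine) (ws : seq (seq bool)) : config M :=
  (start M, [ffun i : 'I_(tapes M).+1 => ([::], map (@bit M) (nth [::] ws i))]).

(* The output is the word read on tape 0 from the head up to the first blank. *)
Definition outputs_within (M : machine) (ws : seq (seq bool)) (t : nat)
    (y : seq bool) : Prop :=
  let c := iter t (@step M) (initial M ws) in
  let r := (c.2 ord0).2 in
  halting c.1 /\ take (index (blank M) r) r = map (@bit M) y.

Definition polytime_function (f : seq bool -> seq bool) : Prop :=
  exists (M : machine) (p : {poly nat}), forall x : seq bool,
    outputs_within M [:: x] p.[size x]%R (f x).

Definition polytime_relation (R : seq bool -> seq bool -> bool) : Prop :=
  exists (M : machine) (p : {poly nat}), forall x y : seq bool,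
    outputs_within M [:: x; y] p.[(size x + size y)%N]%R [:: R x y].

Definition language : Type := seq bool -> Prop.

Definition NP (L : language) : Prop :=
  exists (R : seq bool -> seq bool -> bool) (q : {poly nat}),
    polytime_relation R /\
    forall x : seq bool,
      L x <-> exists y : seq bool, (size y <= q.[size x]%R)%N /\ R x y.

Definition NP_hard (L : language) : Prop :=
  forall L' : language, NP L' ->
    exists f : seq bool -> seq bool,
      polytime_function f /\ forall x : seq bool, L' x <-> L (f x).

Definition NP_complete (L : language) : Prop := NP L /\ NP_hard L.

Definition language_of (I : Type) (enc : I -> seq bool) (yes : I -> Prop) :
    language :=
  fun x => exists i : I, enc i = x /\ yes i.

(* Garey and Johnson's strong NP-completeness; [num i] is the largest number
   occurring in the instance [i]. *)
Definition strongly_NP_complete (I : Type) (enc : I -> seq bool)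
    (num : I -> nat) (yes : I -> Prop) : Prop :=
  NP (language_of enc yes) /\
  exists p : {poly nat},
    NP_complete
      (language_of enc
         (fun i => yes i /\ (num i <= p.[size (enc i)]%R)%N)).

(* A graph is planar when it has a combinatorial embedding (rotation system) of
   genus 0. The darts are the ordered pairs of adjacent vertices; the orbits of
   [node] on darts are the sets of darts leaving a given vertex, those of
   [swap_dart] are the edges and those of [face] are the boundary walks of the
   faces. The last condition is Euler's formula, summed over the connected
   components that have at least one edge. *)
Definition swap_dart (V : finType) (d : V * V) : V * V := (d.2, d.1).

Definition planar (V : finType) (adj : rel V) : Prop :=
  let dart := [pred d : V * V | adj d.1 d.2] in
  exists node : {perm V * V},
    let face := fun d => node (swap_dart d) in
    let link := [rel d d' | (d' == swap_dart d) || (d' == node d)] in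
    (forall d d', dart d -> fconnect node d d' = dart d' && (d'.1 == d.1)) /\
    (fcard node dart + fcard (@swap_dart V) dart + fcard face dart
       = #|dart| + 2 * n_comp link dart)%N.

Definition underlying (V : finType) (E : {set V * V}) : rel V :=
  [rel x y | (x != y) && (((x, y) \in E) || ((y, x) \in E))].

Definition is_dipath (V : finType) (E : {set V * V}) (u v : V) (p : seq V) :
    bool :=
  [&& path [rel x y | (x, y) \in E] u p, last u p == v & uniq (u :: p)].

Definition path_weight (V : finType) (w : V * V -> nat) (u : V) (p : seq V) :
    nat :=
  \sum_(e <- zip (u :: p) p) w e.

(* [+oo] when there is no path; a simple path has at most [#|V|] vertices. *)
Definition rho (V : finType) (E : {set V * V}) (w : V * V -> nat) (u v : V) :
    \bar int :=
  \big[Order.min/+oo%E]_(p : #|V|.-bseq V | is_dipath E u v p)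
    (path_weight w u p)%:Z%:E.

Definition rho_interdicted (V : finType) (E : {set V * V})
    (w c : V * V -> nat) (B : nat) (u v : V) : \bar int :=
  \big[Order.max/-oo%E]_(I : {set V * V} |
      (I \subset E) && (\sum_(e in I) c e <= B)%N)
    rho (E :\: I) w u v.

(* The values of [weight] and [cost] outside [arcs] are junk: nothing below
   depends on them. *)
Record instance := Instance {
  nvert : nat;
  arcs : {set 'I_nvert * 'I_nvert};
  arcs_planar : planar (underlying arcs);
  weight : 'I_nvert * 'I_nvert -> nat;
  cost : 'I_nvert * 'I_nvert -> nat;
  budget : nat;
  budget_gt0 : (0 < budget)%N;
  source : 'I_nvert;
  target : 'I_nvert;
  source_neq_target : source != target;
  threshold : nat }.

Arguments weight : clear implicits.
Arguments cost : clear implicits.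

Definition interdiction_exceeds (i : instance) : Prop :=
  ((threshold i)%:Z%:E <
     rho_interdicted (arcs i) (weight i) (cost i) (budget i)
       (source i) (target i))%E.

Definition max_number (i : instance) : nat :=
  maxn (\max_(e in arcs i) maxn (weight i e) (cost i e))
       (maxn (budget i) (threshold i)).

(* Binary digits, least significant first. *)
Definition bits (n : nat) : seq bool :=
  mkseq (fun j => odd (n %/ 2 ^ j)) (up_log 2 n.+1).

Definition encode_nat (n : nat) : seq bool :=
  flatten [seq [:: true; b] | b <- bits n] ++ [:: false].

Definition encode_arc (i : instance) (e : 'I_(nvert i) * 'I_(nvert i)) :
    seq bool :=
  if e \in arcs i then true :: encode_nat (weight i e) ++ encode_nat (cost i e)
  else [:: false].

(* The number of vertices is written in unary, so that it is bounded by the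
   length of the code; the other numbers are written in binary. The graph is
   given by its adjacency matrix, row by row. *)
Definition encode (i : instance) : seq bool :=
  nseq (nvert i) true ++ [:: false] ++
  flatten [seq encode_arc (x, y) | x <- enum 'I_(nvert i),
                                   y <- enum 'I_(nvert i)] ++
  encode_nat (budget i) ++ encode_nat (source i) ++ encode_nat (target i) ++
  encode_nat (threshold i).

(* Main.v *)
Require Import Defs.
From mathcomp Require Import all_boot all_order all_algebra all_fingroup.
From mathcomp Require Import constructive_ereal.
From mathcomp Require Import zify.

(* Membership in NP. A shortest path is longer than k exactly when there is a
   potential vanishing at the source, exceeding k at the target and growing by at
   most w(e) along each remaining arc e. A certificate consists of the instance,
   the interdicted arcs, a potential truncated at k+1 and a rotation system; Euler's
   formula is checked by counting connected components.

   Hardness. The computation tableau of a verifier becomes a 0-1 linear system,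
   with one variable for each cell and each tile, whose rows force each cell to
   hold an allowed tile and neighbouring cells to agree. Adding a large constant Q
   to all coefficients turns it into rows sum_c x_c a_rc = K with a_rc = Q + A_rc,
   where the sum of the A_rc over a row is at most w < Q/2.

   The linear system becomes a grid on a cylinder, with source and target at the
   two ends. Row r gives two parallel horizontal lines: the arcs of the first have
   weight 0 and cost a_rc, those of the second have weight a_rc and are too
   expensive to cut. The two lines are joined by arcs of weight 0, so the potential
   of row r climbs by at most a_rc in column c, and only if the arc of cost a_rc is
   cut. To gain K in each of the R rows within the budget RK one must gain exactly K
   in each row. Consecutive rows are joined by arcs of weight w: the potentials of
   all rows may differ by the small A-parts, but not by Q, so the same columns are
   cut in every row. All numbers are at most the square of the size of the code. *)

Set Implicit Arguments.
Unset Strict Implicit.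
Unset Printing Implicit Defensive.

Import Order.TTheory GRing.Theory Num.Theory.

Local Open Scope nat_scope.

(** The reduction starts from an arbitrary verifier rather than from a known hard problem: the time
    bound keeps the number of cells, hence all coefficients, polynomial, as strong completeness
    demands. The obstacle is that a budget only limits a total, while one solution must be read in
    all rows. The large [Q] resolves this twice. Between rows, the potential at column [c] divided
    by [Q] counts the cuts before [c], and equal counts in every column force equal cuts. Within a
    row, [Q] separates the number of chosen variables from their coefficients: as many tiles are
    chosen as there are cells, so rows demanding at least one allowed tile per cell leave exactly
    one. The grid is closed into a cylinder so that every vertex has a northern and a southern
    neighbour; the extra arcs are harmless, since the potentials of any two rows of the system are
    close. Membership and hardness both need genuine Turing machines, hence a small language of
    stack programs and a calculus of functions on trees. Its natural numbers are unary, so the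
    unbounded numbers of an instance are handled as binary words. *)

Definition peval (p : {poly nat}) (n : nat) : nat := p.[n]%R.

Lemma pevalD p q n : peval (p + q)%R n = peval p n + peval q n.
Proof. by rewrite /peval hornerD. Qed.

Lemma pevalM p q n : peval (p * q)%R n = peval p n * peval q n.
Proof. by rewrite /peval hornerM. Qed.

Lemma pevalC c n : peval c%:P%R n = c.
Proof. by rewrite /peval hornerC. Qed.

Lemma pevalX n : peval 'X%R n = n.
Proof. by rewrite /peval hornerX. Qed.

Lemma peval_comp p q n : peval (p \Po q)%R n = peval p (peval q n).
Proof. by rewrite /peval horner_comp. Qed.

Definition pevalE := (pevalD, pevalM, pevalC, pevalX, peval_comp).

Lemma peval_mono p m n : m <= n -> peval p m <= peval p n.
Proof.
move=> mn; rewrite /peval; elim/poly_ind: p => [|p c IH]; first by rewrite !horner0.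
by rewrite !hornerMXaddC leq_add2r; apply: leq_mul.
Qed.

(** * Stack programs compiled to Turing machines *)

(** The four tapes serve as stacks: [s0] carries the data and [s1] the values set aside, while [s2]
    and [s3] are scratch space, empty before and after each program of [polytime]. *)
Definition s0 : 'I_4 := @Ordinal 4 0 isT.
Definition s1 : 'I_4 := @Ordinal 4 1 isT.
Definition s2 : 'I_4 := @Ordinal 4 2 isT.
Definition s3 : 'I_4 := @Ordinal 4 3 isT.

Inductive cmd :=
| Push of 'I_4 & bool
| Pop of 'I_4
| Seq of cmd & cmd
| If of 'I_4 & pred (option bool) & cmd & cmd
| While of 'I_4 & pred (option bool) & cmd.

Notation stacks := (seq (seq bool)).

Definition get (s : stacks) (i : 'I_4) : seq bool := nth [::] s i.
Definition put (s : stacks) (i : 'I_4) (x : seq bool) : stacks := set_nth [::] s i x.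

Lemma get_put s i x j : get (put s i x) j = if j == i then x else get s j.
Proof. by rewrite /get /put nth_set_nth /= -val_eqE. Qed.

(** The counter is the exact number of steps of the compiled machine: two for a push, one for a pop
    or a test, none for sequencing. *)
Inductive exec : cmd -> stacks -> nat -> stacks -> Prop :=
| ExecPush i b s : exec (Push i b) s 2 (put s i (b :: get s i))
| ExecPop i s : exec (Pop i) s 1 (put s i (behead (get s i)))
| ExecSeq c d s t u m n : exec c s m t -> exec d t n u -> exec (Seq c d) s (m + n) u
| ExecIf i (p : pred (option bool)) c d s t n :
    exec (if p (ohead (get s i)) then c else d) s n t -> exec (If i p c d) s n.+1 t
| ExecWhileF i (p : pred (option bool)) c s : ~~ p (ohead (get s i)) -> exec (While i p c) s 1 s
| ExecWhileT i (p : pred (option bool)) c s t u m n : p (ohead (get s i)) ->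
    exec c s m t -> exec (While i p c) t n u -> exec (While i p c) s (m + n).+1 u.

(** In [If] and [While], [None] is the control point at which the test is made. *)
Fixpoint control (c : cmd) : finType :=
  match c with
  | Push _ _ => bool
  | Pop _ => unit
  | Seq c d => (control c + control d)%type
  | If _ _ c d => option (control c + control d)%type
  | While _ _ c => option (control c)
  end.

Fixpoint entry (c : cmd) : control c :=
  match c with
  | Push _ _ => false
  | Pop _ => tt
  | Seq c d => inl (entry c)
  | If _ _ _ _ => None
  | While _ _ _ => None
  end.

Definition action := option ('I_4 * (option bool * move)).

(* The next control point ([None] on exit) and the tape operation. A push takes
   two steps, moving left and then writing; whatever lies to the left of the
   head is junk that a push overwrites. *)
Fixpoint next (c : cmd) :
    control c -> ('I_4 -> option bool) -> option (control c) * action :=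
  match c with
  | Push i b => fun q sc =>
      if q then (None, Some (i, (Some b, Stay)))
      else (Some true, Some (i, (sc i, MoveLeft)))
  | Pop i => fun _ sc =>
      (None, if sc i is Some _ then Some (i, (None, MoveRight)) else None)
  | Seq c d => fun q sc =>
      match q with
      | inl q => let r := next q sc in
                 (Some (if r.1 is Some q' then inl q' else inr (entry d)), r.2)
      | inr q => let r := next q sc in (omap inr r.1, r.2)
      end
  | If i p c d => fun q sc =>
      match q with
      | None => (Some (Some (if p (sc i) then inl (entry c) else inr (entry d))), None)
      | Some (inl q) => let r := next q sc in (omap (fun q => Some (inl q)) r.1, r.2)
      | Some (inr q) => let r := next q sc in (omap (fun q => Some (inr q)) r.1, r.2)
      end
  | While i p c => fun q sc =>
      match q with
      | None => (if p (sc i) then Some (Some (entry c)) else None, None)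
      | Some q => let r := next q sc in (Some r.1, r.2)
      end
  end.

Lemma some_bool_inj : injective (@Some bool).
Proof. by move=> ? ? []. Qed.

Definition machine_of (c : cmd) : machine :=
  @Machine 3 (option bool) None (@Some bool) some_bool_inj (fun=> isT)
    (option (control c)) (Some (entry c)) (fun q => ~~ isSome q)
    (fun q sc => if q is Some q then
        let r := next q sc in
        (r.1, [ffun i => if r.2 is Some a then
                           if i == a.1 then a.2 else (sc i, Stay)
                         else (sc i, Stay)])
      else (None, [ffun i => (sc i, Stay)])).

Definition cell_tape := (seq (option bool) * seq (option bool))%type.

(** The rest [r] need not be empty, since even an idle step lists the scanned blank explicitly. Only
    its first cell matters: it marks the end of the word. *)
Definition holds_word (t : cell_tape) (w : seq bool) : Prop :=
  exists r, t.2 = map Some w ++ r /\ head None r = None.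

Definition wm (t : cell_tape) (a : option bool * move) : cell_tape :=
  let: (l, r) := (t.1, a.1 :: behead t.2) in
  match a.2 with
  | MoveLeft => (behead l, head None l :: r)
  | Stay => (l, r)
  | MoveRight => (head None r :: l, behead r)
  end.

Definition scans (ts : {ffun 'I_4 -> cell_tape}) : {ffun 'I_4 -> option bool} :=
  [ffun i => head None (ts i).2].

Definition apply (a : action) (ts : {ffun 'I_4 -> cell_tape}) : {ffun 'I_4 -> cell_tape} :=
  [ffun i => wm (ts i) (if a is Some a then
                           if i == a.1 then a.2 else (scans ts i, Stay)
                         else (scans ts i, Stay))].

Inductive runs (c : cmd) : control c -> {ffun 'I_4 -> cell_tape} -> nat ->
    {ffun 'I_4 -> cell_tape} -> Prop :=
| RunsExit q ts : (next q (scans ts)).1 = None -> 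
    runs q ts 1 (apply (next q (scans ts)).2 ts)
| RunsStep q q' ts n ts' : (next q (scans ts)).1 = Some q' ->
    runs q' (apply (next q (scans ts)).2 ts) n ts' -> runs q ts n.+1 ts'.

Lemma runs_iter c (q : control c) ts n ts' : runs q ts n ts' ->
  iter n (@step (machine_of c)) (Some q, ts) = (None, ts').
Proof.
elim=> {q ts n ts'} [q ts E|q q' ts n ts' E _ IH]; rewrite ?iterSr /=.
- congr pair; first exact: E.
  by apply/ffunP => i; rewrite !ffunE.
- rewrite -IH; congr iter; congr pair; first exact: E.
  by apply/ffunP => i; rewrite !ffunE.
Qed.

Definition agree (ts : {ffun 'I_4 -> cell_tape}) (s : stacks) :=
  forall i : 'I_4, holds_word (ts i) (get s i).

Lemma agree_scan ts s i : agree ts s -> scans ts i = ohead (get s i).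
Proof.
move=> /(_ i) [r [E rN]]; rewrite ffunE E.
by case: (get s i).
Qed.

Lemma wm_idle (t : cell_tape) w : holds_word t w -> holds_word (wm t (head None t.2, Stay)) w.
Proof.
case=> r [E rN]; rewrite /wm E /=; case: w E => [|b w] E /=; last by exists r.
by exists (None :: behead r); rewrite /= rN.
Qed.

Lemma apply_same i b ts : apply (Some (i, b)) ts i = wm (ts i) b.
Proof. by rewrite ffunE /= eqxx. Qed.

Lemma apply_other i b (ts : {ffun _ -> _}) j w : j != i ->
  holds_word (ts j) w -> holds_word (apply (Some (i, b)) ts j) w.
Proof. by move=> ji H; rewrite !ffunE /= (negPf ji); apply: wm_idle. Qed.

Lemma apply_None ts s : agree ts s -> agree (apply None ts) s.
Proof. by move=> A i; rewrite !ffunE; apply: wm_idle; apply: A. Qed.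

Lemma runs_seqr c d (q : control d) ts m ts1 : runs q ts m ts1 ->
  runs (c := Seq c d) (inr q) ts m ts1.
Proof.
elim=> {q ts m ts1} [q ts E|q q' ts m ts1 E _ IH].
  by apply: (@RunsExit (Seq c d)); rewrite /= E.
by apply: (@RunsStep (Seq c d) _ (inr q')); rewrite /= ?E.
Qed.

Lemma runs_seql c d (q : control c) ts m ts1 n ts2 : runs q ts m ts1 ->
  runs (entry d) ts1 n ts2 -> runs (c := Seq c d) (inl q) ts (m + n) ts2.
Proof.
move=> H K; elim: H K => {q ts m ts1} [q ts E|q q' ts m ts1 E _ IH] K.
  rewrite add1n; apply: (@RunsStep (Seq c d) _ (inr (entry d))); first by rewrite /= E.
  exact: runs_seqr K.
by apply: (@RunsStep (Seq c d) _ (inl q')); rewrite /= ?E //; apply: IH.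
Qed.

Lemma runs_ifl i p c d (q : control c) ts m ts1 : runs q ts m ts1 ->
  runs (c := If i p c d) (Some (inl q)) ts m ts1.
Proof.
elim=> {q ts m ts1} [q ts E|q q' ts m ts1 E _ IH].
  by apply: (@RunsExit (If i p c d)); rewrite /= E.
by apply: (@RunsStep (If i p c d) _ (Some (inl q'))); rewrite /= ?E.
Qed.

Lemma runs_ifr i p c d (q : control d) ts m ts1 : runs q ts m ts1 ->
  runs (c := If i p c d) (Some (inr q)) ts m ts1.
Proof.
elim=> {q ts m ts1} [q ts E|q q' ts m ts1 E _ IH].
  by apply: (@RunsExit (If i p c d)); rewrite /= E.
by apply: (@RunsStep (If i p c d) _ (Some (inr q'))); rewrite /= ?E.
Qed.

Lemma runs_while i p c (q : control c) ts m ts1 n ts2 : runs q ts m ts1 ->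
  runs (c := While i p c) None ts1 n ts2 ->
  runs (c := While i p c) (Some q) ts (m + n) ts2.
Proof.
move=> H K; elim: H K => {q ts m ts1} [q ts E|q q' ts m ts1 E _ IH] K.
  by rewrite add1n; apply: (@RunsStep (While i p c) _ None); rewrite /= ?E.
by apply: (@RunsStep (While i p c) _ (Some q')); rewrite /= ?E //; apply: IH.
Qed.

(** Compiler correctness, by induction on the execution: the control points of a command embed into
    those of any compound containing it, and a run of the part becomes a run of the whole. *)
Lemma runs_exec c s n s' : exec c s n s' -> forall ts, agree ts s ->
  exists2 ts', runs (entry c) ts n ts' & agree ts' s'.
Proof.
elim=> {c s n s'}.
- move=> i b s ts A.
  set ts1 := apply (Some (i, (scans ts i, MoveLeft))) ts.
  exists (apply (Some (i, (Some b, Stay))) ts1).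
    apply: (@RunsStep (Push i b) _ true); rewrite //=.
    exact: (@RunsExit (Push i b)).
  move=> j; rewrite get_put; case: eqVneq => [->|ji]; last by do 2! apply: apply_other => //.
  have [r [E rN]] := A i; rewrite /ts1 !apply_same /wm /= E ffunE E.
  case: (get s i) E => [|a w] E /=; last by exists r.
  by exists (None :: behead r); rewrite /= rN.
- move=> i s ts A; eexists; first exact: (@RunsExit (Pop i)).
  move=> j; rewrite get_put /= (agree_scan _ A).
  case E: (get s i) => [|a w] /=.
    have -> : (if j == i then [::] else get s j) = get s j by case: eqP => // ->.
    by apply: apply_None; apply: A.
  case: eqVneq => [->|ji]; last exact: apply_other.
  have [r [F rN]] := A i; rewrite apply_same /wm /= F E /=.
  by exists r.
- move=> c d s t u m n _ IH1 _ IH2 ts /IH1 [ts1 R1 /IH2 [ts2 R2 A2]].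
  by exists ts2 => //; exact: (runs_seql R1 R2).
- move=> i p c d s t n _ IH ts A.
  have [ts1 R1 A1] := IH _ (apply_None A); exists ts1 => //.
  apply: (@RunsStep (If i p c d)) => //=; rewrite (agree_scan _ A).
  by case: (p _) R1 => R1; [apply: runs_ifl|apply: runs_ifr].
- move=> i p c s Np ts A; exists (apply None ts); last exact: apply_None.
  by apply: (@RunsExit (While i p c)) => /=; rewrite (agree_scan _ A) (negPf Np).
- move=> i p c s t u m n pT _ IH1 _ IH2 ts A.
  have [ts1 R1 /IH2 [ts2 R2 A2]] := IH1 _ (apply_None A); exists ts2 => //.
  apply: (@RunsStep (While i p c) _ (Some (entry c))) => /=.
    by rewrite (agree_scan _ A) pT.
  exact: (runs_while R1 R2).
Qed.

Lemma iter_halting M (c : config M) n : halting c.1 -> iter n (@step M) c = c.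
Proof. by move=> H; elim: n => //= n ->; rewrite /step H. Qed.

Lemma exec_outputs c x y n w s t : exec c [:: x; y; [::]; [::]] n s -> n <= t ->
  get s s0 = w -> outputs_within (machine_of c) [:: x; y] t w.
Proof.
move=> E nt sw.
have A : agree (initial (machine_of c) [:: x; y]).2 [:: x; y; [::]; [::]].
  move=> i; rewrite /= ffunE; exists [::] => /=; rewrite cats0; split=> //.
  by congr map; rewrite /get; case: i => [[|[|[|[|?]]]]].
have [ts R At] := runs_exec E A.
have F := runs_iter R; rewrite /outputs_within -(subnK nt) iterD /= F iter_halting //=.
split=> //; have := At s0; rewrite sw (_ : s0 = ord0); last exact: val_inj.
case=> r [Er rN]; rewrite [(ts _).2]Er {Er}.
(* The word contains no blank and [r] is empty or starts with one, so the first blank comes right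
   after the word. *)
rewrite index_cat; have -> : (None \in map Some w) = false.
  by apply/negP => /mapP[].
have -> : index None r = 0 by case: (r) rN => //= a ? ->; rewrite eqxx.
by rewrite addn0 take_size_cat.
Qed.

(** An empty second word leaves its tape blank, so that a machine built for two inputs also serves
    functions of one input. *)
Lemma initial1 M (x : seq bool) : initial M [:: x] = initial M [:: x; [::]].
Proof.
congr pair; apply/ffunP => i; rewrite !ffunE; congr (_, map _ _).
by case: (i : nat) => [|[|[|?]]].
Qed.

(** Only an upper bound on the time is kept: it composes by addition and can be rounded up to a
    polynomial. *)
Definition ex (c : cmd) (s : stacks) (n : nat) (t : stacks) : Prop :=
  exists2 m, m <= n & exec c s m t.

Lemma ex_le c s m n t : m <= n -> ex c s m t -> ex c s n t.
Proof. by move=> mn [k km H]; exists k => //; apply: leq_trans mn. Qed.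

Lemma ex_push i b s : ex (Push i b) s 2 (put s i (b :: get s i)).
Proof. by exists 2 => //; constructor. Qed.

Lemma ex_pop i s : ex (Pop i) s 1 (put s i (behead (get s i))).
Proof. by exists 1 => //; constructor. Qed.

Lemma ex_seq c d s t u m n : ex c s m t -> ex d t n u -> ex (Seq c d) s (m + n) u.
Proof.
by case=> m' ? H [n' ? K]; exists (m' + n'); [apply: leq_add|apply: ExecSeq H K].
Qed.

Lemma ex_if i (p : pred (option bool)) c d s t n :
  ex (if p (ohead (get s i)) then c else d) s n t -> ex (If i p c d) s n.+1 t.
Proof. by case=> m ? H; exists m.+1 => //; constructor. Qed.

Lemma ex_whileF i (p : pred (option bool)) c s :
  ~~ p (ohead (get s i)) -> ex (While i p c) s 1 s.
Proof. by exists 1 => //; constructor. Qed.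

Lemma ex_whileT i (p : pred (option bool)) c s t u m n : p (ohead (get s i)) ->
  ex c s m t -> ex (While i p c) t n u -> ex (While i p c) s (m + n).+1 u.
Proof.
move=> pT [m' ? H] [n' ? K]; exists (m' + n').+1; first by rewrite ltnS leq_add.
exact: ExecWhileT H K.
Qed.

Lemma sumn_put s i x : sumn (map size (put s i x)) + size (get s i) =
  sumn (map size s) + size x.
Proof.
rewrite /put /get; case: i => i /= _; elim: s i => [|a s IH] [|i] /=; rewrite ?nth_nil ?addn0 //.
- by elim: i => [|i] /=; lia.
- by lia.
- by have := IH i; rewrite /set_nth -/set_nth; lia.
Qed.

(** Only a push lengthens a stack, by one symbol in two steps. This is what bounds the size of
    results in [polytime_size]. *)
Lemma exec_size c s n t : exec c s n t -> sumn (map size t) <= sumn (map size s) + n.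
Proof.
elim=> {c s n t}.
- by move=> i b s; have := sumn_put s i (b :: get s i); rewrite /=; lia.
- by move=> i s; have := sumn_put s i (behead (get s i)); rewrite size_behead; lia.
- by move=> c d s t u m n _ + _; lia.
- by move=> i p c d s t n _; lia.
- by move=> *; lia.
- by move=> i p c s t u m n _ _ + _; lia.
Qed.

(** * Polynomial time on trees *)

(* The codes of trees are self-delimiting, so that they can be stacked. *)
Inductive tree := Leaf | Node of tree & tree.

Fixpoint code (t : tree) : seq bool :=
  if t is Node a b then true :: code a ++ code b else [:: false].

Lemma code_gt0 t : 0 < size (code t). Proof. by case: t. Qed.

Definition is_node : pred (option bool) := pred1 (Some true).
Definition nonempty : pred (option bool) := isSome.

Definition side (b : bool) : 'I_4 := if b then s1 else s0.

Definition mk (b : bool) (x y s k : seq bool) : stacks :=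
  if b then [:: y; x; s; k] else [:: x; y; s; k].

Definition skip : cmd := Pop s3.

(** The height of [s3] is the number of trees still to be read: a node replaces one tree by two, a
    leaf removes one, and the code ends when none is left. The symbols read pile up, reversed, on
    [s2]. *)
Definition scan_tree (i : 'I_4) : cmd :=
  While s3 nonempty
    (If i is_node
       (Seq (Pop i) (Seq (Push s2 true) (Push s3 true)))
       (Seq (Pop i) (Seq (Push s2 false) (Pop s3)))).

Definition parse (i : 'I_4) : cmd := Seq (Push s3 true) (scan_tree i).

Definition pour (b : bool) : cmd :=
  While s2 nonempty
    (If s2 is_node (Seq (Pop s2) (Push (side b) true)) (Seq (Pop s2) (Push (side b) false))).

Definition pour2 : cmd :=
  While s2 nonempty
    (If s2 is_node (Seq (Pop s2) (Seq (Push s0 true) (Push s1 true)))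
                   (Seq (Pop s2) (Seq (Push s0 false) (Push s1 false)))).

Definition move_tree (b : bool) : cmd := Seq (parse (side b)) (pour (~~ b)).
Definition copy_tree : cmd := Seq (parse s0) pour2.
Definition drop_tree : cmd := Seq (parse s0) (While s2 nonempty (Pop s2)).

Ltac ex_step :=
  match goal with
  | |- ex (Push _ _) _ _ _ => exact: ex_push
  | |- ex (Pop _) _ _ _ => exact: ex_pop
  | |- ex (Seq _ _) _ _ _ => eapply ex_seq; ex_step
  end.

(** Stated with an arbitrary continuation ending in [u], so that at a node the induction hypotheses
    for both subtrees can be chained. The factor 7 is one loop test and at most six steps for each
    symbol. *)
Lemma scan_treeP b t x y s k n u : ex (scan_tree (side b)) (mk b x y (rev (code t) ++ s) k) n u ->
  ex (scan_tree (side b)) (mk b (code t ++ x) y s (true :: k)) (7 * size (code t) + n) u.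
Proof.
elim: t x s k n => [|l IHl r IHr] x s k n H.
- have E : ex (If (side b) is_node
       (Seq (Pop (side b)) (Seq (Push s2 true) (Push s3 true)))
       (Seq (Pop (side b)) (Seq (Push s2 false) (Pop s3))))
       (mk b (false :: x) y s (true :: k)) 6 (mk b x y (false :: s) k).
    by case: b {H}; apply: ex_if => /=; apply: (@ex_le _ _ (1 + (2 + 1))) => //; ex_step.
  apply: (@ex_le _ _ (6 + n).+1); first by rewrite /=; lia.
  by apply: ex_whileT E H; case: b.
- have E : ex (If (side b) is_node
       (Seq (Pop (side b)) (Seq (Push s2 true) (Push s3 true)))
       (Seq (Pop (side b)) (Seq (Push s2 false) (Pop s3))))
       (mk b (code (Node l r) ++ x) y s (true :: k)) 6
       (mk b (code l ++ (code r ++ x)) y (true :: s) (true :: true :: k)).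
    rewrite /= -catA.
    by case: b {H IHl IHr}; apply: ex_if => /=; apply: (@ex_le _ _ (1 + (2 + 2))) => //; ex_step.
  apply: (@ex_le _ _ (6 + (7 * size (code l) + (7 * size (code r) + n))).+1).
    by rewrite /= size_cat; lia.
  apply: (ex_whileT _ E); first by case: b {H IHl IHr E}.
  apply: IHl; apply: IHr; move: H.
  by rewrite /= rev_cons rev_cat cat_rcons catA.
Qed.

Lemma parseP b t x y : ex (parse (side b)) (mk b (code t ++ x) y [::] [::])
  (7 * size (code t) + 3) (mk b x y (rev (code t)) [::]).
Proof.
apply: (@ex_le _ _ (2 + (7 * size (code t) + 1))); first lia.
eapply ex_seq; first exact: ex_push.
rewrite (_ : put _ _ _ = mk b (code t ++ x) y [::] [:: true]); last by case: b.
apply: scan_treeP; rewrite cats0; apply: ex_whileF.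
by case: b.
Qed.

Lemma pourP b l x y k : ex (pour b) (mk b x y l k) (5 * size l + 1) (mk b (rev l ++ x) y [::] k).
Proof.
elim: l x => [|a l IH] x; first by apply: ex_whileF; case: b.
apply: (@ex_le _ _ (4 + (5 * size l + 1)).+1); first by rewrite /=; lia.
apply: (@ex_whileT _ _ _ _ (mk b (a :: x) y l k)); first by case: b {IH}.
  by case: b {IH}; case: a; apply: ex_if => /=; apply: (@ex_le _ _ (1 + 2)) => //; ex_step.
by rewrite rev_cons cat_rcons; apply: IH.
Qed.

Lemma pour2P l x y k : ex pour2 [:: x; y; l; k] (7 * size l + 1) [:: rev l ++ x; rev l ++ y; [::]; k].
Proof.
elim: l x y => [|a l IH] x y; first exact: ex_whileF.
apply: (@ex_le _ _ (6 + (7 * size l + 1)).+1); first by rewrite /=; lia.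
apply: (@ex_whileT _ _ _ _ [:: a :: x; a :: y; l; k]) => //.
  by case: a; apply: ex_if => /=; apply: (@ex_le _ _ (1 + (2 + 2))) => //; ex_step.
by rewrite rev_cons !cat_rcons; apply: IH.
Qed.

Lemma move_treeP b t x y : ex (move_tree b) (mk b (code t ++ x) y [::] [::])
  (12 * size (code t) + 4) (mk b x (code t ++ y) [::] [::]).
Proof.
apply: (@ex_le _ _ ((7 * size (code t) + 3) + (5 * size (rev (code t)) + 1))).
  by rewrite size_rev; lia.
eapply ex_seq; first exact: parseP.
rewrite (_ : mk b x y _ _ = mk (~~ b) y x (rev (code t)) [::]); last by case: b.
rewrite (_ : mk b _ _ _ _ = mk (~~ b) (code t ++ y) x [::] [::]); last by case: b.
by rewrite -{3}[code t]revK; apply: pourP.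
Qed.

Lemma move0P t x y : ex (move_tree false) [:: code t ++ x; y; [::]; [::]]
  (12 * size (code t) + 4) [:: x; code t ++ y; [::]; [::]].
Proof. exact: (move_treeP false). Qed.

Lemma move1P t x y : ex (move_tree true) [:: x; code t ++ y; [::]; [::]]
  (12 * size (code t) + 4) [:: code t ++ x; y; [::]; [::]].
Proof. exact: (move_treeP true). Qed.

Lemma copy_treeP t x y : ex copy_tree [:: code t ++ x; y; [::]; [::]]
  (14 * size (code t) + 4) [:: code t ++ x; code t ++ y; [::]; [::]].
Proof.
apply: (@ex_le _ _ ((7 * size (code t) + 3) + (7 * size (rev (code t)) + 1))).
  by rewrite size_rev; lia.
apply: ex_seq (parseP false _ _ _) _.
by rewrite -{3 4}[code t]revK; apply: pour2P.
Qed.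

Lemma drop_treeP t x y : ex drop_tree [:: code t ++ x; y; [::]; [::]]
  (9 * size (code t) + 4) [:: x; y; [::]; [::]].
Proof.
apply: (@ex_le _ _ ((7 * size (code t) + 3) + (2 * size (rev (code t)) + 1))).
  by rewrite size_rev; lia.
apply: ex_seq (parseP false _ _ _) _.
elim: (rev _) => [|a l IH] /=; first exact: ex_whileF.
apply: (@ex_le _ _ (1 + (2 * size l + 1)).+1); first by rewrite /=; lia.
by apply: ex_whileT IH => //; apply: ex_pop.
Qed.

Structure encType := EncType { carrier :> Type; enc : carrier -> tree }.

Canonical tree_encType := EncType (fun t : tree => t).
Canonical bool_encType := EncType (fun b : bool => if b then Node Leaf Leaf else Leaf).
(** Unary, so that loops of length [n] are affordable and arithmetic is iteration. *)
Canonical nat_encType := EncType (fun n : nat => iter n (Node Leaf) Leaf).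
Canonical prod_encType (A B : encType) :=
  EncType (fun p : A * B => Node (enc p.1) (enc p.2)).
Canonical seq_encType (A : encType) :=
  EncType (foldr (fun (a : A) t => Node (enc a) t) Leaf).

Definition sz {A : encType} (a : A) : nat := size (code (enc a)).

(** The words [x] and [y] lying below are arbitrary and untouched, so a program can be run while
    other values are kept on the stacks; the time depends on the argument only. *)
Definition polytime {A B : encType} (f : A -> B) : Prop :=
  exists (c : cmd) (p : {poly nat}), forall a x y,
    ex c [:: code (enc a) ++ x; y; [::]; [::]] (peval p (sz a))
         [:: code (enc (f a)) ++ x; y; [::]; [::]].

Section Closure.
Context {X A B C : encType}.

(** A program has no time to write more symbols than it has steps. *)
Lemma polytime_size (f : A -> B) : polytime f ->
  exists p, forall a, sz (f a) <= peval p (sz a).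
Proof.
case=> c [p Hc]; exists ('X + p)%R => a; rewrite !pevalE.
have [m mp /exec_size] := Hc a [::] [::]; rewrite /= !cats0 /sz; move: mp; rewrite /sz; lia.
Qed.

Lemma polytime_ext (f g : A -> B) : f =1 g -> polytime f -> polytime g.
Proof. by move=> fg [c [p Hc]]; exists c, p => a x y; rewrite -fg. Qed.

Lemma polytime_enc (f : A -> B) : (forall a, enc (f a) = enc a) -> polytime f.
Proof.
move=> fE; exists skip, 1%:P%R => a x y; rewrite fE pevalC.
exact: ex_pop.
Qed.

Lemma polytime_comp (g : B -> C) (f : A -> B) : polytime g -> polytime f ->
  polytime (fun a => g (f a)).
Proof.
move=> [d [q Hd]] Pf; have [r Hr] := polytime_size Pf.
have [c [p Hc]] := Pf; exists (Seq c d), (p + (q \Po r))%R => a x y.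
rewrite !pevalE; apply: ex_seq (Hc _ _ _) _; apply: ex_le (Hd _ _ _).
exact: peval_mono.
Qed.

(** The second component is computed first, on a copy, and ends up below the first; a final [true]
    turns the two consecutive codes into the code of a pair. *)
Lemma polytime_pair (f : A -> B) (g : A -> C) : polytime f -> polytime g ->
  polytime (fun a => (f a, g a)).
Proof.
move=> [c [p Hc]] [d [q Hd]].
exists (Seq copy_tree (Seq d (Seq (move_tree true) (Seq c (Push s0 true))))),
  (14%:P * 'X + 4%:P + (q + (12%:P * 'X + 4%:P + (p + 2%:P))))%R => a x y.
rewrite !pevalE.
apply: ex_seq (copy_treeP _ _ _) _; apply: ex_seq (Hd _ _ _) _.
apply: ex_seq (move1P _ _ _) _; apply: ex_seq (Hc _ _ _) _.
rewrite /= -catA; exact: ex_push.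
Qed.

Definition push_all (l : seq bool) : cmd :=
  foldr (fun b c => Seq c (Push s0 b)) skip l.

Lemma push_allP l x y : ex (push_all l) [:: x; y; [::]; [::]] (2 * size l + 1)
  [:: l ++ x; y; [::]; [::]].
Proof.
elim: l => [|b l IH] /=; first exact: ex_pop.
apply: (@ex_le _ _ ((2 * size l + 1) + 2)); first lia.
apply: ex_seq IH _; exact: ex_push.
Qed.

Lemma polytime_const (b : B) : polytime (fun _ : A => b).
Proof.
exists (Seq drop_tree (push_all (code (enc b)))),
  (9%:P * 'X + 4%:P + (2%:P * (sz b)%:P + 1%:P))%R => a x y.
rewrite !pevalE; apply: ex_seq (drop_treeP _ _ _) _; exact: push_allP.
Qed.

Lemma polytime_if (c : A -> bool) (f g : A -> B) :
  polytime c -> polytime f -> polytime g ->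
  polytime (fun a => if c a then f a else g a).
Proof.
move=> [c0 [p0 H0]] [c1 [p1 H1]] [c2 [p2 H2]].
exists (Seq copy_tree (Seq c0 (If s0 is_node
    (Seq drop_tree (Seq (move_tree true) c1))
    (Seq drop_tree (Seq (move_tree true) c2))))),
  (* The constant 31 is [9 * 3 + 4], the cost of dropping a boolean, whose code has at most three
     symbols. *)
  (14%:P * 'X + 4%:P + (p0 + (31%:P + (12%:P * 'X + 4%:P + (p1 + p2)) + 1%:P)))%R => a x y.
rewrite !pevalE.
apply: ex_seq (copy_treeP _ _ _) _; apply: ex_seq (H0 _ _ _) _.
rewrite addn1; apply: ex_if.
apply: (@ex_le _ _ (9 * sz (c a) + 4 + ((12 * sz a + 4) +
   (if c a then peval p1 (sz a) else peval p2 (sz a))))).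
  by rewrite /sz; case: (c a) => /=; lia.
case: (c a) => /=.
  by apply: ex_seq (drop_treeP (Node Leaf Leaf) _ _) _; apply: ex_seq (move1P _ _ _) _; apply: H1.
by apply: ex_seq (drop_treeP Leaf _ _) _; apply: ex_seq (move1P _ _ _) _; apply: H2.
Qed.

End Closure.

Lemma polytime_head : polytime (fun t : tree => if t is Node a b then a else Leaf).
Proof.
exists (If s0 is_node (Seq (Pop s0) (Seq (move_tree false) (Seq drop_tree (move_tree true)))) skip),
  (1%:P + (12%:P * 'X + 4%:P + (9%:P * 'X + 4%:P + (12%:P * 'X + 4%:P))) + 1%:P)%R => t x y.
rewrite !pevalE addn1; apply: ex_if; case: t => [|a b] /=.
  by apply: ex_le (ex_pop _ _); lia.
apply: (@ex_le _ _ (1 + ((12 * size (code a) + 4) + ((9 * size (code b) + 4) + (12 * size (code a) + 4))))).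
  by rewrite /sz /= size_cat; lia.
apply: ex_seq (ex_pop _ _) _; rewrite /put /get /= -catA.
apply: ex_seq (move0P _ _ _) _; apply: ex_seq (drop_treeP _ _ _) _; exact: move1P.
Qed.

Lemma polytime_tail : polytime (fun t : tree => if t is Node a b then b else Leaf).
Proof.
exists (If s0 is_node (Seq (Pop s0) drop_tree) skip),
  (1%:P + (9%:P * 'X + 4%:P) + 1%:P)%R => t x y.
rewrite !pevalE addn1; apply: ex_if; case: t => [|a b] /=.
  by apply: ex_le (ex_pop _ _); lia.
apply: (@ex_le _ _ (1 + (9 * size (code a) + 4))).
  by rewrite /sz /= size_cat; lia.
apply: ex_seq (ex_pop _ _) _; rewrite /put /get /= -catA; exact: drop_treeP.
Qed.

(* Polynomial time only sees encodings. *)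
Lemma polytime_cast {A A' B B' : encType}
    (f : A -> B) (f' : A' -> B') (i : A' -> A) :
  (forall a, enc (i a) = enc a) -> (forall a, enc (f' a) = enc (f (i a))) ->
  polytime f -> polytime f'.
Proof.
by move=> iE fE [c [p Hc]]; exists c, p => a x y; rewrite fE /sz -iE; apply: Hc.
Qed.

(** The accumulator waits on [s1] while the list is consumed on [s0]. Popping the [true] of a list
    cell exposes the code of its head; the accumulator is put in front of it and a [true] is pushed,
    which makes the pair that [c] expects. *)
Definition fold_cmd (c : cmd) : cmd :=
  Seq (Pop s0) (Seq (move_tree false) (Seq
    (While s0 is_node (Seq (Pop s0) (Seq (move_tree true) (Seq (Push s0 true)
       (Seq c (move_tree false))))))
    (Seq (Pop s0) (move_tree true)))).

Section Fold.
Context {A B : encType}.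
Variable f : B * A -> B.
Let F b l := foldl (fun b a => f (b, a)) b l.

Lemma sz_pair (b : B) (a : A) : sz (b, a) = (sz b + sz a).+1.
Proof. by rewrite /sz /= size_cat. Qed.

Lemma sz_cons (a : A) (l : seq A) : sz (a :: l) = (sz a + sz l).+1.
Proof. by rewrite /sz /= size_cat. Qed.

Lemma size_sz (l : seq A) : size l < sz l.
Proof. by elim: l => // a l IH; rewrite sz_cons /=; lia. Qed.

(** [M] bounds the list and all partial accumulators: an iteration costs at most two moves,
    [12 * M + 4] each, and a run of [c] on a pair of size at most [2 * M + 1]. *)
Lemma fold_loop c p M (Hc : forall a x y,
    ex c [:: code (enc a) ++ x; y; [::]; [::]] (peval p (sz a))
         [:: code (enc (f a)) ++ x; y; [::]; [::]]) l b x y :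
  (forall i, sz (F b (take i l)) <= M) -> sz l <= M ->
  ex (While s0 is_node (Seq (Pop s0) (Seq (move_tree true) (Seq (Push s0 true)
       (Seq c (move_tree false)))))) [:: code (enc l) ++ x; code (enc b) ++ y; [::]; [::]]
     (size l * (24 * M + peval p (2 * M + 1) + 12) + 1)
     [:: false :: x; code (enc (F b l)) ++ y; [::]; [::]].
Proof.
elim: l b => [|a l IH] b HM lM; first exact: ex_whileF.
rewrite sz_cons in lM.
have bM := HM 0; have fM := HM 1; rewrite /= take0 /= in bM fM.
apply: (@ex_le _ _ ((1 + ((12 * sz b + 4) + (2 + (peval p (sz (b, a)) + (12 * sz (f (b,a)) + 4))))) +
   (size l * (24 * M + peval p (2 * M + 1) + 12) + 1)).+1).
  have : peval p (sz (b, a)) <= peval p (2 * M + 1).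
    by apply: peval_mono; rewrite sz_pair; lia.
  rewrite /= mulSn; lia.
apply: (@ex_whileT _ _ _ _ [:: code (enc l) ++ x; code (enc (f (b,a))) ++ y; [::]; [::]]) => //.
  apply: ex_seq (ex_pop _ _) _; rewrite /put /get /= -catA.
  apply: ex_seq (move1P _ _ _) _; apply: ex_seq (ex_push _ _ _) _; rewrite /put /get /=.
  have Hca := Hc (b, a) (code (enc l) ++ x) y; rewrite /= -catA in Hca.
  by apply: ex_seq Hca _; apply: move0P.
apply: IH; last lia.
by move=> i; have := HM i.+1.
Qed.

(** The bound on the partial results is assumed for each input separately, because in
    [polytime_foldl] it only holds for accumulators that start from the prescribed initial value. *)
Lemma polytime_foldl_raw :
  polytime f -> forall q, exists (c : cmd) (p : {poly nat}), forall a x y,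
  (forall i, sz (F a.1 (take i a.2)) <= peval q (sz a)) ->
    ex c [:: code (enc a) ++ x; y; [::]; [::]] (peval p (sz a))
         [:: code (enc (F a.1 a.2)) ++ x; y; [::]; [::]].
Proof.
move=> [c [p Hc]] q; exists (fold_cmd c).
exists (1%:P + (12%:P * 'X + 4%:P + (('X * (24%:P * (q + 'X) + (p \Po (2%:P * (q + 'X) + 1%:P)) + 12%:P) + 1%:P) +
  (1%:P + (12%:P * q + 4%:P)))))%R => -[b l] x y /= HM.
have [Hb Hl] : sz b <= sz (b, l) /\ sz l <= sz (b, l).
  by rewrite /sz /= size_cat; lia.
have HF : sz (F b l) <= peval q (sz (b,l)) by have := HM (size l); rewrite take_size.
rewrite !pevalE; set M := peval q (sz (b, l)) + sz (b, l).
apply: (@ex_le _ _ (1 + ((12 * sz b + 4) + ((size l * (24 * M + peval p (2 * M + 1) + 12) + 1) +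
   (1 + (12 * sz (F b l) + 4)))))).
  rewrite -/M; set K := (24 * M + _ + 12).
  have : size l * K <= sz (b, l) * K by apply: leq_mul => //; have := size_sz l; lia.
  by move: (size l * K) (sz (b, l) * K) => k1 k2; lia.
apply: ex_seq (ex_pop _ _) _; rewrite /put /get /= -catA.
apply: ex_seq (move0P _ _ _) _.
have HL : forall i, sz (F b (take i l)) <= M by move=> i; have := HM i; rewrite /M; lia.
have lM : sz l <= M by rewrite /M; lia.
apply: ex_seq (fold_loop Hc _ _ HL lM) _.
apply: ex_seq (ex_pop _ _) _; rewrite /put /get /=; exact: move1P.
Qed.
End Fold.

Section FoldEnv.
Context {X A B : encType}.

Lemma polytime_fst : polytime (fun p : A * B => p.1).
Proof. exact: (polytime_cast (i := @enc (prod_encType A B)) _ _ polytime_head). Qed.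

Lemma polytime_snd : polytime (fun p : A * B => p.2).
Proof. exact: (polytime_cast (i := @enc (prod_encType A B)) _ _ polytime_tail). Qed.

Lemma polytime_id : polytime (fun a : A => a).
Proof. exact: polytime_enc. Qed.

End FoldEnv.

(** The environment [x] is carried along inside the accumulator, where every iteration can consult
    it. *)
Lemma polytime_foldl {X A B : encType}
    (f : X * B * A -> B) (z : X -> B) (s : X -> seq A) (q : {poly nat}) :
  polytime f -> polytime z -> polytime s ->
  (forall x i, sz (foldl (fun b a => f (x, b, a)) (z x) (take i (s x))) <= peval q (sz x)) ->
  polytime (fun x => foldl (fun b a => f (x, b, a)) (z x) (s x)).
Proof.
move=> Pf Pz Ps Hq.
pose g (w : X * B * A) : X * B := (w.1.1, f w).
have Pg : polytime g.
  by apply: polytime_pair Pf; apply: polytime_comp polytime_fst polytime_fst.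
pose init x := ((x, z x), s x).
have Pi : polytime init.
  by apply: polytime_pair Ps; apply: polytime_pair Pz; apply: polytime_id.
have gE x l b : foldl (fun b a => g (b, a)) (x, b) l =
    (x, foldl (fun b a => f (x, b, a)) b l).
  by elim: l b => //= a l IH b; rewrite IH.
pose h x := foldl (fun b a => g (b, a)) (init x).1 (init x).2.
suff Ph : polytime h.
  apply: (polytime_ext (f := fun x => (h x).2)); first by move=> x; rewrite /h gE.
  exact: polytime_comp polytime_snd Ph.
have [c [p Hc]] := polytime_foldl_raw Pg ('X + q + 1%:P)%R.
have [d [r Hd]] := Pi; have [t Ht] := polytime_size Pi.
exists (Seq d c), (r + (p \Po t))%R => x a b; rewrite !pevalE.
eapply ex_seq; first exact: (Hd x a b).
apply: (@ex_le _ _ (peval p (sz (init x)))); first exact: peval_mono.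
apply: Hc => i; rewrite /= gE sz_pair !pevalE; have := Hq x i.
have : sz x <= sz (init x) by rewrite !sz_pair; lia.
by move=> xi /leq_trans /(_ (peval_mono q xi)); lia.
Qed.

Lemma sz_take {A : encType} (l : seq A) i : sz (take i l) <= sz l.
Proof. by elim: l i => [|a l IH] [|i] //=; rewrite !sz_cons; have := IH i; lia. Qed.

(* Each step may add to the accumulator an amount polynomial in the data that
   does not change during the loop. *)
Lemma polytime_foldl_add {X A B : encType}
    (f : X * B * A -> B) (z : X -> B) (s : X -> seq A) (q : {poly nat}) :
  polytime f -> polytime z -> polytime s ->
  (forall x b a, sz (f (x, b, a)) <= sz b + peval q (sz x + sz a)) ->
  polytime (fun x => foldl (fun b a => f (x, b, a)) (z x) (s x)).
Proof.
move=> Pf Pz Ps Hq; have [p Hp] := polytime_size Pz; have [r Hr] := polytime_size Ps.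
apply: (polytime_foldl (q := p + r * (q \Po ('X + r)))%R) => // x i.
rewrite !pevalE; apply: leq_trans (_ : sz (z x) + sz (take i (s x)) * peval q (sz x + sz (take i (s x))) <= _); last first.
  have tr := leq_trans (sz_take (s x) i) (Hr x).
  apply: leq_add => //; apply: leq_mul => //.
  by apply: peval_mono; rewrite leq_add2l.
elim: (take i (s x)) (z x) => [|a l IH] b /=; first lia.
apply: leq_trans (IH _) _; rewrite sz_cons mulSn mulnDl.
have H1 : sz (f (x, b, a)) <= sz b + peval q (sz x + (sz a + sz l).+1).
  by apply: leq_trans (Hq x b a) _; rewrite leq_add2l; apply: peval_mono; lia.
have H2 : sz l * peval q (sz x + sz l) <= sz l * peval q (sz x + (sz a + sz l).+1).
  by rewrite leq_mul2l; apply/orP; right; apply: peval_mono; lia.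
move: H1 H2; move: (sz l * _) (sz l * _) (sz a * _) => k1 k2 k3; lia.
Qed.

(** A fold over [nseq n Leaf], a list that has the same code as the number [n]. *)
Lemma polytime_iter {X B : encType}
    (f : X * B -> B) (z : X -> B) (n : X -> nat) (q : {poly nat}) :
  polytime f -> polytime z -> polytime n ->
  (forall x i, i <= n x -> sz (iter i (fun b => f (x, b)) (z x)) <= peval q (sz x)) ->
  polytime (fun x => iter (n x) (fun b => f (x, b)) (z x)).
Proof.
move=> Pf Pz Pn Hq; pose s x := nseq (n x) Leaf.
have Ps : polytime s.
  apply: (polytime_cast (i := id) (f := n)) => // x.
  by rewrite /s; elim: (n x) => //= k IH; rewrite /enc /= -/enc IH.
have FE x k b : foldl (fun b (a : tree) => f (x, b)) b (nseq k Leaf) = iter k (fun b => f (x, b)) b.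
  by elim: k b => //= k IH b; rewrite IH -iterSr.
apply: (polytime_ext (f := fun x => foldl (fun b (a : tree) => f (x, b)) (z x) (s x))).
  by move=> x; rewrite FE.
apply: (polytime_foldl (q := q) (f := fun w : X * B * tree => f w.1)) => //.
  exact: polytime_comp Pf polytime_fst.
move=> x i; rewrite /s /=.
have -> : take i (nseq (n x) Leaf) = nseq (minn i (n x)) Leaf.
  by elim: (n x) i => [|k IH] [|i] //=; rewrite minnSS /= IH.
by rewrite FE; apply: Hq; apply: geq_minr.
Qed.

(** * Conversion between words on tapes and codes of trees *)

Definition pour_raw (i j : 'I_4) : cmd :=
  While i nonempty
    (If i is_node (Seq (Pop i) (Push j true)) (Seq (Pop i) (Push j false))).

(** The code of a list is built from its end, so the bits must come in reverse order, which the
    preceding [pour_raw] provides. A list cell holding [true] takes four symbols, one holding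
    [false] takes two. *)
Definition encode_raw (i : 'I_4) : cmd :=
  While i nonempty
    (If i is_node
      (Seq (Pop i) (Seq (Push s0 false) (Seq (Push s0 false) (Seq (Push s0 true) (Push s0 true)))))
      (Seq (Pop i) (Seq (Push s0 false) (Push s0 true)))).

Definition read_input : cmd :=
  Seq (pour_raw s0 s3) (Seq (pour_raw s1 s2) (Seq (Push s0 false) (Seq (encode_raw s2)
    (Seq (Push s0 false) (Seq (encode_raw s3) (Push s0 true)))))).

Definition write_output : cmd :=
  Seq (While s0 is_node (Seq (Pop s0) (If s0 is_node
        (Seq (Pop s0) (Seq (Pop s0) (Seq (Pop s0) (Push s2 true))))
        (Seq (Pop s0) (Push s2 false)))))
  (Seq (Pop s0) (pour false)).

Lemma pour_raw03 x y k l : ex (pour_raw s0 s3) [:: x; y; k; l] (5 * size x + 1) [:: [::]; y; k; rev x ++ l].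
Proof.
elim: x l => [|a x IH] l; first exact: ex_whileF.
apply: (@ex_le _ _ (4 + (5 * size x + 1)).+1); first by rewrite /=; lia.
apply: (@ex_whileT _ _ _ _ [:: x; y; k; a :: l]) => //.
  by case: a {IH}; apply: ex_if => /=; apply: (@ex_le _ _ (1 + 2)) => //; ex_step.
by rewrite rev_cons cat_rcons; apply: IH.
Qed.

Lemma pour_raw12 x y k l : ex (pour_raw s1 s2) [:: x; y; k; l] (5 * size y + 1) [:: x; [::]; rev y ++ k; l].
Proof.
elim: y k => [|a y IH] k; first exact: ex_whileF.
apply: (@ex_le _ _ (4 + (5 * size y + 1)).+1); first by rewrite /=; lia.
apply: (@ex_whileT _ _ _ _ [:: x; y; a :: k; l]) => //.
  by case: a {IH}; apply: ex_if => /=; apply: (@ex_le _ _ (1 + 2)) => //; ex_step.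
by rewrite rev_cons cat_rcons; apply: IH.
Qed.

Lemma encode_raw2 (w : seq bool) x k l z : ex (encode_raw s2) [:: code (enc w) ++ x; z; k; l]
  (11 * size k + 1) [:: code (enc (catrev k w)) ++ x; z; [::]; l].
Proof.
elim: k w => [|a k IH] w; first exact: ex_whileF.
apply: (@ex_le _ _ (10 + (11 * size k + 1)).+1); first by rewrite /=; lia.
apply: (@ex_whileT _ _ _ _ [:: code (enc (a :: w)) ++ x; z; k; l]) => //.
  case: a {IH}; apply: ex_if => /=; first by apply: (@ex_le _ _ (1 + (2 + (2 + (2 + 2))))) => //; ex_step.
  by apply: (@ex_le _ _ (1 + (2 + 2))) => //; ex_step.
Qed.

Lemma encode_raw3 (w : seq bool) x k l z : ex (encode_raw s3) [:: code (enc w) ++ x; z; k; l]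
  (11 * size l + 1) [:: code (enc (catrev l w)) ++ x; z; k; [::]].
Proof.
elim: l w => [|a l IH] w; first exact: ex_whileF.
apply: (@ex_le _ _ (10 + (11 * size l + 1)).+1); first by rewrite /=; lia.
apply: (@ex_whileT _ _ _ _ [:: code (enc (a :: w)) ++ x; z; k; l]) => //.
  case: a {IH}; apply: ex_if => /=; first by apply: (@ex_le _ _ (1 + (2 + (2 + (2 + 2))))) => //; ex_step.
  by apply: (@ex_le _ _ (1 + (2 + 2))) => //; ex_step.
Qed.

Lemma read_inputP (x y : seq bool) : ex read_input [:: x; y; [::]; [::]] (16 * (size x + size y) + 10)
  [:: code (enc (x, y)); [::]; [::]; [::]].
Proof.
apply: (@ex_le _ _ ((5 * size x + 1) + ((5 * size y + 1) + (2 + ((11 * size (rev y) + 1) + (2 + ((11 * size (rev x) + 1) + 2))))))).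
  by rewrite !size_rev; lia.
apply: ex_seq (pour_raw03 _ _ _ _) _; apply: ex_seq (pour_raw12 _ _ _ _) _; rewrite !cats0.
apply: ex_seq (ex_push _ _ _) _; rewrite /put /get /=.
apply: ex_seq (@encode_raw2 [::] [::] (rev y) _ _) _.
apply: ex_seq (ex_push _ _ _) _; rewrite /put /get /=.
apply: ex_seq (@encode_raw3 [::] _ _ _ _) _; rewrite !catrevE !cats0 !revK.
exact: ex_push.
Qed.

Lemma write_outputP (w : seq bool) : ex write_output [:: code (enc w); [::]; [::]; [::]]
  (15 * size w + 10) [:: w; [::]; [::]; [::]].
Proof.
apply: (@ex_le _ _ ((10 * size w + 1) + (1 + (5 * size (rev w) + 1)))).
  by rewrite size_rev; lia.
apply: (@ex_seq _ _ _ [:: [:: false]; [::]; rev w; [::]]); last first.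
  apply: ex_seq (ex_pop _ _) _; rewrite /put /get /=.
  by rewrite -[w in X in ex _ _ _ X]revK -[rev (rev w)]cats0; apply: (pourP false).
rewrite -[rev w]cats0; pose k : seq bool := [::]; rewrite -[X in [:: _; _; X; _]]/k -[X in _ ++ X]/k.
elim: w k => [|a w IH] k; first exact: ex_whileF.
apply: (@ex_le _ _ (9 + (10 * size w + 1)).+1); first by rewrite /=; lia.
apply: (@ex_whileT _ _ _ _ [:: code (enc w); [::]; a :: k; [::]]) => //; last first.
  by rewrite rev_cons cat_rcons; apply: IH.
apply: (@ex_le _ _ (1 + 8)) => //; apply: ex_seq (ex_pop _ _) _.
case: a {IH}; apply: ex_if; rewrite /put /get /=.
  by apply: (@ex_le _ _ (1 + (1 + (1 + 2)))) => //; ex_step.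
by apply: (@ex_le _ _ (1 + 2)) => //; ex_step.
Qed.

Lemma polytime_main (g : seq bool * seq bool -> seq bool) : polytime g ->
  exists c p, forall x y,
    ex c [:: x; y; [::]; [::]] (peval p (size x + size y)) [:: g (x, y); [::]; [::]; [::]].
Proof.
move=> Pg; have [r Hr] := polytime_size Pg; have [c [p Hc]] := Pg.
exists (Seq read_input (Seq c write_output)),
  (16%:P * 'X + 10%:P + ((p \Po (4%:P * 'X + 3%:P)) + (15%:P * (r \Po (4%:P * 'X + 3%:P)) + 10%:P)))%R.
move=> x y; rewrite !pevalE.
have szb (w : seq bool) : sz w <= 4 * size w + 1.
  by elim: w => // b w IH; rewrite sz_cons /=; case: b; rewrite /sz /= in IH *; lia.
have szxy : sz (x, y) <= 4 * (size x + size y) + 3.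
  by rewrite sz_pair; have := szb x; have := szb y; lia.
apply: ex_seq (read_inputP _ _) _.
have := Hc (x, y) [::] [::]; rewrite !cats0 => H1.
apply: (@ex_seq _ _ _ [:: code (enc (g (x, y))); [::]; [::]; [::]]).
  apply: ex_le H1; exact: peval_mono.
apply: ex_le (write_outputP _); apply: leq_add => //; apply: leq_mul => //.
by apply: ltnW (leq_trans (size_sz _) (leq_trans (Hr (x, y)) (peval_mono r _))).
Qed.

Lemma polytime_function_intro (f : seq bool -> seq bool) :
  polytime f -> polytime_function f.
Proof.
move=> Pf; have [c [p Hc]] := polytime_main (polytime_comp Pf polytime_fst).
exists (machine_of c), p => x; have [n np H] := Hc x [::]; rewrite addn0 in np.
by rewrite /outputs_within initial1; apply: exec_outputs H np _.
Qed.

Lemma polytime_relation_intro (R : seq bool -> seq bool -> bool) :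
  polytime (fun xy : seq bool * seq bool => R xy.1 xy.2) -> polytime_relation R.
Proof.
move=> PR.
have [|c [p Hc]] := @polytime_main (fun xy => [:: R xy.1 xy.2]).
  (* The one-letter list [[:: b]] has the same code as the pair [(b, Leaf)]. *)
  apply: (polytime_cast (A := prod_encType (seq_encType bool_encType) (seq_encType bool_encType)) (f := fun xy => (R xy.1 xy.2, Leaf)) (i := id)) => //.
  by apply: polytime_pair PR _; apply: polytime_const.
by exists (machine_of c), p => x y; have [n np H] := Hc x y; apply: exec_outputs H np _.
Qed.

(** * Basic functions computable in polynomial time *)

Lemma sz_nat (n : nat) : sz n = 2 * n + 1.
Proof. by rewrite /sz; elim: n => //= n ->; lia. Qed.

Lemma sz_bool (b : bool) : sz b <= 3.
Proof. by case: b. Qed.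

Lemma sz_gt0 (A : encType) (a : A) : 0 < sz a.
Proof. exact: code_gt0. Qed.

Lemma polytime_is_node : polytime (fun t : tree => if t is Node _ _ then true else false).
Proof.
exists (If s0 is_node (Seq drop_tree (push_all [:: true; false; false])) skip),
  (9%:P * 'X + 4%:P + 7%:P + 1%:P)%R => t x y.
rewrite !pevalE addn1; apply: ex_if; case: t => [|a b] /=.
  by apply: ex_le (ex_pop _ _); lia.
apply: ex_seq (drop_treeP (Node a b) _ _) _; exact: (push_allP [:: true; false; false]).
Qed.

Lemma polytime_op2 {X A B C : encType} (op : A -> B -> C) (f : X -> A) (g : X -> B) :
  polytime (fun p : A * B => op p.1 p.2) -> polytime f -> polytime g ->
  polytime (fun x => op (f x) (g x)).
Proof. by move=> Ho Hf Hg; apply: (polytime_comp (g := fun p => op p.1 p.2)) Ho (polytime_pair Hf Hg). Qed.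

Lemma polytime_compfst {X A B : encType} (f : X -> A * B) : polytime f -> polytime (fun x => (f x).1).
Proof. exact: polytime_comp polytime_fst. Qed.

Lemma polytime_compsnd {X A B : encType} (f : X -> A * B) : polytime f -> polytime (fun x => (f x).2).
Proof. exact: polytime_comp polytime_snd. Qed.

Section Env.
Variable X : encType.
Implicit Types (c d : X -> bool) (m n : X -> nat).

Lemma polytime_negb c : polytime c -> polytime (fun x => ~~ c x).
Proof.
move=> H; apply: (polytime_ext (f := fun x => if c x then false else true)).
  by move=> x; case: (c x).
by apply: polytime_if => //; apply: polytime_const.
Qed.

Lemma polytime_andb c d : polytime c -> polytime d -> polytime (fun x => c x && d x).
Proof.
move=> H K; apply: (polytime_ext (f := fun x => if c x then d x else false)) => //.
by apply: polytime_if => //; apply: polytime_const.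
Qed.

Lemma polytime_orb c d : polytime c -> polytime d -> polytime (fun x => c x || d x).
Proof.
move=> H K; apply: (polytime_ext (f := fun x => if c x then true else d x)) => //.
by apply: polytime_if => //; apply: polytime_const.
Qed.

Lemma polytime_implyb c d : polytime c -> polytime d -> polytime (fun x => c x ==> d x).
Proof.
move=> H K; apply: (polytime_ext (f := fun x => if c x then d x else true)) => //.
by apply: polytime_if => //; apply: polytime_const.
Qed.

Lemma polytime_eqb c d : polytime c -> polytime d -> polytime (fun x => c x == d x).
Proof.
move=> H K; apply: (polytime_ext (f := fun x => if c x then d x else ~~ d x)).
  by move=> x; case: (c x); case: (d x).
by apply: polytime_if => //; apply: polytime_negb.
Qed.

Lemma polytime_cons (A : encType) (f : X -> A) (s : X -> seq A) :
  polytime f -> polytime s -> polytime (fun x => f x :: s x).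
Proof.
move=> H K; apply: (polytime_cast (f := fun x => (f x, s x)) (i := id)) => //.
exact: polytime_pair.
Qed.

Lemma polytime_S n : polytime n -> polytime (fun x => (n x).+1).
Proof.
move=> H; apply: (polytime_cast (f := fun x => (Leaf, n x)) (i := id)) => //.
by apply: polytime_pair => //; apply: polytime_const.
Qed.

Lemma polytime_pred n : polytime n -> polytime (fun x => (n x).-1).
Proof.
apply: polytime_comp; apply: (polytime_cast (i := @enc nat_encType) _ _ polytime_tail) => //.
by case.
Qed.

Lemma polytime_behead (A : encType) (s : X -> seq A) : polytime s -> polytime (fun x => behead (s x)).
Proof.
apply: polytime_comp; apply: (polytime_cast (i := @enc (seq_encType A)) _ _ polytime_tail) => //.
by case.
Qed.

Lemma polytime_head_seq (A : encType) (a : X -> A) (s : X -> seq A) :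
  polytime a -> polytime s -> polytime (fun x => head (a x) (s x)).
Proof.
apply: polytime_op2.
pose h (t : tree) := if t is Node a b then a else Leaf.
apply: (polytime_cast (A := prod_encType tree_encType tree_encType) (B := tree_encType)
   (i := fun p : A * seq A => (enc p.1, enc p.2))
   (f := fun p => if (if p.2 is Node _ _ then true else false) then h p.2 else p.1)) => //.
  by case=> d [|x l].
apply: polytime_if; last exact: polytime_fst.
  by apply: polytime_comp polytime_is_node _; apply: polytime_snd.
exact: (polytime_comp polytime_head polytime_snd).
Qed.

End Env.

Section Env1.
Variable X : encType.
Implicit Types (c d : X -> bool) (m n : X -> nat).

Lemma polytime_addn m n : polytime m -> polytime n -> polytime (fun x => m x + n x).
Proof.
apply: polytime_op2.
apply: (polytime_ext (f := fun p : nat * nat => iter p.1 (fun k => k.+1) p.2)).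
  by move=> [a b] /=; elim: a => //= a ->.
apply: (@polytime_iter _ _ (fun p : nat * nat * nat => p.2.+1) _ _ ('X + 'X)%R).
- by apply: polytime_S; apply: polytime_snd.
- exact: polytime_snd.
- exact: polytime_fst.
move=> [a b] i /= ia; rewrite !pevalE sz_pair !sz_nat.
have -> : iter i (fun k => k.+1) b = i + b by elim: i {ia} => //= i ->.
lia.
Qed.

Lemma polytime_subn m n : polytime m -> polytime n -> polytime (fun x => m x - n x).
Proof.
apply: polytime_op2.
apply: (polytime_ext (f := fun p : nat * nat => iter p.2 (fun k => k.-1) p.1)).
  by move=> [a b] /=; elim: b => [|b] /=; [rewrite subn0|rewrite subnS => ->].
apply: (@polytime_iter _ _ (fun p : nat * nat * nat => p.2.-1) _ _ ('X)%R).
- by apply: polytime_pred; apply: polytime_snd.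
- exact: polytime_fst.
- exact: polytime_snd.
move=> [a b] i /= _; rewrite !pevalE sz_pair !sz_nat.
have : iter i (fun k => k.-1) a <= a by elim: i => //= i; lia.
lia.
Qed.

Lemma polytime_leq m n : polytime m -> polytime n -> polytime (fun x => m x <= n x).
Proof.
move=> H K; have P := polytime_subn H K.
apply: (polytime_ext (f := fun x => ~~ (if enc (m x - n x) is Node _ _ then true else false))).
  by move=> x; rewrite /leq; case: (m x - n x).
apply: polytime_negb; apply: polytime_comp polytime_is_node _.
exact: (polytime_cast (i := id) (f := fun x => m x - n x) _ _ P).
Qed.

Lemma polytime_eqn m n : polytime m -> polytime n -> polytime (fun x => m x == n x).
Proof.
move=> H K; apply: (polytime_ext (f := fun x => (m x <= n x) && (n x <= m x))).
  by move=> x; rewrite eqn_leq.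
by apply: polytime_andb; apply: polytime_leq.
Qed.

End Env1.

Section Env2.
Variable X : encType.
Implicit Types (c d : X -> bool) (m n : X -> nat).

Lemma polytime_muln m n : polytime m -> polytime n -> polytime (fun x => m x * n x).
Proof.
apply: polytime_op2.
apply: (polytime_ext (f := fun p : nat * nat => iter p.1 (fun k => p.2 + k) 0)).
  by move=> [a b] /=; elim: a => //= a ->; rewrite mulSn.
apply: (@polytime_iter _ _ (fun p : nat * nat * nat => p.1.2 + p.2) _ _ ('X * 'X + 1%:P)%R).
- by apply: polytime_addn polytime_snd; apply: polytime_comp polytime_snd polytime_fst.
- exact: polytime_const.
- exact: polytime_fst.
move=> [a b] i /= ia; rewrite !pevalE sz_pair !sz_nat.
have -> : iter i (fun k => b + k) 0 = i * b by elim: i {ia} => //= i ->; rewrite mulSn.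
have : i * b <= a * b by rewrite leq_mul2r ia orbT.
by nia.
Qed.

Variable A : encType.

Lemma polytime_catrev (s t : X -> seq A) : polytime s -> polytime t -> polytime (fun x => catrev (s x) (t x)).
Proof.
apply: polytime_op2.
apply: (polytime_ext (f := fun p : seq A * seq A => foldl (fun l a => a :: l) p.2 p.1)).
  by move=> [a b] /=; elim: a b => //= x a IH b; rewrite IH.
apply: (@polytime_foldl_add _ _ _ (fun p : seq A * seq A * seq A * A => p.2 :: p.1.2) _ _ ('X + 1%:P)%R).
- by apply: polytime_cons polytime_snd _; apply: polytime_comp polytime_snd polytime_fst.
- exact: polytime_snd.
- exact: polytime_fst.
by move=> x b a /=; rewrite sz_cons !pevalE; lia.
Qed.

Lemma polytime_rev (s : X -> seq A) : polytime s -> polytime (fun x => rev (s x)).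
Proof. by move=> H; apply: polytime_catrev => //; apply: polytime_const. Qed.

Lemma polytime_cat (s t : X -> seq A) : polytime s -> polytime t -> polytime (fun x => s x ++ t x).
Proof.
move=> Hs Ht; apply: (polytime_ext (f := fun x => catrev (rev (s x)) (t x))).
  by move=> x; rewrite catrevE revK.
by apply: polytime_catrev => //; apply: polytime_rev.
Qed.

Lemma sz_cat (s t : seq A) : sz (s ++ t) = (sz s + sz t).-1.
Proof.
have st (s' : seq A) : 0 < sz s' by apply: sz_gt0.
elim: s => [|a s IH]; first by rewrite /sz.
by rewrite cat_cons !sz_cons IH; move: (st s) (st t); lia.
Qed.

Lemma polytime_size_seq (s : X -> seq A) : polytime s -> polytime (fun x => size (s x)).
Proof.
apply: polytime_comp.
apply: (polytime_ext (f := fun s : seq A => foldl (fun l a => l.+1) 0 s)).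
  by move=> a; rewrite -[size a]addn0; elim: a 0 => //= x a IH b; rewrite IH addnS.
apply: (@polytime_foldl_add _ _ _ (fun p : seq A * nat * A => p.1.2.+1) _ _ (2%:P)%R).
- by apply: polytime_S; apply: polytime_comp polytime_snd polytime_fst.
- exact: polytime_const.
- exact: polytime_id.
by move=> x b a /=; rewrite !sz_nat !pevalE; lia.
Qed.

Lemma polytime_drop n (s : X -> seq A) : polytime n -> polytime s -> polytime (fun x => drop (n x) (s x)).
Proof.
apply: polytime_op2.
apply: (polytime_ext (f := fun p : nat * seq A => iter p.1 behead p.2)).
  by move=> [a b] /=; elim: a b => [|a IH] b; rewrite ?drop0 // iterSr IH; case: b.
apply: (@polytime_iter _ _ (fun p : nat * seq A * seq A => behead p.2) _ _ ('X)%R).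
- by apply: polytime_behead; apply: polytime_snd.
- exact: polytime_snd.
- exact: polytime_fst.
move=> [a b] i /= _; rewrite !pevalE sz_pair.
apply: (@leq_trans (sz b)); last by lia.
by elim: i => //= i; case: (iter i _ _) => // y l; rewrite sz_cons /=; lia.
Qed.

Lemma polytime_nth n (a : X -> A) (s : X -> seq A) : polytime n -> polytime a -> polytime s ->
  polytime (fun x => nth (a x) (s x) (n x)).
Proof.
move=> Hn Ha Hs; apply: (polytime_ext (f := fun x => head (a x) (drop (n x) (s x)))).
  by move=> x; rewrite -nth0 nth_drop addn0.
by apply: polytime_head_seq => //; apply: polytime_drop.
Qed.

Lemma polytime_nseq n (a : X -> A) : polytime n -> polytime a -> polytime (fun x => nseq (n x) (a x)).
Proof.
apply: polytime_op2.
apply: (polytime_ext (f := fun p : nat * A => iter p.1 (fun l => p.2 :: l) [::])).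
  by move=> [a' b] /=; elim: a' => //= k ->.
apply: (@polytime_iter _ _ (fun p : nat * A * seq A => p.1.2 :: p.2) _ _ ('X * ('X + 1%:P) + 1%:P)%R).
- by apply: polytime_cons polytime_snd; apply: polytime_comp polytime_snd polytime_fst.
- exact: polytime_const.
- exact: polytime_fst.
move=> [k b] i /= ik; rewrite !pevalE sz_pair sz_nat.
have : sz (iter i (fun l => b :: l) [::]) <= i * (sz b + 1) + 1.
  by elim: i {ik} => //= i IH; rewrite sz_cons; lia.
have : i * (sz b + 1) <= k * (sz b + 1) by rewrite leq_mul2r ik orbT.
by nia.
Qed.

End Env2.

Section Loops.
Variables (X A B : encType).

Lemma polytime_map (f : X * A -> B) (s : X -> seq A) :
  polytime f -> polytime s -> polytime (fun x => map (fun a => f (x, a)) (s x)).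
Proof.
move=> Hf Hs; have [p Hp] := polytime_size Hf.
apply: (polytime_ext (f := fun x => rev (foldl (fun l a => f (x, a) :: l) [::] (s x)))).
  move=> x; rewrite -[RHS]revK; congr rev.
  rewrite -[RHS]cats0 -map_rev.
  elim: (s x) [::] => //= a l IH k; rewrite IH rev_cons map_rcons cat_rcons //.
apply: polytime_rev.
apply: (@polytime_foldl_add _ _ _ (fun w : X * seq B * A => f (w.1.1, w.2) :: w.1.2) _ _ (p \Po ('X + 1%:P) + 1%:P)%R) => //.
- apply: polytime_cons.
    apply: polytime_comp Hf _; apply: polytime_pair polytime_snd.
    exact: polytime_comp polytime_fst polytime_fst.
  exact: polytime_comp polytime_snd polytime_fst.
- exact: polytime_const.
move=> x b a; rewrite sz_cons !pevalE /=; have := Hp (x, a); rewrite sz_pair.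
set k := peval p _; set k' := peval p _.
have -> : k' = k by rewrite /k' /k; congr peval; lia.
lia.
Qed.

Lemma polytime_flatten (s : X -> seq (seq A)) : polytime s -> polytime (fun x => flatten (s x)).
Proof.
apply: polytime_comp.
apply: (polytime_ext (f := fun s : seq (seq A) => foldl (fun l a => l ++ a) [::] s)).
  by move=> a; rewrite -[flatten a]cat0s; elim: a [::] => [|x a IH] b /=; rewrite ?cats0 // IH catA.
apply: (@polytime_foldl_add _ _ _ (fun p : seq (seq A) * seq A * seq A => p.1.2 ++ p.2) _ _ ('X)%R).
- by apply: polytime_cat polytime_snd; apply: polytime_comp polytime_snd polytime_fst.
- exact: polytime_const.
- exact: polytime_id.
by move=> x b a /=; rewrite sz_cat !pevalE; lia.
Qed.

Lemma polytime_has (f : X * A -> bool) (s : X -> seq A) :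
  polytime f -> polytime s -> polytime (fun x => has (fun a => f (x, a)) (s x)).
Proof.
move=> Hf Hs.
apply: (polytime_ext (f := fun x => foldl (fun b a => b || f (x, a)) false (s x))).
  move=> x; rewrite -[RHS]orFb; elim: (s x) false => [|a l IH] b /=; rewrite ?orbF // IH orbA //.
apply: (@polytime_foldl _ _ _ (fun w : X * bool * A => w.1.2 || f (w.1.1, w.2)) _ _ (3%:P)%R) => //.
- apply: polytime_orb; first exact: polytime_comp polytime_snd polytime_fst.
  apply: polytime_comp Hf _; apply: polytime_pair polytime_snd.
  exact: polytime_comp polytime_fst polytime_fst.
- exact: polytime_const.
by move=> x i; rewrite pevalE; apply: sz_bool.
Qed.

Lemma polytime_all (f : X * A -> bool) (s : X -> seq A) :
  polytime f -> polytime s -> polytime (fun x => all (fun a => f (x, a)) (s x)).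
Proof.
move=> Hf Hs.
apply: (polytime_ext (f := fun x => ~~ has (fun a => ~~ f (x, a)) (s x))).
  by move=> x; rewrite has_predC negbK.
apply: polytime_negb; apply: (@polytime_has (fun w => ~~ f w)) => //; exact: polytime_negb.
Qed.

Lemma polytime_filter (f : X * A -> bool) (s : X -> seq A) :
  polytime f -> polytime s -> polytime (fun x => filter (fun a => f (x, a)) (s x)).
Proof.
move=> Hf Hs.
apply: (polytime_ext (f := fun x => rev (foldl (fun l a => if f (x, a) then a :: l else l) [::] (s x)))).
  move=> x; rewrite -[RHS]revK; congr rev.
  rewrite -[RHS]cats0 -filter_rev.
  elim: (s x) [::] => //= a l IH k; rewrite IH rev_cons filter_rcons; case: ifP => //.
  by rewrite cat_rcons.
apply: polytime_rev.
apply: (@polytime_foldl_add _ _ _ (fun w : X * seq A * A => if f (w.1.1, w.2) then w.2 :: w.1.2 else w.1.2) _ _ ('X + 1%:P)%R) => //.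
- apply: polytime_if; last exact: polytime_comp polytime_snd polytime_fst.
    apply: polytime_comp Hf _; apply: polytime_pair polytime_snd.
    exact: polytime_comp polytime_fst polytime_fst.
  apply: polytime_cons polytime_snd _; exact: polytime_comp polytime_snd polytime_fst.
- exact: polytime_const.
by move=> x b a /=; case: ifP => _; rewrite ?sz_cons !pevalE /=; lia.
Qed.

Lemma polytime_count (f : X * A -> bool) (s : X -> seq A) :
  polytime f -> polytime s -> polytime (fun x => count (fun a => f (x, a)) (s x)).
Proof.
move=> Hf Hs.
apply: (polytime_ext (f := fun x => size (filter (fun a => f (x, a)) (s x)))).
  by move=> x; rewrite size_filter.
by apply: polytime_size_seq; apply: polytime_filter.
Qed.

End Loops.

Lemma count_ltn_iota k n : k <= n -> count (fun i => i < k) (iota 0 n) = k.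
Proof.
move=> kn; rewrite -(subnKC kn) iotaD count_cat.
rewrite (eq_in_count (a2 := predT)) ?count_predT ?size_iota => [|i]; last first.
  by rewrite mem_iota /= add0n => ->.
rewrite (eq_in_count (a2 := pred0)) ?count_pred0 ?addn0 // => i.
by rewrite mem_iota => /andP[K _]; apply/negbTE; rewrite -leqNgt.
Qed.

Section Iota.
Variable X : encType.
Implicit Types (c d : X -> bool) (m n : X -> nat).

Lemma polytime_iota0 n : polytime n -> polytime (fun x => iota 0 (n x)).
Proof.
apply: polytime_comp.
apply: (polytime_ext (f := fun n : nat => rev (iter n (fun l : seq nat => size l :: l) [::]))).
  move=> k; rewrite -[RHS]revK; congr rev.
  by elim: k => //= k ->; rewrite size_rev size_iota -[0 :: _]/(iota 0 k.+1) -addn1 iotaD rev_cat.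
apply: polytime_rev.
apply: (@polytime_iter _ _ (fun p : nat * seq nat => size p.2 :: p.2) _ _ ('X * 'X + 1%:P)%R).
- by apply: polytime_cons polytime_snd; apply: polytime_size_seq polytime_snd.
- exact: polytime_const.
- exact: polytime_id.
move=> k i ik; rewrite !pevalE sz_nat.
have Hs j : size (iter j (fun l : seq nat => size l :: l) [::]) = j by elim: j => //= j ->.
apply: (@leq_trans (i * (2 * i + 1) + 1)).
  by elim: i {ik} => //= i IH; rewrite sz_cons sz_nat Hs; nia.
by have : i * (2 * i + 1) <= k * (2 * k + 1); [apply: leq_mul; lia|nia].
Qed.

(** For a nonzero divisor, the quotient is the number of [i] with [i.+1 * n <= m], and all of them
    are below [m]. *)
Lemma polytime_divn m n : polytime m -> polytime n -> polytime (fun x => m x %/ n x).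
Proof.
move=> Hm Hn.
apply: (polytime_ext (f := fun x => if n x == 0 then 0 else count (fun i => i.+1 * n x <= m x) (iota 0 (m x)))).
  move=> x; case: eqP => [->|/eqP]; rewrite ?divn0 // -lt0n => n0.
  rewrite (eq_count (a2 := fun i => i < m x %/ n x)); last by move=> i /=; rewrite leq_divRL.
  have : m x %/ n x <= m x by apply: leq_div.
  exact: count_ltn_iota.
apply: polytime_if; last 1 first.
- apply: (@polytime_count _ _ (fun w : X * nat => w.2.+1 * n w.1 <= m w.1)).
    apply: polytime_leq; last exact: polytime_comp Hm polytime_fst.
    by apply: polytime_muln; [apply: polytime_S polytime_snd|apply: polytime_comp Hn polytime_fst].
  exact: polytime_iota0.
- by apply: polytime_eqn => //; apply: polytime_const.
- exact: polytime_const.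
Qed.

Lemma polytime_modn m n : polytime m -> polytime n -> polytime (fun x => m x %% n x).
Proof.
move=> Hm Hn; apply: (polytime_ext (f := fun x => m x - m x %/ n x * n x)).
  by move=> x; rewrite {1}(divn_eq (m x) (n x)) addKn.
by apply: polytime_subn => //; apply: polytime_muln => //; apply: polytime_divn.
Qed.

Lemma polytime_odd n : polytime n -> polytime (fun x => odd (n x)).
Proof.
move=> Hn; apply: (polytime_ext (f := fun x => n x %% 2 == 1)).
  by move=> x; rewrite modn2 eqb1.
by apply: polytime_eqn; [apply: polytime_modn => //|]; apply: polytime_const.
Qed.

Lemma polytime_half n : polytime n -> polytime (fun x => (n x)./2).
Proof.
move=> Hn; apply: (polytime_ext (f := fun x => n x %/ 2)); first by move=> x; rewrite divn2.
by apply: polytime_divn => //; apply: polytime_const.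
Qed.

Lemma polytime_peval p n : polytime n -> polytime (fun x => peval p (n x)).
Proof.
move=> Hn; elim/poly_ind: p => [|p a IH].
  by apply: (polytime_ext (f := fun=> 0)) => [x|]; rewrite ?/peval ?horner0 //; apply: polytime_const.
apply: (polytime_ext (f := fun x => peval p (n x) * n x + a)).
  by move=> x; rewrite !pevalE.
by apply: polytime_addn; [apply: polytime_muln|apply: polytime_const].
Qed.

Lemma polytime_eq_bits (s t : X -> seq bool) : polytime s -> polytime t -> polytime (fun x => s x == t x).
Proof.
move=> Hs Ht; apply: (polytime_ext (f := fun x => (size (s x) == size (t x)) &&
   all (fun i => nth false (s x) i == nth false (t x) i) (iota 0 (size (s x))))).
  move=> x; apply/idP/eqP => [/andP[/eqP H /allP K]|->]; last by rewrite eqxx; apply/allP.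
  by apply: (eq_from_nth (x0 := false)) => // i Hi; apply/eqP/K; rewrite mem_iota add0n.
apply: polytime_andb; first by apply: polytime_eqn; apply: polytime_size_seq.
apply: (@polytime_all _ _ (fun w : X * nat => nth false (s w.1) w.2 == nth false (t w.1) w.2)).
  apply: polytime_eqb; apply: polytime_nth polytime_snd (polytime_const _) _.
    exact: polytime_comp Hs polytime_fst.
  exact: polytime_comp Ht polytime_fst.
by apply: polytime_iota0; apply: polytime_size_seq.
Qed.

End Iota.

(** Hook of [pt], redefined whenever further functions have been shown to be computable in
    polynomial time. *)
Ltac pt_user := fail.

(** The search follows the syntax of the function. The variable of an inner loop is paired with the
    environment, and goals that no rule matches are left open. *)
Ltac pt :=
  cbv beta;
  lazymatch goal with
  | |- polytime (fun _ => ?b) => exact: polytime_const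
  | |- polytime (fun x => x) => exact: polytime_id
  | H : polytime ?f |- polytime ?f => exact: H
  | |- polytime fst => exact: polytime_fst
  | |- polytime snd => exact: polytime_snd
  | |- polytime (fun x => (@?f x).1) => apply: (@polytime_compfst _ _ _ f); pt
  | |- polytime (fun x => (@?f x).2) => apply: (@polytime_compsnd _ _ _ f); pt
  | |- polytime (fun x => (@?f x, @?g x)) => apply: (@polytime_pair _ _ _ f g); pt
  | |- polytime (fun x => if _ then _ else _) => apply: polytime_if; pt
  | |- polytime (fun x => ~~ @?f x) => apply: (@polytime_negb _ f); pt
  | |- polytime (fun x => (@?f x) && (@?g x)) => apply: (@polytime_andb _ f g); pt
  | |- polytime (fun x => (@?f x) || (@?g x)) => apply: (@polytime_orb _ f g); pt
  | |- polytime (fun x => (@?f x) ==> (@?g x)) => apply: (@polytime_implyb _ f g); pt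
  | |- polytime (fun x => S (@?f x)) => apply: (@polytime_S _ f); pt
  | |- polytime (fun x => predn (@?f x)) => apply: (@polytime_pred _ f); pt
  | |- polytime (fun x => (@?f x) + (@?g x)) => apply: (@polytime_addn _ f g); pt
  | |- polytime (fun x => (@?f x) - (@?g x)) => apply: (@polytime_subn _ f g); pt
  | |- polytime (fun x => (@?f x) * (@?g x)) => apply: (@polytime_muln _ f g); pt
  | |- polytime (fun x => (@?f x) %/ (@?g x)) => apply: (@polytime_divn _ f g); pt
  | |- polytime (fun x => (@?f x) %% (@?g x)) => apply: (@polytime_modn _ f g); pt
  | |- polytime (fun x => leq (@?f x) (@?g x)) => apply: (@polytime_leq _ f g); pt
  | |- polytime (fun x => odd (@?f x)) => apply: (@polytime_odd _ f); pt
  | |- polytime (fun x => half (@?f x)) => apply: (@polytime_half _ f); pt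
  | |- polytime (fun x => peval ?p (@?f x)) => apply: (@polytime_peval _ p f); pt
  | |- polytime (fun x => @eq_op Datatypes_nat__canonical__eqtype_Equality (@?f x) (@?g x)) =>
         apply: (@polytime_eqn _ f g); pt
  | |- polytime (fun x => @eq_op Datatypes_bool__canonical__eqtype_Equality (@?f x) (@?g x)) =>
         apply: (@polytime_eqb _ f g); pt
  | |- polytime (fun x => (@?f x) :: (@?g x)) => apply: (@polytime_cons _ _ f g); pt
  | |- polytime (fun x => (@?f x) ++ (@?g x)) => apply: (@polytime_cat _ _ f g); pt
  | |- polytime (fun x => size (@?f x)) => apply: (@polytime_size_seq _ _ f); pt
  | |- polytime (fun x => rev (@?f x)) => apply: (@polytime_rev _ _ f); pt
  | |- polytime (fun x => flatten (@?f x)) => apply: (@polytime_flatten _ _ f); pt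
  | |- polytime (fun x => behead (@?f x)) => apply: (@polytime_behead _ _ f); pt
  | |- polytime (fun x => iota 0 (@?f x)) => apply: (@polytime_iota0 _ f); pt
  | |- polytime (fun x => head (@?f x) (@?g x)) => apply: (@polytime_head_seq _ _ f g); pt
  | |- polytime (fun x => nseq (@?f x) (@?g x)) => apply: (@polytime_nseq _ _ f g); pt
  | |- polytime (fun x => nth (@?d x) (@?s x) (@?n x)) => apply: (@polytime_nth _ _ n d s); pt
  | |- polytime (fun x => map (fun a => @?f x a) (@?s x)) =>
         apply: (@polytime_map _ _ _ (fun w => f w.1 w.2) s); pt
  | |- polytime (fun x => filter (fun a => @?f x a) (@?s x)) =>
         apply: (@polytime_filter _ _ (fun w => f w.1 w.2) s); pt
  | |- polytime (fun x => has (fun a => @?f x a) (@?s x)) =>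
         apply: (@polytime_has _ _ (fun w => f w.1 w.2) s); pt
  | |- polytime (fun x => all (fun a => @?f x a) (@?s x)) =>
         apply: (@polytime_all _ _ (fun w => f w.1 w.2) s); pt
  | |- polytime (fun x => count (fun a => @?f x a) (@?s x)) =>
         apply: (@polytime_count _ _ (fun w => f w.1 w.2) s); pt
  | H : polytime ?h |- polytime (fun x => ?h (@?f x)) => apply: (polytime_comp (f := f) H); pt
  | H : polytime (fun z => ?h z.1 z.2) |- polytime (fun x => ?h (@?f x) (@?g x)) =>
         refine (polytime_comp (f := fun x => (f x, g x)) H _); pt
  | H : polytime (fun z => ?h z.1.1 z.1.2 z.2) |- polytime (fun x => ?h (@?f x) (@?g x) (@?k x)) =>
         refine (polytime_comp (f := fun x => (f x, g x, k x)) H _); pt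
  | _ => first [pt_user; pt | idtac]
  end.

(** * Binary numbers *)

Definition value (s : seq bool) : nat := foldr (fun (b : bool) v => b + v.*2) 0 s.

Lemma valueE s n : size s <= n -> value s = \sum_(i < n) nth false s i * 2 ^ i.
Proof.
elim: s n => [|b s IH] [|n] //= sn; rewrite ?big_ord0 //.
  by rewrite big1 // => i _; rewrite nth_nil.
rewrite big_ord_recl /= muln1 (IH n) //; congr addn.
rewrite -muln2 big_distrl /=; apply: eq_bigr => i _.
by rewrite /bump /= add1n expnSr mulnA.
Qed.

Lemma iter_half n j : iter j half n = n %/ 2 ^ j.
Proof. by elim: j => [|j IH] /=; rewrite ?divn1 // IH -divn2 -divnMA expnSr. Qed.

(** The number of binary digits is the number of halvings that leave something; this form avoids
    logarithms and powers and suits [pt]. *)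
Lemma up_log2_count n : up_log 2 n.+1 = count (fun j => 0 < iter j half n) (iota 0 n.+1).
Proof.
have H j : (0 < iter j half n) = (j < up_log 2 n.+1).
  rewrite iter_half divn_gt0 ?expn_gt0 // ltnNge; apply/idP/negP => [H K|H].
    have := leq_trans (up_logP n.+1 (isT : 1 < 2)) (leq_pexp2l (isT : 0 < 2) K).
    by rewrite ltnNge H.
  rewrite leqNgt; apply/negP => K; apply: H; exact: up_log_min.
rewrite (eq_count H).
by rewrite count_ltn_iota // up_log_min //; apply/ltnW/ltn_expl.
Qed.

Lemma bitsE n : bits n = [seq odd (iter j half n) | j <- iota 0 (count (fun j => 0 < iter j half n) (iota 0 n.+1))].
Proof. by rewrite -up_log2_count /bits /mkseq; apply: eq_map => j; rewrite iter_half. Qed.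

Lemma polytime_iter_half (X : encType) (m n : X -> nat) : polytime m -> polytime n ->
  polytime (fun x => iter (m x) half (n x)).
Proof.
apply: (@polytime_op2 _ _ _ _ (fun m n => iter m half n)).
apply: (polytime_ext (f := fun p : nat * nat => iter p.1 (fun k => k./2) p.2)) => //.
apply: (@polytime_iter _ _ (fun p : nat * nat * nat => p.2./2) _ _ ('X)%R); try pt.
move=> [a b] i _ /=; rewrite pevalE sz_pair !sz_nat.
have : iter i (fun k => k./2) b <= b by elim: i => //= i; lia.
lia.
Qed.

Lemma polytime_bits (X : encType) (n : X -> nat) : polytime n -> polytime (fun x => bits (n x)).
Proof.
move=> Hn.
pose h (x : X) j := iter j half (n x).
have Hh : polytime (fun w : X * nat => h w.1 w.2).
  by apply: polytime_iter_half; pt.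
apply: (polytime_ext (f := fun x => [seq odd (h x j) | j <- iota 0 (count (fun j => 0 < h x j) (iota 0 (n x).+1))])).
  by move=> x; rewrite bitsE.
pt.
Qed.

Lemma bits_rec n : 0 < n -> bits n = odd n :: bits n./2.
Proof.
move=> n0; rewrite /bits.
rewrite up_log2S // /mkseq /= divn1 (iotaDl 1 0) -map_comp; congr cons; apply: eq_map => j /=.
by rewrite add1n expnS divnMA divn2.
Qed.

Lemma value_bits n : value (bits n) = n.
Proof.
elim/ltn_ind: n => -[|n] IH //.
have -> : value (bits n.+1) = odd n.+1 + (value (bits n.+1./2)).*2 by rewrite bits_rec.
by rewrite IH ?odd_double_half //; lia.
Qed.

(** The most significant digit comes last and must be 1; the default [true] admits the empty word,
    which stands for 0. *)
Definition canonical (s : seq bool) : bool := last true s.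

Lemma canonical_bits n : canonical (bits n).
Proof.
elim/ltn_ind: n => -[|n] IH //; rewrite bits_rec //.
case: n IH => // n IH; have := IH n.+2./2; rewrite /canonical /=.
by rewrite (@bits_rec n.+2./2) //=; apply; rewrite /= ; lia.
Qed.

Lemma value_gt0 s : canonical s -> s != [::] -> 0 < value s.
Proof.
elim: s => // -[] s IH //; rewrite /canonical /= => H _; rewrite add0n double_gt0.
by case: s H IH => // b s H IH; apply: IH.
Qed.

Lemma bits_value s : canonical s -> bits (value s) = s.
Proof.
elim: s => // b s IH; rewrite /canonical /= => H.
have Hs : canonical s by case: s H {IH}.
have v0 : 0 < b + (value s).*2.
  by have := @value_gt0 (b :: s) H isT.
rewrite bits_rec // oddD odd_double addbF oddb; congr cons.
by rewrite halfD odd_double andbF add0n doubleK; case: (b); rewrite /= ?add0n IH.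
Qed.

Lemma iota0S n : iota 0 n.+1 = rcons (iota 0 n) n.
Proof. by rewrite -addn1 iotaD cats1. Qed.

(** A full adder: the carry is the majority of the two digits and the old carry, and
    [a == (b == r.1)] is their parity. Digits are accumulated in reverse. *)
Definition add_step (s t : seq bool) (r : bool * seq bool) (i : nat) : bool * seq bool :=
  let a := nth false s i in let b := nth false t i in
  (if a then b || r.1 else b && r.1, (a == (b == r.1)) :: r.2).

Definition add_bits (s t : seq bool) : seq bool :=
  rev (foldl (add_step s t) (false, [::]) (iota 0 (size s + size t).+1)).2.

(** The scan goes from the least significant digit upwards, so the last difference met decides. *)
Definition leq_bits (s t : seq bool) : bool :=
  foldl (fun r i => if nth false s i == nth false t i then r else nth false t i)
    true (iota 0 (size s + size t)).

Lemma value_rcons s (b : bool) : value (rcons s b) = value s + b * 2 ^ size s.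
Proof. by elim: s => [|a s IH] /=; rewrite ?muln1 ?addn0 // IH expnS; lia. Qed.

Lemma value_add s t : value (add_bits s t) = value s + value t.
Proof.
rewrite /add_bits; set r := foldl _ _ _.
(* Invariant: digits written so far plus the pending carry represent the sum of the two truncated
   numbers. *)
have H n : let r := foldl (add_step s t) (false, [::]) (iota 0 n) in
   size r.2 = n /\ value (rev r.2) + r.1 * 2 ^ n =
   \sum_(i < n) nth false s i * 2 ^ i + \sum_(i < n) nth false t i * 2 ^ i.
  elim: n => [|n]; first by rewrite !big_ord0.
  rewrite iota0S foldl_rcons; set q := foldl _ _ _ => -[qs IH].
  split; first by rewrite /= qs.
  rewrite [(add_step _ _ _ _).2]/=.
  rewrite rev_cons value_rcons size_rev qs !big_ord_recr /= expnS.
  move: IH; move: (\sum_(i < n) _) (\sum_(i < n) _) (value _) (2 ^ n) => u v w z IH.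
  by move: IH; case: (nth false s n); case: (nth false t n); case: (q.1) => /=; lia.
have [sr] := H (size s + size t).+1; rewrite -/r.
rewrite -!valueE; try lia.
(* No carry is left: the sum of the two values is below [2 ^ (size s + size t).+1]. *)
case: (r.1); last by rewrite mul0n addn0.
move=> E; exfalso; move: E.
have lt u : value u < 2 ^ size u.
  by elim: u => //= b u; rewrite expnS; case: b; lia.
have := lt s; have := lt t; rewrite expnS expnD mul1n.
have : 0 < 2 ^ size s by rewrite expn_gt0.
have : 0 < 2 ^ size t by rewrite expn_gt0.
move: (2 ^ _) (2 ^ _) => p q; nia.
Qed.

Lemma leq_bitsP s t : leq_bits s t = (value s <= value t).
Proof.
rewrite (@valueE s (size s + size t)) ?leq_addr // (@valueE t (size s + size t)) ?leq_addl //.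
rewrite /leq_bits; elim: (size s + size t) => [|n IH]; first by rewrite !big_ord0.
rewrite iota0S foldl_rcons IH !big_ord_recr /=.
(* All lower digits together weigh less than digit [n], so a difference there overrules them. *)
have lt (f : nat -> bool) : \sum_(i < n) f i * 2 ^ i < 2 ^ n.
  elim: n {IH} => [|n IH]; first by rewrite big_ord0.
  rewrite big_ord_recr expnS /=; move: IH; move: (\sum_(i < n) _) (2 ^ n) => u v.
    by case: (f n) => /=; lia.
have := lt (nth false s); have := lt (nth false t).
move: (\sum_(i < n) _) (\sum_(i < n) _) (2 ^ n) => u v w.
by case: (nth false s n); case: (nth false t n) => /=; lia.
Qed.

Lemma polytime_add_bits (X : encType) (s t : X -> seq bool) : polytime s -> polytime t ->
  polytime (fun x => add_bits (s x) (t x)).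
Proof.
apply: polytime_op2.
suff H : polytime (fun p : seq bool * seq bool =>
    foldl (fun r i => add_step p.1 p.2 r i) (false, [::]) (iota 0 (size p.1 + size p.2).+1)).
  by rewrite /add_bits; pt.
apply: (@polytime_foldl_add _ _ _
   (fun w : (seq bool * seq bool) * (bool * seq bool) * nat => add_step w.1.1.1 w.1.1.2 w.1.2 w.2) _ _ (8%:P)%R); rewrite /add_step; try pt.
move=> x [b1 b2] a /=; rewrite !sz_pair sz_cons pevalE; set c := if _ then _ else _; set d := _ == _.
have := sz_bool c; have := sz_bool d; move: (sz c) (sz d) (sz b1) (sz b2) => k1 k2 k3 k4; lia.
Qed.

Lemma polytime_leq_bits (X : encType) (s t : X -> seq bool) : polytime s -> polytime t ->
  polytime (fun x => leq_bits (s x) (t x)).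
Proof.
apply: polytime_op2.
apply: (@polytime_foldl _ _ _ (fun w : (seq bool * seq bool) * bool * nat =>
  if nth false w.1.1.1 w.2 == nth false w.1.1.2 w.2 then w.1.2 else nth false w.1.1.2 w.2) _ _ (3%:P)%R); try pt.
by move=> x i; rewrite pevalE; apply: sz_bool.
Qed.

(** * Connected components of a finite relation *)

Definition dart := (nat * nat)%type.

Definition eq_dart (d e : dart) : bool := (d.1 == e.1) && (d.2 == e.2).

Lemma eq_dartP d e : eq_dart d e = (d == e).
Proof. by case: d e => [a b] [c d]. Qed.

Lemma polytime_eq_dart (X : encType) (f g : X -> dart) : polytime f -> polytime g ->
  polytime (fun x => eq_dart (f x) (g x)).
Proof. by move=> Hf Hg; rewrite /eq_dart; pt. Qed.

(** Each round filters [L] anew instead of extending the previous list, so the set never outgrows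
    [L]; [size L] rounds suffice for simple paths. *)
Definition reach (L : seq dart) (e : rel dart) (d : dart) : seq dart :=
  iter (size L) (fun S => [seq y <- L | has (fun x => eq_dart x y || e x y) S]) [:: d].

Definition connected (L : seq dart) (e : rel dart) (d d' : dart) : bool :=
  has (fun y => eq_dart y d') (reach L e d).

Definition lex_leq (d e : dart) : bool := (d.1 < e.1) || ((d.1 == e.1) && (d.2 <= e.2)).

(** Counts one representative per component, its lexicographically least element. *)
Definition components (L : seq dart) (e : rel dart) (a : pred dart) : nat :=
  count (fun d => a d && all (fun d' => connected L e d d' ==> lex_leq d d') L) L.

Section Graph.
Variables (X : encType) (L : X -> seq dart) (e : X -> rel dart) (a : X -> pred dart).
Hypothesis PL : polytime L.
Hypothesis Pe : polytime (fun w : X * dart * dart => e w.1.1 w.1.2 w.2).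
Hypothesis Pa : polytime (fun w : X * dart => a w.1 w.2).

Lemma polytime_connected (Y : encType) (x : Y -> X) (f g : Y -> dart) :
  polytime x -> polytime f -> polytime g ->
  polytime (fun y => connected (L (x y)) (e (x y)) (f y) (g y)).
Proof.
move=> Hx Hf Hg.
suff H : polytime (fun w : X * dart => reach (L w.1) (e w.1) w.2).
  rewrite /connected; pt; last first.
    exact: polytime_comp H (polytime_pair Hx Hf).
  by apply: polytime_eq_dart; pt.
have [p Hp] := polytime_size PL.
apply: (@polytime_iter _ _ (fun w : (X * dart) * seq dart =>
   [seq y <- L w.1.1 | has (fun z => eq_dart z y || e w.1.1 z y) w.2]) _ _ (p + 1%:P + 'X)%R); try pt.
  by apply: polytime_eq_dart; pt.
move=> [z d] i _; rewrite !pevalE sz_pair /=.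
apply: (@leq_trans (sz (L z) + sz [:: d])).
  case: i => [|i] /=; first exact: leq_addl.
  set P := fun _ => _; apply: leq_trans (leq_addr _ _).
  by elim: (L z) => //= y l IH; case: ifP => _; rewrite !sz_cons; lia.
have h1 : sz (L z) <= peval p (sz z + sz d).+1.
  by apply: leq_trans (Hp z) _; apply: peval_mono; lia.
have -> : sz [:: d] = (sz d).+2 by rewrite sz_cons /= addn1.
by move: h1 (sz_gt0 z) => /=; lia.
Qed.

Lemma polytime_components : polytime (fun x => components (L x) (e x) (a x)).
Proof.
rewrite /components /lex_leq; pt.
apply: (polytime_connected (x := fun w : X * dart * dart => w.1.1) (f := fun w => w.1.2) (g := fun w => w.2)); pt.
Qed.

End Graph.

(** * Distances and potentials *)

Section Potential.
Variables (V : finType) (E : {set V * V}) (w : V * V -> nat) (u v : V) (k : nat).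

Definition potential (f : V -> nat) : Prop :=
  [/\ f u = 0, k < f v & forall x y, (x, y) \in E -> f y <= f x + w (x, y)].

Lemma path_weight_cons x y p : path_weight w x (y :: p) = w (x, y) + path_weight w y p.
Proof. by rewrite /path_weight /= big_cons. Qed.

Lemma path_weight_cat x p q :
  path_weight w x (p ++ q) = path_weight w x p + path_weight w (last x p) q.
Proof.
elim: p x => [|y p IH] x /=; first by rewrite {2}/path_weight big_nil.
by rewrite !path_weight_cons IH addnA.
Qed.

Lemma potential_path f p : potential f ->
  path [rel x y | (x, y) \in E] u p -> f (last u p) <= path_weight w u p.
Proof.
case=> f0 _ Hf; rewrite -[path_weight _ _ _]add0n -{1}f0.
elim: p (u) => [|y p IH] x /=; first by rewrite leq_addr.
case/andP=> /Hf Hxy /IH H; rewrite path_weight_cons; lia.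
Qed.

(** If [y] already lies on the path, the part up to [y] is no heavier, weights being nonnegative;
    otherwise the arc is appended and the path stays simple. *)
Lemma dipath_prefix x y p : is_dipath E u x p -> (x, y) \in E ->
  exists2 q, is_dipath E u y q & path_weight w u q <= path_weight w u p + w (x, y).
Proof.
move=> /and3P[Hp /eqP Hl Hu] xy; case: (boolP (y \in u :: p)) => [yp|Ny].
- case/splitPl: yp Hp Hl Hu => p1 p2 Hy; rewrite cat_path last_cat -cat_cons cat_uniq.
  case/andP=> H1 _ _ /and3P[H2 _ _]; exists p1; first by rewrite /is_dipath H1 Hy eqxx.
  by rewrite path_weight_cat -addnA leq_addr.
- exists (rcons p y).
    by rewrite /is_dipath rcons_path last_rcons -rcons_cons rcons_uniq Ny Hp Hu Hl /= xy eqxx.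
  by rewrite -cats1 path_weight_cat Hl path_weight_cons /path_weight big_nil addn0.
Qed.

(** The disjunct [n == k.+1] caps the minimum and guarantees that it exists even for unreachable
    vertices. *)
Definition weight_within (x : V) (n : nat) : bool :=
  (n == k.+1) || [exists p : #|V|.-bseq V, is_dipath E u x p && (path_weight w u p <= n)].

Lemma weight_within_ex x : exists n, weight_within x n.
Proof. by exists k.+1; rewrite /weight_within eqxx. Qed.

Definition truncated_distance (x : V) : nat := ex_minn (weight_within_ex x).

Lemma dipath_size x p : is_dipath E u x p -> size p <= #|V|.
Proof.
case/and3P=> _ _ /card_uniqP H; apply: ltnW.
rewrite -[(size p).+1]/(size (u :: p)) -H; exact: max_card.
Qed.

Lemma truncated_distance_le x p : is_dipath E u x p ->
  truncated_distance x <= path_weight w u p.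
Proof.
move=> Hp; rewrite /truncated_distance; case: ex_minnP => m _; apply.
by apply/orP; right; apply/existsP; exists (Bseq (dipath_size Hp)); rewrite Hp /=.
Qed.

Lemma truncated_distance_max x : truncated_distance x <= k.+1.
Proof. by rewrite /truncated_distance; case: ex_minnP => m _; apply; rewrite /weight_within eqxx. Qed.

Lemma truncated_distanceP :
  (forall p : #|V|.-bseq V, is_dipath E u v p -> k < path_weight w u p) ->
  potential truncated_distance.
Proof.
move=> H; split.
- have /truncated_distance_le : is_dipath E u u [::] by rewrite /is_dipath /= eqxx.
  by rewrite /path_weight big_nil leqn0 => /eqP.
- rewrite /truncated_distance; case: ex_minnP => m /orP[/eqP -> //|] /existsP[p /andP[/H]].
  by move=> kp pm _; apply: leq_trans kp pm.
- move=> x y xy; rewrite {2}/truncated_distance; case: ex_minnP => m + _.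
  (* If the value at [x] is the cap [k.+1], nothing can exceed it at [y]; otherwise a path to [x] is
     extended along the arc. *)
  case/orP=> [/eqP ->|/existsP[p /andP[Hp pm]]].
    by apply: leq_trans (truncated_distance_max _) (leq_addr _ _).
  have [q Hq qp] := dipath_prefix Hp xy.
  apply: leq_trans (truncated_distance_le Hq) _; apply: leq_trans qp _.
  by rewrite leq_add2r.
Qed.

Lemma rho_gtP : reflect (exists f, potential f) (k%:Z%:E < rho E w u v)%E.
Proof.
apply: (iffP (@bigmin_gtP _ _ _ _ _ _ _)) => [[_ H]|[f Hf]].
  exists truncated_distance; apply: truncated_distanceP => p /H.
  by rewrite lte_fin ltz_nat.
split=> [|p /and3P[Hp /eqP Hl _]]; first exact: ltry.
have := potential_path Hf Hp; rewrite Hl lte_fin ltz_nat; apply: leq_trans.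
by case: Hf.
Qed.

End Potential.

Lemma interdiction_gtP (V : finType) (E : {set V * V}) (w c : V * V -> nat) (B : nat) (u v : V) (k : nat) :
  (k%:Z%:E < rho_interdicted E w c B u v)%E <->
  exists (I : {set V * V}) (f : V -> nat),
    [/\ I \subset E, \sum_(e in I) c e <= B & potential (E :\: I) w u v k f].
Proof.
rewrite /rho_interdicted; split=> [|[I [f [IE cB Hf]]]].
  move=> H.
  (* The maximum exceeds [k] only if one of its terms does, since the default value [-oo] never
     exceeds [k]. *)
  have [/existsP[I /andP[/andP[IE cB] /rho_gtP[f Hf]]]|] :=
      boolP [exists I : {set V * V}, (I \subset E) && (\sum_(e in I) c e <= B)
         && (k%:Z%:E < rho (E :\: I) w u v)%E]; first by exists I, f.
  rewrite negb_exists => /forallP K; move: H; rewrite ltNge => /negP[].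
  apply/bigmax_leP; split=> [|I IE]; first exact: leNye.
  by have := K I; rewrite IE /= -leNgt.
apply: (@lt_le_trans _ _ (rho (E :\: I) w u v)); first by apply/rho_gtP; exists f.
by apply: (le_bigmax_cond (-oo)%E (fun I => rho (E :\: I) w u v)); rewrite IE.
Qed.

(** * Planarity of cylindrical grids *)

(** The tool for all counts of orbits and components below: a set meeting each class in exactly one
    point is in bijection with the roots. *)
Lemma n_comp_transversal (T : finType) (e : rel T) (a B : {pred T}) :
  connect_sym e -> closed e a -> {subset B <= a} ->
  {in a, forall x, exists2 y, y \in B & connect e x y} ->
  {in B &, forall y z, connect e y z -> y = z} ->
  n_comp e a = #|B|.
Proof.
move=> symE cl sub ex inj; pose C := [set fingraph.root e y | y in B].
have -> : #|B| = #|C|.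
  by rewrite card_in_imset // => y z yB zB /eqP; rewrite root_connect //; apply: inj.
apply: eq_card => x; rewrite !inE; apply/andP/imsetP => [[rx xa]|[y yB ->]].
  have [y yB xy] := ex x xa; exists y => //.
  by rewrite -(eqP rx); apply/eqP; rewrite root_connect.
split; first exact: roots_root.
by rewrite -(closed_connect cl (connect_root e y)); apply: sub.
Qed.

Lemma swap_dartK (V : finType) : involutive (@swap_dart V).
Proof. by case. Qed.

(** A step along [node] is not reversible in one step, but the orbits of a permutation of a finite
    set are cycles, so going on around the cycle leads back. *)
Lemma link_sym (V : finType) (node : {perm V * V}) :
  connect_sym [rel d d' : V * V | (d' == swap_dart d) || (d' == node d)].
Proof.
set e := [rel _ _ | _].
have sub : subrel (frel node) (connect e).
  by move=> x y /eqP <-; apply: connect1; rewrite /= eqxx orbT.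
have back x y : e x y -> connect e y x.
  case/orP => /eqP ->; first by apply: connect1; rewrite /= swap_dartK eqxx.
  apply: (connect_sub sub); rewrite (fconnect_sym (@perm_inj _ node)).
  exact: fconnect1.
have H x y : connect e x y -> connect e y x.
  case/connectP => p; elim: p x => [|z p IH] x /=; first by move=> _ ->.
  case/andP=> xz /IH H /H K; apply: connect_trans K _; exact: back.
by move=> x y; apply/idP/idP; apply: H.
Qed.

(* A grid on a cylinder: every vertex has a neighbour to the south and one to
   the north, and [hasE], [hasW] tell whether it has one to the east, to the west. *)
Section Cylinder.
Variables (V : finType) (south north east west : V -> V) (hasE hasW : pred V).
Variables (v0 v1 : V).
Hypothesis southK : cancel south north.
Hypothesis northK : cancel north south.
Hypothesis hasE_south : forall x, hasE (south x) = hasE x.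
Hypothesis hasW_south : forall x, hasW (south x) = hasW x.
Hypothesis hasW_east : forall x, hasE x -> hasW (east x).
Hypothesis hasE_west : forall x, hasW x -> hasE (west x).
Hypothesis eastK : forall x, hasE x -> west (east x) = x.
Hypothesis westK : forall x, hasW x -> east (west x) = x.
Hypothesis east_south : forall x, hasE x -> east (south x) = south (east x).
Hypothesis neqSN : forall x, south x != north x.
Hypothesis neqES : forall x, hasE x -> east x != south x.
Hypothesis neqEN : forall x, hasE x -> east x != north x.
Hypothesis neqWS : forall x, hasW x -> west x != south x.
Hypothesis neqWN : forall x, hasW x -> west x != north x.
Hypothesis neqEW : forall x, hasE x -> hasW x -> east x != west x.
Hypothesis left_border : forall x, ~~ hasW x -> exists n, x = iter n south v0.
Hypothesis right_border : forall x, ~~ hasE x -> exists n, x = iter n south v1.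
Hypothesis to_left : forall x, exists2 n, ~~ hasW (iter n west x) &
  forall m, m < n -> hasW (iter m west x).
Hypothesis v0W : ~~ hasW v0.
Hypothesis v1E : ~~ hasE v1.

Definition cylinder_adj : rel V := fun x y =>
  [|| y == south x, y == north x, hasE x && (y == east x) | hasW x && (y == west x)].

Let dart := [pred d : V * V | cylinder_adj d.1 d.2].

Let Sd x := (x, south x).
Let Nd x := (x, north x).
Let Ed x := (x, east x).
Let Wd x := (x, west x).

(** The darts at a vertex in the cyclic order south, east, north, west, skipping missing ones; pairs
    that are not darts stay fixed. *)
Definition rotate (d : V * V) : V * V :=
  let: (x, y) := d in
  if y == south x then if hasE x then (x, east x) else (x, north x) else
  if y == north x then if hasW x then (x, west x) else (x, south x) else
  if hasE x && (y == east x) then (x, north x) else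
  if hasW x && (y == west x) then (x, south x) else d.

Definition rotate_back (d : V * V) : V * V :=
  let: (x, y) := d in
  if y == south x then if hasW x then (x, west x) else (x, north x) else
  if y == north x then if hasE x then (x, east x) else (x, south x) else
  if hasE x && (y == east x) then (x, south x) else
  if hasW x && (y == west x) then (x, north x) else d.

Variant dart_spec : V * V -> Type :=
| DartS x : dart_spec (Sd x)
| DartN x : dart_spec (Nd x)
| DartE x of hasE x : dart_spec (Ed x)
| DartW x of hasW x : dart_spec (Wd x).

Lemma dartP d : dart d -> dart_spec d.
Proof.
case: d => x y /=; rewrite /cylinder_adj.
case: eqP => [->|_] /=; first by move=> _; apply: DartS.
case: eqP => [->|_] /=; first by move=> _; apply: DartN.
case E: (hasE x) => /=.
  case: eqP => [->|_] /=; first by move=> _; apply: DartE.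
  by case/andP=> W /eqP ->; apply: DartW.
by case/andP=> W /eqP ->; apply: DartW.
Qed.

Lemma rotS x : rotate (Sd x) = if hasE x then Ed x else Nd x.
Proof. by rewrite /rotate /= eqxx. Qed.

Lemma neqNS x : (north x == south x) = false.
Proof. by rewrite eq_sym (negPf (neqSN x)). Qed.

Lemma rotN x : rotate (Nd x) = if hasW x then Wd x else Sd x.
Proof. by rewrite /rotate /= neqNS eqxx. Qed.

Lemma rotE x : hasE x -> rotate (Ed x) = Nd x.
Proof. by move=> E; rewrite /rotate /= (negPf (neqES E)) (negPf (neqEN E)) E eqxx. Qed.

Lemma rotW x : hasW x -> rotate (Wd x) = Sd x.
Proof.
move=> W; rewrite /rotate /= (negPf (neqWS W)) (negPf (neqWN W)) W eqxx.
by case E: (hasE x) => //=; rewrite eq_sym (negPf (neqEW E W)).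
Qed.

Lemma rotate_stable d : ~~ dart d -> rotate d = d.
Proof.
case: d => x y /=; rewrite /cylinder_adj; do 2! case: (y == _) => //=.
by case: (_ && _) => //=; case: (_ && _).
Qed.

Lemma dartSd x : dart (Sd x). Proof. by rewrite /= /cylinder_adj eqxx. Qed.
Lemma dartNd x : dart (Nd x). Proof. by rewrite /= /cylinder_adj eqxx orbT. Qed.
Lemma dartEd x : hasE x -> dart (Ed x).
Proof. by move=> E; rewrite /= /cylinder_adj E eqxx !orbT. Qed.
Lemma dartWd x : hasW x -> dart (Wd x).
Proof. by move=> E; rewrite /= /cylinder_adj E eqxx !orbT. Qed.

Lemma rotate_dart d : dart d -> dart (rotate d).
Proof.
case/dartP=> x; rewrite ?rotS ?rotN.
- by case: ifP => E; [apply: dartEd|apply: dartNd].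
- by case: ifP => E; [apply: dartWd|apply: dartSd].
- by move=> E; rewrite rotE //; apply: dartNd.
- by move=> E; rewrite rotW //; apply: dartSd.
Qed.

Lemma rotateK : cancel rotate rotate_back.
Proof.
move=> d; case: (boolP (dart d)) => [|Nd']; last first.
  rewrite rotate_stable //; case: d Nd' => x y /=; rewrite /cylinder_adj.
  do 2! case: (y == _) => //=; by case: (_ && _) => //=; case: (_ && _).
case/dartP=> x.
- rewrite rotS; case E: (hasE x); rewrite /rotate_back /=.
    by rewrite (negPf (neqES E)) (negPf (neqEN E)) E eqxx.
  by rewrite neqNS eqxx E.
- rewrite rotN; case W: (hasW x); rewrite /rotate_back /=.
    rewrite (negPf (neqWS W)) (negPf (neqWN W)) W eqxx.
    by case E: (hasE x) => //=; rewrite eq_sym (negPf (neqEW E W)).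
  by rewrite eqxx W.
- by move=> E; rewrite rotE // /rotate_back /= neqNS eqxx E.
- by move=> W; rewrite rotW // /rotate_back /= eqxx W.
Qed.

Definition rotation : {perm V * V} := perm (can_inj rotateK).

Lemma rotationE d : rotation d = rotate d.
Proof. by rewrite permE. Qed.

Let face := fun d => rotation (swap_dart d).
Let link := [rel d d' | (d' == swap_dart d) || (d' == rotation d)].

Lemma swapS x : swap_dart (Sd x) = Nd (south x).
Proof. by rewrite /swap_dart /Nd /= southK. Qed.
Lemma swapN x : swap_dart (Nd x) = Sd (north x).
Proof. by rewrite /swap_dart /Sd /= northK. Qed.
Lemma swapE x : hasE x -> swap_dart (Ed x) = Wd (east x).
Proof. by move=> E; rewrite /swap_dart /Wd /= eastK. Qed.
Lemma swapW x : hasW x -> swap_dart (Wd x) = Ed (west x).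
Proof. by move=> E; rewrite /swap_dart /Ed /= westK. Qed.

Lemma faceS x : face (Sd x) = if hasW x then Wd (south x) else Sd (south x).
Proof. by rewrite /face swapS rotationE rotN hasW_south. Qed.

Lemma hasE_north x : hasE (north x) = hasE x.
Proof. by rewrite -hasE_south northK. Qed.

Lemma faceN x : face (Nd x) = if hasE x then Ed (north x) else Nd (north x).
Proof. by rewrite /face swapN rotationE rotS hasE_north. Qed.

Lemma faceE x : hasE x -> face (Ed x) = Sd (east x).
Proof. by move=> E; rewrite /face swapE // rotationE rotW // hasW_east. Qed.

Lemma faceW x : hasW x -> face (Wd x) = Nd (west x).
Proof. by move=> E; rewrite /face swapW // rotationE rotE // hasE_west. Qed.

Lemma west_north x : hasW x -> west (north x) = north (west x).
Proof.
move=> W; have E := hasE_west W.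
rewrite -{1}[x]westK // -{1}[west x]northK east_south ?hasE_north // southK eastK //.
by rewrite hasE_north.
Qed.

Lemma swap_in_dart d : dart d -> dart (swap_dart d).
Proof.
case/dartP=> x; rewrite ?swapS ?swapN; first exact: dartNd; first exact: dartSd.
  by move=> E; rewrite swapE //; apply: dartWd; apply: hasW_east.
by move=> E; rewrite swapW //; apply: dartEd; apply: hasE_west.
Qed.

Lemma swap_dartE d : dart (swap_dart d) = dart d.
Proof. by apply/idP/idP => /swap_in_dart //; rewrite swap_dartK. Qed.

Lemma rotation_dartE d : dart (rotation d) = dart d.
Proof.
rewrite rotationE; case: (boolP (dart d)) => [/rotate_dart|H]; first by [].
by rewrite rotate_stable // (negPf H).
Qed.

Lemma face_dartE d : dart (face d) = dart d.
Proof. exact: etrans (rotation_dartE _) (swap_dartE _). Qed.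

Lemma closed_face : closed (frel face) dart.
Proof. by move=> x y /eqP <-; exact: esym (etrans (rotation_dartE _) (swap_dartE _)). Qed.

Lemma closed_rotation : closed (frel rotation) dart.
Proof. by move=> x y /eqP <-; exact: esym (rotation_dartE _). Qed.

Lemma closed_swap : closed (frel (@swap_dart V)) dart.
Proof. by move=> x y /eqP <-; exact: esym (swap_dartE _). Qed.

Lemma closed_link : closed link dart.
Proof. by move=> x y /orP[] /eqP ->; [exact: esym (swap_dartE _)|exact: esym (rotation_dartE _)]. Qed.

Lemma face_inj : injective face.
Proof. by move=> x y /perm_inj /(can_inj (@swap_dartK V)). Qed.

(** Every vertex has a southward dart, which therefore represents the orbit of all darts leaving
    it. *)
Lemma to_south d : dart d -> fconnect rotation d (Sd d.1).
Proof.
have toS x : hasW x -> fconnect rotation (Wd x) (Sd x).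
  by move=> W; rewrite -rotW // -rotationE; apply: fconnect1.
have NS x : fconnect rotation (Nd x) (Sd x).
  apply: connect_trans (fconnect1 _ _) _; rewrite rotationE rotN.
  by case: ifP => W; [apply: toS|apply: connect0].
case/dartP=> x /=; [exact: connect0|exact: NS| |exact: toS].
move=> E; apply: connect_trans (fconnect1 _ _) _; rewrite rotationE rotE //; exact: NS.
Qed.

Lemma rotation_fst d n : (iter n rotation d).1 = d.1.
Proof.
elim: n => //= n <-; rewrite rotationE; case: (iter _ _ _) => x y /=.
by do ![case: ifP => // _].
Qed.

Lemma rotation_orbit d d' : dart d -> fconnect rotation d d' = dart d' && (d'.1 == d.1).
Proof.
move=> dd; apply/idP/andP => [H|[dd' /eqP E]].
  split; first by rewrite -[dart d'](closed_connect closed_rotation H).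
  by rewrite -(iter_findex H) rotation_fst.
apply: connect_trans (to_south dd) _; rewrite -E.
by rewrite (fconnect_sym (@perm_inj _ _)); apply: to_south.
Qed.

Lemma card_rotation : fcard rotation dart = #|V|.
Proof.
rewrite -(card_codom (f := Sd)); last by move=> x y [].
apply: n_comp_transversal (fconnect_sym (@perm_inj _ _)) closed_rotation _ _ _.
- by move=> d /codomP[x ->]; apply: dartSd.
- by move=> d dd; exists (Sd d.1); [apply: codom_f|apply: to_south].
- move=> y z /codomP[x ->] /codomP[x' ->].
  by rewrite rotation_orbit ?dartSd // => /andP[_ /eqP /= ->].
Qed.

Let Es := [set d | dart d & (d.2 == east d.1) && hasE d.1].
Let Ws := [set d | dart d & (d.2 == west d.1) && hasW d.1].
Let Ss := [set Sd x | x : V].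
Let Ns := [set Nd x | x : V].

Lemma EsP d : reflect (exists2 x, hasE x & d = Ed x) (d \in Es).
Proof.
rewrite inE; apply: (iffP and3P) => [[_ /eqP H E]|[x E ->]].
  by exists d.1 => //; case: d H {E} => x y /= ->.
by rewrite /= eqxx; split=> //; apply: (dartEd E).
Qed.

Lemma WsP d : reflect (exists2 x, hasW x & d = Wd x) (d \in Ws).
Proof.
rewrite inE; apply: (iffP and3P) => [[_ /eqP H E]|[x E ->]].
  by exists d.1 => //; case: d H {E} => x y /= ->.
by rewrite /= eqxx; split=> //; apply: (dartWd E).
Qed.

Lemma card_Ws : #|Ws| = #|Es|.
Proof.
rewrite -(card_imset _ (can_inj (@swap_dartK V))); apply: eq_card => d.
apply/imsetP/EsP => [[d' /WsP[x W ->] ->]|[x E ->]].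
  by exists (west x); [apply: hasE_west|rewrite swapW].
exists (Wd (east x)); last by rewrite -swapE // swap_dartK.
by apply/WsP; exists (east x) => //; apply: hasW_east.
Qed.

Lemma card_Ss : #|Ss| = #|V|.
Proof. by rewrite card_imset // => x y []. Qed.

Lemma card_Ns : #|Ns| = #|V|.
Proof. by rewrite card_imset // => x y []. Qed.

Lemma card_ES : #|Es :|: Ss| = #|Es| + #|V|.
Proof.
rewrite cardsU card_Ss (_ : Es :&: Ss = set0) ?cards0 ?subn0 //.
apply/setP => d; rewrite in_setI in_set0; apply/negP => /andP[/EsP[x E ->] /imsetP[y _ [<- H]]].
by move: (neqES E); rewrite H eqxx.
Qed.

Lemma card_WN : #|Ws :|: Ns| = #|Es| + #|V|.
Proof.
rewrite cardsU card_Ns card_Ws (_ : Ws :&: Ns = set0) ?cards0 ?subn0 //.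
apply/setP => d; rewrite in_setI in_set0; apply/negP => /andP[/WsP[x E ->] /imsetP[y _ [<- H]]].
by move: (neqWN E); rewrite H eqxx.
Qed.

(** Of the two darts of an edge one goes east or south and the other west or north; this gives both
    the number of darts and the number of edges. *)
Lemma ES_WN_disjoint d : d \in Es :|: Ss -> d \in Ws :|: Ns -> False.
Proof.
rewrite !in_setU => H K.
have {}H : (exists2 x, hasE x & d = Ed x) \/ (exists x, d = Sd x).
  by case/orP: H => [/EsP|/imsetP[x _ ->]]; [left|right; exists x].
have {K} : (exists2 x, hasW x & d = Wd x) \/ (exists x, d = Nd x).
  by case/orP: K => [/WsP|/imsetP[x _ ->]]; [left|right; exists x].
case: H => [[x E ->]|[x ->]] [[y W [xy]]|[y [xy]]] /eqP.
- by rewrite -xy in W *; rewrite (negPf (neqEW E W)).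
- by rewrite -xy (negPf (neqEN E)).
- by rewrite -xy in W *; rewrite eq_sym (negPf (neqWS W)).
- by rewrite -xy (negPf (neqSN _)).
Qed.

Lemma card_dart : #|dart| = 2 * (#|Es| + #|V|).
Proof.
rewrite mul2n -addnn -{1}card_ES -card_WN -cardsUI (_ : _ :&: _ = set0) ?cards0 ?addn0.
  apply: eq_card => d; rewrite !in_setU; apply/idP/idP => [/dartP[] x|].
  - by apply/orP; left; apply/orP; right; apply: imset_f.
  - by apply/orP; right; apply/orP; right; apply: imset_f.
  - by move=> E; apply/orP; left; apply/orP; left; apply/EsP; exists x.
  - by move=> E; apply/orP; right; apply/orP; left; apply/WsP; exists x.
  case/orP=> /orP[].
  - by case/EsP=> x E ->; apply: dartEd.
  - by case/imsetP=> x _ ->; apply: dartSd.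
  - by case/WsP=> x E ->; apply: dartWd.
  - by case/imsetP=> x _ ->; apply: dartNd.
by apply/setP => d; rewrite in_setI in_set0; apply/negP => /andP[H /(ES_WN_disjoint H)].
Qed.

Lemma card_swap : fcard (@swap_dart V) dart = #|Es| + #|V|.
Proof.
rewrite -card_ES.
apply: n_comp_transversal (fconnect_sym (can_inj (@swap_dartK V))) closed_swap _ _ _.
- move=> d; rewrite in_setU => /orP[/EsP[x E ->]|/imsetP[x _ ->]]; first exact: dartEd.
  exact: dartSd.
- move=> d /dartP[] x.
  + by exists (Sd x); rewrite ?connect0 // in_setU; apply/orP; right; apply: imset_f.
  + exists (Sd (north x)); first by rewrite in_setU; apply/orP; right; apply: imset_f.
    by rewrite -swapN; apply: fconnect1.
  + by move=> E; exists (Ed x); rewrite ?connect0 // in_setU; apply/orP; left; apply/EsP; exists x.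
  + move=> E; exists (Ed (west x)); last by rewrite -swapW //; apply: fconnect1.
    by rewrite in_setU; apply/orP; left; apply/EsP; exists (west x) => //; apply: hasE_west.
- move=> y z yB zB /iter_findex E; move: zB; rewrite -E.
  have : iter (findex (@swap_dart V) y z) (@swap_dart V) y \in [:: y; swap_dart y].
    elim: (findex _ _ _) => [|n]; rewrite ?inE ?eqxx //= => /orP[] /eqP ->; rewrite ?eqxx ?orbT //.
    by rewrite swap_dartK eqxx.
  rewrite in_cons mem_seq1 => /orP[] /eqP -> // H; exfalso; apply: (ES_WN_disjoint H).
  move: yB; rewrite in_setU => /orP[/EsP[x E' ->]|/imsetP[x _ ->]].
    by rewrite swapE // in_setU; apply/orP; left; apply/WsP; exists (east x) => //; apply: hasW_east.
  by rewrite swapS in_setU; apply/orP; right; apply: imset_f.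
Qed.

(** There are two kinds of faces. A square is represented by its only eastward dart, on its northern
    side. The two circles bounding the cylinder are represented by the southward dart at [v0] and
    the northward dart at [v1]. *)
Definition face_repr (d : V * V) : V * V :=
  let: (x, y) := d in
  if y == south x then if hasW x then Ed (west x) else Sd v0 else
  if y == north x then if hasE x then Ed (north x) else Nd v1 else
  if hasE x && (y == east x) then d else Ed (west (north x)).

Lemma reprS x : face_repr (Sd x) = if hasW x then Ed (west x) else Sd v0.
Proof. by rewrite /face_repr /= eqxx. Qed.

Lemma reprN x : face_repr (Nd x) = if hasE x then Ed (north x) else Nd v1.
Proof. by rewrite /face_repr /= neqNS eqxx. Qed.

Lemma reprE x : hasE x -> face_repr (Ed x) = Ed x.
Proof. by move=> E; rewrite /face_repr /= (negPf (neqES E)) (negPf (neqEN E)) E eqxx. Qed.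

Lemma reprW x : hasW x -> face_repr (Wd x) = Ed (west (north x)).
Proof.
move=> W; rewrite /face_repr /= (negPf (neqWS W)) (negPf (neqWN W)).
by case E: (hasE x) => //=; rewrite eq_sym (negPf (neqEW E W)).
Qed.

Lemma repr_face d : dart d -> face_repr (face d) = face_repr d.
Proof.
case/dartP=> x.
- rewrite faceS reprS; case: ifP => W; last by rewrite reprS hasW_south W.
  by rewrite reprW ?hasW_south // southK.
- rewrite faceN reprN; case: ifP => W; last by rewrite reprN hasE_north W.
  by rewrite reprE ?hasE_north.
- by move=> E; rewrite faceE // reprE // reprS hasW_east // eastK.
- by move=> W; rewrite faceW // reprW // reprN hasE_west // west_north.
Qed.

Lemma repr_connect d d' : dart d -> fconnect face d d' -> face_repr d' = face_repr d.
Proof.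
move=> dd /iter_findex <-; elim: (findex _ _ _) => //= n IH; rewrite repr_face //.
by elim: n {IH} => // n IH; rewrite iterS face_dartE.
Qed.

Lemma connect_repr d : dart d -> fconnect face d (face_repr d).
Proof.
have HN x : hasE x -> fconnect face (Nd x) (Ed (north x)).
  by move=> E; have := fconnect1 face (Nd x); rewrite faceN E.
have HW x : hasW x -> fconnect face (Wd x) (Ed (west (north x))).
  move=> W; rewrite west_north //; apply: connect_trans (fconnect1 _ _) _.
  by rewrite faceW //; apply: HN; apply: hasE_west.
case/dartP=> x.
- rewrite reprS; case: ifP => W; last first.
    have [n ->] := left_border (negbT W); rewrite (fconnect_sym face_inj).
    elim: n => [|n IH]; first exact: connect0.
    apply: connect_trans IH _; have := fconnect1 face (Sd (iter n south v0)).
    rewrite faceS; suff -> : hasW (iter n south v0) = false by [].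
    by elim: n => [|n IH] /=; rewrite ?hasW_south //; apply/negbTE.
  apply: connect_trans (fconnect1 _ _) _; rewrite faceS W.
  by have := HW (south x); rewrite hasW_south W southK; apply.
- rewrite reprN; case: ifP => E; first exact: HN.
  have [n ->] := right_border (negbT E); elim: n => [|n IH]; first exact: connect0.
  apply: connect_trans (fconnect1 _ _) _; rewrite faceN.
  suff -> : hasE (iter n.+1 south v1) = false by rewrite /= southK.
  by rewrite iterS hasE_south; elim: n {IH} => [|n IH]; [apply: negbTE|rewrite iterS hasE_south].
- by move=> E; rewrite reprE // connect0.
- by move=> W; rewrite reprW //; apply: HW.
Qed.

(** The squares correspond to the eastward darts; the remaining two faces cap the ends of the
    cylinder and make it a sphere. *)
Lemma card_face : fcard face dart = #|Es| + 2.
Proof.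
pose B := Sd v0 |: (Nd v1 |: Es).
have NE : Nd v1 \notin Es.
  by apply/EsP => -[x E [xy _]]; move: v1E; rewrite xy E.
have SE : Sd v0 \notin Nd v1 |: Es.
  rewrite in_setU1 negb_or; apply/andP; split.
    by apply/eqP => -[<-] /eqP; rewrite (negPf (neqSN _)).
  by apply/EsP => -[x E [xy]] /eqP; rewrite xy eq_sym (negPf (neqES E)).
have -> : #|Es| + 2 = #|B| by rewrite /B !cardsU1 NE SE; lia.
have BP d : d \in B -> [\/ d = Sd v0, d = Nd v1 | exists2 x, hasE x & d = Ed x].
  rewrite !in_setU1 => /or3P[/eqP ->|/eqP ->|/EsP H];
    by [apply: Or31|apply: Or32|apply: Or33].
have BE x : hasE x -> Ed x \in B.
  by move=> E; rewrite !in_setU1; apply/or3P; apply: Or33; apply/EsP; exists x.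
have reprB y : y \in B -> face_repr y = y.
  case/BP => [->|->|[x E ->]]; first by rewrite reprS (negPf v0W).
    by rewrite reprN (negPf v1E).
  by rewrite reprE.
apply: n_comp_transversal (fconnect_sym face_inj) closed_face _ _ _.
- move=> d /BP[->|->|[x E ->]]; first exact: dartSd; first exact: dartNd.
  exact: dartEd.
- move=> d dd; exists (face_repr d); last exact: connect_repr.
  case/dartP: dd => x.
  + rewrite reprS; case: ifP => W; first by apply: BE; apply: hasE_west.
    by rewrite in_setU1 eqxx.
  + rewrite reprN; case: ifP => E; first by apply: BE; rewrite hasE_north.
    by rewrite !in_setU1 eqxx orbT.
  + by move=> E; rewrite reprE //; apply: BE.
  + by move=> W; rewrite reprW //; apply: BE; rewrite west_north // hasE_north hasE_west.
- move=> y z yB zB /repr_connect; rewrite !reprB // => -> //.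
  case/BP: yB => [->|->|[x E ->]]; first exact: dartSd; first exact: dartNd.
  exact: dartEd.
Qed.

(** From any vertex one walks west to the border, and then around the border circle to [v0]. *)
Lemma card_link : n_comp link dart = 1.
Proof.
rewrite -(cards1 (Sd v0)).
apply: n_comp_transversal (link_sym rotation) closed_link _ _ _.
- by move=> d; rewrite in_set1 => /eqP ->; apply: dartSd.
- move=> d dd; exists (Sd v0); first by rewrite in_set1.
  have same e e' : dart e -> dart e' -> e.1 = e'.1 -> connect link e e'.
    move=> de de' E; have : fconnect rotation e e' by rewrite rotation_orbit // de' E eqxx.
    by apply: connect_sub => x y /eqP <-; apply: connect1; rewrite /= eqxx orbT.
  have sw e : connect link e (swap_dart e) by apply: connect1; rewrite /= eqxx.
  apply: connect_trans (same _ (Sd d.1) dd (dartSd _) erefl) _.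
  have [n Hn Hm] := to_left d.1.
  apply: (@connect_trans _ _ (Sd (iter n west d.1))).
    elim: n {Hn} Hm => [|n IH] Hm; first exact: connect0.
    apply: connect_trans (IH _) _; first by move=> m mn; apply: Hm; apply: ltnW.
    have W := Hm n (leqnn _).
    apply: connect_trans (same _ (Wd (iter n west d.1)) (dartSd _) (dartWd W) erefl) _.
    apply: connect_trans (sw _) _; rewrite swapW //.
    by apply: same => //; [apply: dartEd; apply: hasE_west|apply: dartSd].
  have [m ->] := left_border Hn; rewrite (link_sym rotation).
  elim: m => [|m IH]; first exact: connect0.
  apply: connect_trans IH _; apply: connect_trans (sw _) _; rewrite swapS.
  by apply: same => //; [apply: dartNd|apply: dartSd].
- by move=> y z; rewrite !in_set1 => /eqP -> /eqP ->.
Qed.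

(** With [V] vertices and [e] eastward darts, Euler's formula reads [V + (e + V) + (e + 2) = 2 * (e
    + V) + 2 * 1]. *)
Theorem cylinder_planar : planar cylinder_adj.
Proof.
exists rotation; split=> [d d'|]; first exact: rotation_orbit.
rewrite [fcard rotation _]card_rotation [fcard (@swap_dart V) _]card_swap [fcard face _]card_face.
rewrite [n_comp _ _]card_link [X in _ = X + _]card_dart; lia.
Qed.

End Cylinder.

Definition planar_with (V : finType) (adj : rel V) (node : {perm V * V}) : Prop :=
  let dart := [pred d : V * V | adj d.1 d.2] in
  let face := fun d => node (swap_dart d) in
  let link := [rel d d' | (d' == swap_dart d) || (d' == node d)] in
  (forall d d', dart d -> fconnect node d d' = dart d' && (d'.1 == d.1)) /\
  fcard node dart + fcard (@swap_dart V) dart + fcard face dart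
    = #|dart| + 2 * n_comp link dart.

Lemma planar_with_ext (V : finType) (e e' : rel V) node :
  e =2 e' -> planar_with e node -> planar_with e' node.
Proof.
move=> H [H1 H2]; split=> [d d'|].
  by rewrite /= -!H; apply: H1.
suff E : [pred d : V * V | e' d.1 d.2] =i [pred d : V * V | e d.1 d.2].
  by rewrite (eq_card E) !(eq_n_comp_r E).
by move=> d; rewrite !inE H.
Qed.

Lemma planar_ext (V : finType) (e e' : rel V) : e =2 e' -> planar e -> planar e'.
Proof. by move=> H [node Hn]; exists node; apply: planar_with_ext Hn. Qed.

Lemma ord_eqE m (x y : 'I_m) : (x == y) = (nat_of_ord x == nat_of_ord y).
Proof. by []. Qed.

Section Grid.
Variables (R n : nat).
Hypothesis (R2 : 1 < R) (n0 : 0 < n).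

Let W := n.+1.
Let N := R.*2 * W.

(** Vertex [x] lies in row [x %/ W] and column [x %% W]. Vertical neighbours differ by [W] modulo
    [N], which closes the cylinder, and adding [N - W] stands for subtracting [W]. *)
Definition grid_adj (x y : nat) : bool :=
  [|| y == (x + W) %% N, y == (x + (N - W)) %% N,
      (x %% W < n) && (y == x.+1) | (0 < x %% W) && (y.+1 == x)].

Lemma N_gt0 : 0 < N. Proof. by rewrite muln_gt0 double_gt0 (ltnW R2). Qed.

Lemma WN : 4 * W <= N. Proof. by rewrite leq_mul2r; lia. Qed.

Definition gsouth (x : 'I_N) : 'I_N := Ordinal (ltn_pmod (x + W) N_gt0).
Definition gnorth (x : 'I_N) : 'I_N := Ordinal (ltn_pmod (x + (N - W)) N_gt0).
Definition geast (x : 'I_N) : 'I_N := insubd x x.+1.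
Definition gwest (x : 'I_N) : 'I_N := insubd x x.-1.
Definition ghasE (x : 'I_N) := x %% W < n.
Definition ghasW (x : 'I_N) := 0 < x %% W.

Lemma modn_shift x k : x < N -> k < N -> (x + k) %% N = if x + k < N then x + k else x + k - N.
Proof.
move=> xN kN; case: ltnP => H; first by rewrite modn_small.
by rewrite -{1}(subnK H) modnDr modn_small //; lia.
Qed.

Lemma gsouthE (x : 'I_N) : gsouth x = (if x + W < N then x + W else x + W - N) :> nat.
Proof. by rewrite /= modn_shift //; have := WN; lia. Qed.

Lemma gnorthE (x : 'I_N) : gnorth x = (if x < W then x + N - W else x - W) :> nat.
Proof.
have := WN => H; rewrite /= modn_shift //; last lia.
by have xN := ltn_ord x; do ![case: ltnP => ?]; lia.
Qed.

Lemma geastE (x : 'I_N) : ghasE x -> geast x = x.+1 :> nat.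
Proof.
rewrite /ghasE => H; rewrite /geast val_insubd; case: ifP => // /negbT; rewrite -leqNgt => K.
have xN : x.+1 = N by apply/eqP; rewrite eqn_leq K andbT.
have : (x.+1 %% W = 0)%N by rewrite xN /N modnMl.
have -> : x.+1 %% W = (x %% W).+1.
  by rewrite {1}(divn_eq x W) -addnS modnMDl modn_small.
by [].
Qed.

Lemma gwestE (x : 'I_N) : gwest x = x.-1 :> nat.
Proof. by rewrite /gwest val_insubd; case: ifP => //; have := ltn_ord x; lia. Qed.

Lemma modS x : x %% W < n -> x.+1 %% W = (x %% W).+1.
Proof. by move=> H; rewrite {1}(divn_eq x W) -addnS modnMDl modn_small. Qed.

Lemma modP x : 0 < x %% W -> 0 < x /\ x.-1 %% W = (x %% W).-1.
Proof.
case: x => [|x]; rewrite ?mod0n // => H; split=> //=.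
case: (ltnP (x %% W) n) => K; first by rewrite modS.
have E : x %% W = n by apply/eqP; rewrite eqn_leq K -ltnS ltn_mod.
by move: H; rewrite {1}(divn_eq x W) E -addnS addnC -mulSn modnMl.
Qed.

Lemma col_south (x : 'I_N) : gsouth x %% W = x %% W.
Proof. by rewrite /= modn_dvdm ?modnDr // /N dvdn_mull. Qed.

Lemma col_north (x : 'I_N) : gnorth x %% W = x %% W.
Proof.
rewrite /= modn_dvdm ?dvdn_mull //.
have -> : N - W = (R.*2 - 1) * W by rewrite mulnBl mul1n.
by rewrite addnC modnMDl.
Qed.

Lemma grid_cylinder (x y : 'I_N) :
  grid_adj x y = cylinder_adj gsouth gnorth geast gwest ghasE ghasW x y.
Proof.
rewrite /grid_adj /cylinder_adj -!val_eqE /=; congr [|| _, _ , _ | _].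
- by rewrite /ghasE; case E: (_ < n) => //=; rewrite geastE.
- rewrite /ghasW; case E: (0 < _) => //=; rewrite gwestE.
  by have [H _] := modP E; case: (nat_of_ord x) H.
Qed.

Lemma iter_gsouth k (v : 'I_N) : v < W -> k < R.*2 -> iter k gsouth v = k * W + v :> nat.
Proof.
move=> vW; elim: k => [|k IH] kR; first by [].
rewrite iterS gsouthE IH ?(ltnW kR) //.
have : k.+2 * W <= N by rewrite leq_mul2r kR orbT.
by rewrite !mulSn; case: ifP; lia.
Qed.

Lemma gnN : n < N. Proof. by have := WN; lia. Qed.

Lemma div_row x : x < N -> x %/ W < R.*2.
Proof. by move=> H; rewrite ltn_divLR // mulnC [X in _ < X]mulnC. Qed.

Lemma grid_planar : planar (fun x y : 'I_N => grid_adj x y).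
Proof.
apply: planar_ext (_ : planar (cylinder_adj gsouth gnorth geast gwest ghasE ghasW)).
  by move=> x y; rewrite grid_cylinder.
have WN4 := WN.
apply: (@cylinder_planar _ _ _ _ _ _ _ (Ordinal N_gt0) (Ordinal gnN)).
- move=> x; apply: ord_inj; rewrite gnorthE gsouthE; have xN := ltn_ord x; case: (ltnP (x + W) N) => ?; case: ltnP => ?; lia.
- move=> x; apply: ord_inj; rewrite gsouthE gnorthE; have xN := ltn_ord x; case: (ltnP x W) => ?; case: ltnP => ?; lia.
- by move=> x; rewrite /ghasE col_south.
- by move=> x; rewrite /ghasW col_south.
- by move=> x E; rewrite /ghasW geastE // modS.
- move=> x H; rewrite /ghasE gwestE; have [_ ->] := modP H.
  by have := ltn_pmod x (ltn0Sn n); rewrite /ghasW in H; lia.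
- by move=> x E; apply: ord_inj; rewrite gwestE geastE.
- move=> x H; have [x0 E] := modP H; have gE : ghasE (gwest x).
    by rewrite /ghasE gwestE E; have := ltn_pmod x (ltn0Sn n); rewrite /ghasW in H; lia.
  by apply: ord_inj; rewrite geastE // gwestE prednK.
- move=> x E; apply: ord_inj; rewrite geastE ?/ghasE ?col_south // !gsouthE geastE //.
  move: (geastE E) (ltn_ord (geast x)) (ltn_ord x) => -> ? ?.
  (* The wrap-around cannot fall between [x] and its eastern neighbour: [N] is a multiple of [W], so
     [N.-1] is in the last column. *)
  have : x + W != N.-1.
    apply/eqP => K; have : (x + W).+1 %% W = 0 by rewrite K prednK ?N_gt0 // /N modnMl.
    by rewrite modS modnDr.
  by do ![case: ltnP => ?]; lia.
- move=> x; rewrite ord_eqE gsouthE gnorthE; have xN := ltn_ord x; do ![case: ltnP => ?]; lia.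
- move=> x E; rewrite ord_eqE geastE // gsouthE; have xN := ltn_ord x; do ![case: ltnP => ?]; lia.
- move=> x E; rewrite ord_eqE geastE // gnorthE; have xN := ltn_ord x; do ![case: ltnP => ?]; lia.
- move=> x E; rewrite ord_eqE gwestE gsouthE; have [x0 _] := modP E; have xN := ltn_ord x; do ![case: ltnP => ?]; lia.
- move=> x E; rewrite ord_eqE gwestE gnorthE; have [x0 _] := modP E; have xN := ltn_ord x; do ![case: ltnP => ?]; lia.
- move=> x E F; rewrite ord_eqE geastE // gwestE; have [x0 _] := modP F; lia.
- move=> x; rewrite /ghasW -eqn0Ngt => /eqP E; exists (x %/ W); apply: ord_inj.
  by rewrite iter_gsouth ?div_row //= -E -divn_eq.
- move=> x; rewrite /ghasE -leqNgt => H; exists (x %/ W); apply: ord_inj.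
  rewrite iter_gsouth ?div_row //=.
  have <- : x %% W = n by apply/eqP; rewrite eqn_leq H -ltnS ltn_pmod.
  by rewrite -divn_eq.
- move=> x.
  have H m : m <= x %% W -> iter m gwest x = x - m :> nat /\ (x - m) %% W = x %% W - m.
    elim: m => [|m IH] Hm; first by rewrite !subn0.
    have [E1 E2] := IH (ltnW Hm); rewrite iterS gwestE E1 !subnS; split=> //.
    by have [|_ ->] := @modP (x - m); rewrite E2 // subn_gt0.
  exists (x %% W).
    by rewrite /ghasW; have [-> ->] := H _ (leqnn _); rewrite subnn.
  by move=> m mx; rewrite /ghasW; have [-> ->] := H _ (ltnW mx); rewrite subn_gt0.
- by rewrite /ghasW [nat_of_ord _]/= mod0n.
- by rewrite /ghasE [nat_of_ord _]/= modn_small ?ltnn.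
Qed.

End Grid.

(** * Linear systems as interdiction instances *)

(* Two grid rows per row of the linear system [\sum_c x c * a r c = K]: the
   even one carries deletable arcs of weight 0 and cost [a r c], the odd one
   undeletable arcs of weight [a r c]. *)
Definition gweight (n K w : nat) (a : nat -> nat -> nat) (x y : nat) : nat :=
  if (x %% n.+1 < n) && (y == x.+1)
  then if odd (x %/ n.+1) then a (x %/ n.+1)./2 (x %% n.+1) else 0
  else if (0 < x %% n.+1) && (y.+1 == x) then K
  else if [|| (x %/ n.+1)./2 == (y %/ n.+1)./2, x %% n.+1 == 0 | x %% n.+1 == n]
  then 0 else w.

(** The cost [(R * K).+1] is one more than the budget, so all arcs but the eastward ones of even
    grid rows are undeletable. *)
Definition gcost (R n K : nat) (a : nat -> nat -> nat) (x y : nat) : nat :=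
  if [&& x %% n.+1 < n, y == x.+1 & ~~ odd (x %/ n.+1)]
  then a (x %/ n.+1)./2 (x %% n.+1) else (R * K).+1.

Section GridInstance.
Variables (R n K w Q : nat) (a A : nat -> nat -> nat).
Hypothesis (R2 : 1 < R) (n0 : 0 < n) (K0 : 0 < K).

Let W := n.+1.
Let N := R.*2 * W.

Definition grid_arcs : {set 'I_N * 'I_N} := [set e : 'I_N * 'I_N | grid_adj R n e.1 e.2].

Lemma grid_adj_sym (x y : 'I_N) : grid_adj R n x y -> grid_adj R n y x.
Proof.
have WN4 : 4 * W <= N by apply: (@WN R n R2).
have N0 : 0 < N by apply: (@N_gt0 R n R2).
have [xN yN] := (ltn_ord x, ltn_ord y).
case/or4P=> [/eqP E|/eqP E|/andP[H /eqP E]|/andP[H /eqP E]]; apply/or4P.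
- apply: Or42; apply/eqP; move: E; rewrite (@modn_shift R n) -/W -/N; try lia.
  by rewrite (@modn_shift R n) -/W -/N; try lia; case: ltnP => ? ?; case: ltnP => ?; lia.
- apply: Or41; apply/eqP; move: E; rewrite (@modn_shift R n) -/W -/N; try lia.
  by rewrite (@modn_shift R n) -/W -/N; try lia; case: ltnP => ? ?; case: ltnP => ?; lia.
- apply: Or44; rewrite E eqxx modS //.
- have [x0 M] := modP H; apply: Or43; rewrite -E eqxx andbT.
  by move: M; rewrite -E /= => ->; have := ltn_pmod x (ltn0Sn n); lia.
Qed.

Lemma grid_adj_irr (x : 'I_N) : ~~ grid_adj R n x x.
Proof.
have WN4 : 4 * W <= N by apply: (@WN R n R2).
have xN := ltn_ord x.
apply/negP => /or4P[/eqP|/eqP|/andP[_ /eqP]|/andP[_ /eqP]]; try lia.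
  by rewrite (@modn_shift R n) -/W -/N; try lia; case: ltnP => ?; lia.
by rewrite (@modn_shift R n) -/W -/N; try lia; case: ltnP => ?; lia.
Qed.

Lemma grid_underlying : underlying grid_arcs =2 (fun x y : 'I_N => grid_adj R n x y).
Proof.
move=> x y; rewrite /underlying /= !inE /=.
have -> : grid_adj R n y x = grid_adj R n x y by apply/idP/idP; apply: grid_adj_sym.
rewrite orbb andbC; case E: (grid_adj R n x y) => //=.
by apply/eqP => xy; move: (grid_adj_irr x); rewrite {2}xy E.
Qed.

Lemma grid_arcs_planar : planar (underlying grid_arcs).
Proof. by apply: planar_ext (grid_planar R2 n0) => x y; rewrite grid_underlying. Qed.

Definition gsource : 'I_N := Ordinal (@N_gt0 R n R2).
Definition gtarget : 'I_N := Ordinal (gnN R2 n0).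

Lemma gsource_neq_target : gsource != gtarget.
Proof. by rewrite ord_eqE /=; case: n n0. Qed.

Lemma gbudget_gt0 : 0 < R * K.
Proof. by rewrite muln_gt0 K0 (ltnW R2). Qed.

(** Source and target are the two ends of the first grid row; the threshold [K.-1] makes exceeding
    it mean a distance of at least [K]. *)
Definition grid_instance : instance :=
  @Instance N grid_arcs grid_arcs_planar
    (fun e => gweight n K w a e.1 e.2) (fun e => gcost R n K a e.1 e.2)
    (R * K) gbudget_gt0 gsource gtarget gsource_neq_target K.-1.

Hypothesis aE : forall r c, r < R -> c < n -> a r c = Q + A r c.
Hypothesis QE : 2 * w < Q.
Hypothesis wE : forall r, r < R -> \sum_(c < n) A r c <= w.

(** This is the potential that a solution [x] gives to column [c] in row [r] of the system. *)
Definition partial_sum (x : nat -> bool) r c := \sum_(j < c) x j * a r j.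

Lemma partial_sumS x r c : partial_sum x r c.+1 = partial_sum x r c + x c * a r c.
Proof. by rewrite /partial_sum big_ord_recr. Qed.

Lemma partial_sum_mono x r c d : c <= d -> partial_sum x r c <= partial_sum x r d.
Proof.
move=> /subnK <-; elim: (d - c) => //= k IH; rewrite addSn partial_sumS.
exact: leq_trans IH (leq_addr _ _).
Qed.

Lemma partial_sum_split x r c : r < R -> c <= n ->
  exists2 s, s <= w & partial_sum x r c = Q * \sum_(j < c) x j + s.
Proof.
move=> rR cn; exists (\sum_(j < c) x j * A r j).
  apply: leq_trans (wE rR); rewrite -(subnKC cn) big_split_ord /=.
  apply: leq_trans (leq_addr _ _); apply: leq_sum => j _.
  by case: (x j); rewrite ?mul1n.
rewrite big_distrr /= -big_split; apply: eq_bigr => j _ /=.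
by rewrite aE // ?(leq_trans (ltn_ord j)) // mulnDr mulnC.
Qed.

(** Both rows count the same columns, so their multiples of [Q] cancel and only the small parts, at
    most [w], remain. *)
Lemma partial_sum_close x r s c : r < R -> s < R -> c <= n ->
  partial_sum x r c <= partial_sum x s c + w.
Proof.
move=> rR sR cn.
have [u uw ->] := partial_sum_split x rR cn; have [v vw ->] := partial_sum_split x sR cn.
by move: (Q * _) => q; lia.
Qed.

Definition row_solution (x : nat -> bool) : Prop :=
  forall r, r < R -> \sum_(c < n) x c * a r c = K.

Lemma div_row' (x : 'I_N) : (x %/ W)./2 < R.
Proof. by have := @div_row R n x (ltn_ord x); rewrite -/W; lia. Qed.

Lemma vertical_col (x y : 'I_N) : grid_adj R n x y ->
  ~~ ((x %% W < n) && (y == x.+1 :> nat)) -> ~~ ((0 < x %% W) && (y.+1 == x)) ->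
  y %% W = x %% W.
Proof.
case/or4P=> [/eqP -> _ _|/eqP -> _ _|->|->] //.
  exact: (col_south R2 x).
exact: (col_north R2 x).
Qed.

Definition pack_vertex (r c : nat) : 'I_N := insubd gsource (r * W + c).

Lemma pack_vertexE r c : r < R.*2 -> c < W -> pack_vertex r c = r * W + c :> nat.
Proof.
move=> rR cW; rewrite val_insubd ifT // /N.
have : r.+1 * W <= R.*2 * W by rewrite leq_mul2r rR orbT.
by rewrite mulSn; lia.
Qed.

Lemma pack_row r c : r < R.*2 -> c < W -> pack_vertex r c %/ W = r.
Proof. by move=> rR cW; rewrite pack_vertexE // divnMDl // divn_small // addn0. Qed.

Lemma pack_col r c : r < R.*2 -> c < W -> pack_vertex r c %% W = c.
Proof. by move=> rR cW; rewrite pack_vertexE // modnMDl modn_small. Qed.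

Lemma solution_exceeds x : row_solution x -> interdiction_exceeds grid_instance.
Proof.
move=> sol; apply/interdiction_gtP.
pose h (p : 'I_R * 'I_n) := (pack_vertex p.1.*2 p.2, pack_vertex p.1.*2 p.2.+1).
have r2 (r : 'I_R) : r.*2 < R.*2 by rewrite ltn_double.
have cW (c : 'I_n) : c < W by apply: ltnW; rewrite ltnS.
have cW' (c : 'I_n) : c.+1 < W by rewrite ltnS.
have h_inj : injective h.
  move=> [r c] [r' c'] [/(congr1 (@nat_of_ord _)) E _].
  have E1 := congr1 (fun v => v %/ W) E; have E2 := congr1 (fun v => v %% W) E.
  rewrite !pack_row // in E1; rewrite !pack_col // in E2; congr pair; apply: ord_inj => //.
  exact: double_inj.
(* The cut takes the deletable arcs in the columns chosen by [x]. The potential agrees on the two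
   grid rows of the same row of the system. *)
pose I := [set h p | p in [pred p : 'I_R * 'I_n | x p.2]].
exists I, (fun v : 'I_N => partial_sum x (v %/ W)./2 (v %% W)); split.
- apply/subsetP => _ /imsetP[[r c] _ ->]; rewrite inE /=; apply/or4P; apply: Or43.
  by rewrite pack_col // ltn_ord !pack_vertexE // addnS eqxx.
- rewrite /= big_imset /=; last by move=> ? ? _ _; apply: h_inj.
  have -> : R * K = \sum_(r < R) \sum_(c < n) x c * a r c.
    by rewrite (eq_bigr (fun=> K)) ?sum_nat_const ?card_ord // => r _; apply: sol.
  rewrite pair_bigA big_mkcond; apply: leq_sum => -[r c] _ /=; rewrite inE /=.
  case: (x c) => //; rewrite mul1n /gcost pack_col // pack_row // ltn_ord odd_double /=.
  by rewrite !pack_vertexE // addnS eqxx doubleK.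
- split.
  + by rewrite /= mod0n /partial_sum big_ord0.
  + rewrite /= divn_small // modn_small // /partial_sum sol ?prednK // ltnW //.
  + move=> u v; rewrite !inE => /andP[NI uv]; rewrite /= /gweight -/W.
    case: ifP => [/andP[un /eqP E]|/negbT NE].
      have -> : v %/ W = u %/ W.
        by rewrite E [in LHS](divn_eq u W) -addnS divnMDl // [X in _ + X]divn_small ?addn0.
      rewrite E modS // partial_sumS leq_add2l; case: ifP => Od; first by case: (x _); rewrite ?mul1n.
      rewrite leqn0 muln_eq0; apply/orP; left; case xu: (x (u %% W)) => //.
      case/negP: NI; apply/imsetP; exists (Ordinal (div_row' u), Ordinal un); first by rewrite inE.
      have Eu : (u %/ W)./2.*2 = u %/ W by rewrite -[RHS]odd_double_half Od.
      congr pair; apply: ord_inj; rewrite pack_vertexE ?Eu //; try exact: (@div_row R n).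
      * exact: divn_eq.
      * by rewrite E [in LHS](divn_eq u W) addnS.
    (* A westward arc weighs [K], which is the largest value of the potential, and so imposes
       nothing. *)
    case: ifP => [/andP[u0 /eqP E]|/negbT NW].
      have [u0' M] := modP u0; apply: (@leq_trans K); last exact: leq_addl.
      rewrite -(sol _ (div_row' v)); apply: partial_sum_mono.
      by rewrite -ltnS ltn_pmod.
    have C := vertical_col uv NE NW; rewrite C.
    (* A vertical arc has weight 0 within a row of the system and in the border columns, where the
       potential is 0 or [K] in every row; elsewhere the weight [w] absorbs the difference. *)
    case: ifP => [/or3P[/eqP ->|/eqP ->|/eqP ->]|_].
    * exact: leq_addr.
    * by rewrite /partial_sum !big_ord0.
    * by rewrite addn0 [X in X <= _](sol _ (div_row' v)) [X in _ <= X](sol _ (div_row' u)).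
    apply: partial_sum_close; try exact: div_row'.
    by rewrite -ltnS ltn_pmod.
Qed.

Lemma arc_cost_le (I : {set 'I_N * 'I_N}) (e : 'I_N * 'I_N) :
  \sum_(e in I) gcost R n K a e.1 e.2 <= R * K -> gcost R n K a e.1 e.2 = (R * K).+1 -> e \notin I.
Proof.
move=> cI ce; apply/negP => eI; move: cI; rewrite (bigD1 e) //= ce.
by rewrite addSn ltnNge leq_addr.
Qed.

(** Since [gweight] and [gcost] recognize eastward arcs by consecutive numbers, vertical arcs must
    not be mistaken for them; columns modulo [W > 1] tell them apart. *)
Lemma pack_neq r r' c : c < W -> (r' * W + c == (r * W + c).+1) = false.
Proof.
move=> cW; apply/eqP => /(congr1 (modn^~ W)); rewrite -addnS !modnMDl.
rewrite [c %% W]modn_small //; move: cW; rewrite ltnS leq_eqVlt => /orP[/eqP ->|cn].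
  by rewrite modnn => E; move: n0; rewrite E.
by rewrite modn_small // => /eqP; rewrite -[X in X == _]addn0 -addn1 eqn_add2l.
Qed.

Lemma vertical_weight r r' c : r < R.*2 -> r' < R.*2 -> c < W ->
  gweight n K w a (pack_vertex r c) (pack_vertex r' c) =
  if [|| r./2 == r'./2, c == 0 | c == n] then 0 else w.
Proof.
move=> rR r'R cW; rewrite /gweight -/W !pack_row // !pack_col // !pack_vertexE //.
by rewrite pack_neq // andbF eq_sym pack_neq // andbF.
Qed.

Lemma vertical_cost r r' c : r < R.*2 -> r' < R.*2 -> c < W ->
  gcost R n K a (pack_vertex r c) (pack_vertex r' c) = (R * K).+1.
Proof. by move=> rR r'R cW; rewrite /gcost !pack_vertexE // pack_neq // andbF. Qed.

Lemma south_adj r c : r.+1 < R.*2 -> c < W ->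
  grid_adj R n (pack_vertex r c) (pack_vertex r.+1 c).
Proof.
move=> rR cW; apply/or4P/Or41; rewrite -/W -/N !pack_vertexE ?(ltnW rR) //.
have : r.+2 * W <= N by rewrite leq_mul2r rR orbT.
rewrite !mulSn => H; rewrite modn_small; last lia.
by apply/eqP; lia.
Qed.

Lemma north_adj r c : r.+1 < R.*2 -> c < W ->
  grid_adj R n (pack_vertex r.+1 c) (pack_vertex r c).
Proof. by move=> rR cW; apply: grid_adj_sym; apply: south_adj. Qed.

Lemma east_adj r c : r < R.*2 -> c < n ->
  grid_adj R n (pack_vertex r c) (pack_vertex r c.+1).
Proof.
move=> rR cn; have cW : c < W by apply: ltnW.
by apply/or4P/Or43; rewrite -/W pack_col // cn !pack_vertexE // addnS eqxx.
Qed.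

Lemma east_weight r c : r < R.*2 -> c < n ->
  gweight n K w a (pack_vertex r c) (pack_vertex r c.+1) = if odd r then a r./2 c else 0.
Proof.
move=> rR cn; have cW : c < W by apply: ltnW.
by rewrite /gweight -/W pack_col // pack_row // cn !pack_vertexE // addnS eqxx.
Qed.

Lemma east_cost r c : r < R.*2 -> c < n ->
  gcost R n K a (pack_vertex r c) (pack_vertex r c.+1) = if odd r then (R * K).+1 else a r./2 c.
Proof.
move=> rR cn; have cW : c < W by apply: ltnW.
by rewrite /gcost -/W pack_col // pack_row // cn !pack_vertexE // addnS eqxx /=; case: odd.
Qed.

(** Consecutive prefix counts differ by the value at one column. *)
Lemma count_determined (x y : nat -> bool) :
  (forall c, c <= n -> \sum_(j < c) x j = \sum_(j < c) y j) ->
  forall c, c < n -> x c = y c.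
Proof.
move=> H c cn; have := H _ cn; rewrite !big_ord_recr /= (H c (ltnW cn)).
by move/addnI; case: (x c); case: (y c).
Qed.

Lemma exceeds_solution : interdiction_exceeds grid_instance -> exists x, row_solution x.
Proof.
move=> /interdiction_gtP [I [f [_ cI [f0 fn Hf]]]].
rewrite /= in f I cI f0 fn Hf.
have step r c r' c' : grid_adj R n (pack_vertex r c) (pack_vertex r' c') ->
    (pack_vertex r c, pack_vertex r' c') \notin I ->
    f (pack_vertex r' c') <= f (pack_vertex r c) + gweight n K w a (pack_vertex r c) (pack_vertex r' c').
  by move=> adj NI; apply: Hf; rewrite !inE NI.
have vert_step r r' c : grid_adj R n (pack_vertex r c) (pack_vertex r' c) ->
    r < R.*2 -> r' < R.*2 -> c < W -> f (pack_vertex r' c) <= f (pack_vertex r c) +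
       if [|| r./2 == r'./2, c == 0 | c == n] then 0 else w.
  move=> adj rR r'R cW; rewrite -vertical_weight //; apply: step => //.
  by apply: (arc_cost_le cI); rewrite vertical_cost.
have R0 : 0 < R.*2 by rewrite double_gt0 ltnW.
(* The border columns consist of undeletable arcs of weight 0, which carry the value at the source,
   and below the bound at the target, to all rows. *)
have left r : r < R.*2 -> f (pack_vertex r 0) = 0.
  elim: r => [|r IH] rR.
    by rewrite (_ : pack_vertex 0 0 = gsource) //; apply: ord_inj; rewrite pack_vertexE.
  have := vert_step _ _ _ (south_adj rR (ltn0Sn n)) (ltnW rR) rR (ltn0Sn n).
  by rewrite IH ?(ltnW rR) // eqxx orbT leqn0 => /eqP.
have right r : r < R.*2 -> K <= f (pack_vertex r n).
  elim: r => [|r IH] rR.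
    rewrite (_ : pack_vertex 0 n = gtarget); first by apply: leq_trans fn; rewrite prednK.
    by apply: ord_inj; rewrite pack_vertexE.
  apply: leq_trans (IH (ltnW rR)) _.
  have := vert_step _ _ _ (north_adj rR (ltnSn n)) rR (ltnW rR) (ltnSn n).
  by rewrite eqxx !orbT addn0.
pose X r c := (pack_vertex r.*2 c, pack_vertex r.*2 c.+1) \in I.
pose P r c := partial_sum (X r) r c.
have even_odd r c : r < R -> c < W -> f (pack_vertex r.*2.+1 c) = f (pack_vertex r.*2 c).
  move=> rR cW; have rR1 : r.*2.+1 < R.*2 by rewrite -doubleS leq_double.
  apply/eqP; rewrite eqn_leq.
  have := vert_step _ _ _ (south_adj rR1 cW) (ltnW rR1) rR1 cW.
  have := vert_step _ _ _ (north_adj rR1 cW) rR1 (ltnW rR1) cW.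
  by rewrite /= uphalf_double doubleK eqxx /= !addn0 => -> ->.
(* If the arc of the even grid row is cut, the parallel one of weight [a r c] in the odd grid row
   still limits the climb; if not, its weight 0 forbids any climb. *)
have row_step r c : r < R -> c < n ->
    f (pack_vertex r.*2 c.+1) <= f (pack_vertex r.*2 c) + X r c * a r c.
  move=> rR cn; have rR1 : r.*2.+1 < R.*2 by rewrite -doubleS leq_double.
  case Xrc : (X r c).
    rewrite mul1n -even_odd // -even_odd ?(ltnW cn) //; last exact: ltnW.
    have := step _ _ _ _ (east_adj rR1 cn); rewrite east_weight // /= odd_double uphalf_double; apply.
    by apply: (arc_cost_le cI); rewrite east_cost //= odd_double.
  have := step _ _ _ _ (east_adj (ltnW rR1) cn) (negbT Xrc).
  by rewrite east_weight ?(ltnW rR1) // odd_double.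
have row_le r c d : r < R -> c <= d -> d <= n ->
    f (pack_vertex r.*2 d) + P r c <= f (pack_vertex r.*2 c) + P r d.
  move=> rR; elim: d => [|d IH]; first by rewrite leqn0 => /eqP ->.
  rewrite leq_eqVlt => /orP[/eqP -> //|]; rewrite ltnS => cd dn.
  have := IH cd (ltnW dn); have := row_step r d rR dn.
  by rewrite /P partial_sumS; lia.
have r2R r : r < R -> r.*2 < R.*2 by rewrite ltn_double.
have total_ge r : r < R -> K <= P r n.
  move=> rR; have := row_le r 0 n rR (leq0n n) (leqnn n).
  rewrite left ?r2R // {1}/P /partial_sum big_ord0 addn0 add0n; apply: leq_trans.
  exact/right/r2R.
(* The left side is the cost of the cut arcs lying in even grid rows, hence at most the budget. *)
have total_le : \sum_(r < R) P r n <= R * K.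
  apply: leq_trans cI.
  pose h (p : 'I_R * 'I_n) := (pack_vertex p.1.*2 p.2, pack_vertex p.1.*2 p.2.+1).
  have h_inj : injective h.
    move=> [r c] [r' c'] [/(congr1 (@nat_of_ord _)) E _].
    have E1 := congr1 (fun v => v %/ W) E; have E2 := congr1 (fun v => v %% W) E.
    have cW (j : 'I_n) : j < W by apply: ltnW; rewrite ltnS.
    rewrite !pack_row ?r2R // in E1; rewrite !pack_col ?r2R // in E2; congr pair; apply: ord_inj => //.
    exact: double_inj.
  pose S := [set h p | p in [pred p : 'I_R * 'I_n | X p.1 p.2]].
  have SI : S \subset I by apply/subsetP => _ /imsetP[p Xp ->].
  rewrite (big_setID S) /= (setIidPr SI); apply: leq_trans (leq_addr _ _).
  rewrite big_imset /=; last by move=> ? ? _ _; apply: h_inj.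
  rewrite /P /partial_sum pair_bigA [X in _ <= X]big_mkcond; apply: leq_sum => -[r c] _ /=.
  rewrite inE /=; case: (X r c) => //; rewrite mul1n east_cost ?r2R // odd_double doubleK //.
(* There are [R] terms, each at least [K], and their sum is at most [R * K]. *)
have total r : r < R -> P r n = K.
  move=> rR; apply/eqP; rewrite eqn_leq total_ge // andbT.
  move: total_le; rewrite (bigD1 (Ordinal rR)) //=.
  have : \sum_(i < R | i != Ordinal rR) K <= \sum_(i < R | i != Ordinal rR) P i n.
    by apply: leq_sum => i _; apply: total_ge.
  rewrite sum_nat_const.
  have -> : #|[pred i : 'I_R | i != Ordinal rR]| = R.-1.
    by have := cardC1 (Ordinal rR); rewrite card_ord => <-; apply: eq_card.
  move: (\sum_(i < R | _) _) => S; have -> : R * K = K + R.-1 * K by rewrite -mulSn prednK // ltnW.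
  lia.
(* Since the total climb is exactly what the cuts allow, it is tight everywhere: the climb from the
   left border bounds [f] above, the climb still due to the right border bounds it below. *)
have fE r c : r < R -> c <= n -> f (pack_vertex r.*2 c) = P r c.
  move=> rR cn; apply/eqP; rewrite eqn_leq; apply/andP; split.
    have := row_le r 0 c rR (leq0n c) cn.
    by rewrite left ?r2R // {1}/P /partial_sum big_ord0 addn0 add0n.
  have := row_le r c n rR cn (leqnn n); rewrite total //.
  by have := right _ (r2R _ rR); lia.
(* Both directions of the arc between the odd grid row of [r] and the even grid row of [r.+1] are
   used. *)
have close r c : r.+1 < R -> c <= n -> P r c <= P r.+1 c + w /\ P r.+1 c <= P r c + w.
  move=> rR cn; rewrite -!fE ?(ltnW rR) // doubleS.
  have rR1 : r.*2.+2 < R.*2 by rewrite -doubleS ltn_double.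
  rewrite -(even_odd r c) ?(ltnW rR) //.
  have := vert_step _ _ _ (south_adj rR1 cn) (ltnW rR1) rR1 cn.
  have := vert_step _ _ _ (north_adj rR1 cn) rR1 (ltnW rR1) cn.
  by do 2 case: ifP => _; lia.
(* If [k] and [l] are the numbers of cuts before [c] in the two rows, [Q * k] and [Q * l] differ by
   at most [2 * w < Q], so [k = l]. *)
have same r c : r.+1 < R -> c < n -> X r.+1 c = X r c.
  move=> rR; apply: (@count_determined (X r.+1) (X r)) => {}c cn.
  have [] := close r c rR cn; rewrite /P.
  have [u uw ->] := partial_sum_split (X r) (ltnW rR) cn.
  have [v vw ->] := partial_sum_split (X r.+1) rR cn.
  move: (\sum_(j < c) _) (\sum_(j < c) _) => k l H1 H2.
  case: (ltngtP k l) => // H.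
    have : Q * k.+1 <= Q * l by rewrite leq_mul2l H orbT.
    by rewrite mulnS; lia.
  have : Q * l.+1 <= Q * k by rewrite leq_mul2l H orbT.
  by rewrite mulnS; lia.
have all_same r c : r < R -> c < n -> X r c = X 0 c.
  by move=> + cn; elim: r => // r IH rR; rewrite same // IH // ltnW.
exists (X 0) => r rR; rewrite -(total r rR) /P /partial_sum.
by apply: eq_bigr => c _; rewrite (all_same r c).
Qed.

End GridInstance.

Lemma sum_ord_mul (G m : nat) (F : nat -> nat) :
  \sum_(j < G * m) F j = \sum_(g < G) \sum_(k < m) F (g * m + k).
Proof.
elim: G => [|G IH]; first by rewrite mul0n !big_ord0.
by rewrite mulSn addnC big_split_ord /= IH big_ord_recr.
Qed.

(** * Tableaux *)

(* A tableau with [TT] rows and [PP] columns of tiles numbered from 0 to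
   [m.-1]. The tiles allowed in a cell are given by [dom]; adjacent tiles must
   agree in the sense of [fE], [fW] horizontally and [fS], [fN] vertically. *)
Section Tableau.
Variables (TT PP m C : nat) (dom : nat -> nat -> nat -> bool).
Variables (fE fW fS fN : nat -> nat).

Let G := TT * PP.
Let n := G * m.

Definition tableau (s : nat -> nat -> nat) : Prop :=
  forall t p, t < TT -> p < PP ->
    [/\ s t p < m, dom t p (s t p),
        p.+1 < PP -> fE (s t p) = fW (s t p.+1) &
        t.+1 < TT -> fS (s t p) = fN (s t.+1 p)].

Definition has_neighbour (k g : nat) : bool :=
  if k == 0 then false else if k == 1 then (g %% PP).+1 < PP else g + PP < G.

Definition neighbour (k g : nat) : nat := if k == 1 then g.+1 else g + PP.

(** A row is meant to sum to [C]. For [k = 0] it says that the chosen tile is allowed; for [k = 1]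
    and [k = 2] the colour of the tile plus [C] minus that of its eastern or southern neighbour
    gives [C] exactly when they agree. At the border the row is made trivial by the coefficient
    [C]. *)
Definition own_coef (k g i : nat) : nat :=
  if k == 0 then if dom (g %/ PP) (g %% PP) i then C else 0
  else if has_neighbour k g then if k == 1 then fE i else fS i else C.

Definition neighbour_coef (k i : nat) : nat := C - (if k == 1 then fW i else fN i).

(* Row [k * G + g] expresses the constraint number [k] at the cell [g]; column
   [g * m + i] stands for the tile [i] in the cell [g]. *)
Definition coef (r j : nat) : nat :=
  let k := r %/ G in let g := r %% G in
  (if j %/ m == g then own_coef k g (j %% m) else 0) +
  (if has_neighbour k g && (j %/ m == neighbour k g) then neighbour_coef k (j %% m) else 0).

(** Each of the [n] coefficients is at most [C], so this bounds every row sum. The scale exceeds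
    twice this bound, and the total asks for [G] chosen tiles with a remainder [C]. *)
Definition tableau_weight := n * C.
Definition tableau_scale := (2 * tableau_weight).+1.
Definition tableau_total := tableau_scale * G + C.

Hypothesis (TT0 : 0 < TT) (PP0 : 0 < PP) (m0 : 0 < m) (C0 : 0 < C).
Hypothesis fC : forall i, [/\ fE i <= C, fW i <= C, fS i <= C & fN i <= C].

Lemma G_gt0 : 0 < G. Proof. by rewrite muln_gt0 TT0. Qed.

Lemma neighbour_neq k g : has_neighbour k g -> neighbour k g != g.
Proof.
rewrite /has_neighbour /neighbour; case: (k == 0) => //.
by case: (k == 1) => _; [rewrite neq_ltn ltnSn orbT|rewrite -[X in _ != X]addn0 eqn_add2l -lt0n].
Qed.

Lemma neighbour_lt k g : g < G -> has_neighbour k g -> neighbour k g < G.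
Proof.
rewrite /has_neighbour /neighbour; case: (k == 0) => //; case: (k == 1) => // gG H.
have := divn_eq g PP; have : g %/ PP < TT by rewrite ltn_divLR.
move=> H1 H2; rewrite {1}H2 -addnS.
have : (g %/ PP).+1 * PP <= G by rewrite leq_mul2r H1 orbT.
by rewrite mulSn; lia.
Qed.

(** A cell differs from its neighbour, so at most one of the two summands is nonzero. *)
Lemma coef_le r j : coef r j <= C.
Proof.
rewrite /coef /=; set k := r %/ G; set g := r %% G.
case: eqP => [->|_].
  case: ifP => [/andP[H /eqP E]|_]; first by move: (neighbour_neq H); rewrite -E eqxx.
  rewrite addn0 /own_coef; have [H1 _ H3 _] := fC (j %% m).
  by case: (k == 0); case: ifP => // _; case: (k == 1).
by case: ifP => // _; rewrite add0n leq_subr.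
Qed.

Lemma coef_sum r : \sum_(j < n) coef r j <= tableau_weight.
Proof.
have -> : tableau_weight = \sum_(j < n) C by rewrite sum_nat_const card_ord.
by apply: leq_sum => j _; apply: coef_le.
Qed.

Definition dot (x : nat -> bool) (g : nat) (u : nat -> nat) : nat :=
  \sum_(i < m) x (g * m + i) * u i.

Lemma row_dot (x : nat -> bool) k g : g < G ->
  \sum_(j < n) x j * coef (k * G + g) j =
  dot x g (own_coef k g) +
  (if has_neighbour k g then dot x (neighbour k g) (neighbour_coef k) else 0).
Proof.
move=> gG; rewrite (sum_ord_mul G m (fun j => x j * coef (k * G + g) j)).
have E (h : 'I_G) : \sum_(i < m) x (h * m + i) * coef (k * G + g) (h * m + i) =
    (if h == g :> nat then dot x h (own_coef k g) else 0) +
    (if has_neighbour k g && (h == neighbour k g :> nat) then dot x h (neighbour_coef k) else 0).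
  rewrite /coef divnMDl ?G_gt0 // modnMDl divn_small // modn_small // addn0 /dot.
  set b := has_neighbour k g && _.
  have -> : (if h == g :> nat then \sum_(i < m) x (h * m + i) * own_coef k g i else 0) =
      \sum_(i < m) x (h * m + i) * (if h == g :> nat then own_coef k g i else 0).
    by case: eqP => // _; rewrite big1 // => i _; rewrite muln0.
  have -> : (if b then \sum_(i < m) x (h * m + i) * neighbour_coef k i else 0) =
      \sum_(i < m) x (h * m + i) * (if b then neighbour_coef k i else 0).
    by case: (b) => //; rewrite big1 // => i _; rewrite muln0.
  rewrite -big_split; apply: eq_bigr => i _ /=.
  by rewrite divnMDl // modnMDl divn_small // modn_small // addn0 mulnDr.
rewrite (eq_bigr _ (fun h _ => E h)) big_split /=; congr addn.
  rewrite (bigD1 (Ordinal gG)) //= eqxx big1 ?addn0 // => h.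
  by rewrite -val_eqE /= => /negPf ->.
case: ifP => [H|_] /=; last by rewrite big1.
rewrite (bigD1 (Ordinal (neighbour_lt gG H))) //= eqxx big1 ?addn0 // => h.
by rewrite -val_eqE /= => /negPf ->.
Qed.

Definition tableau_solution (x : nat -> bool) : Prop := forall r, r < 3 * G ->
  \sum_(j < n) x j * (tableau_scale + coef r j) = tableau_total.

Lemma solution_split (x : nat -> bool) r : \sum_(j < n) x j * (tableau_scale + coef r j) =
  tableau_scale * \sum_(j < n) x j + \sum_(j < n) x j * coef r j.
Proof.
rewrite big_distrr -big_split; apply: eq_bigr => j _ /=.
by rewrite mulnDr mulnC.
Qed.

(** Both the sum of the chosen coefficients and [C] are below the scale, so the quotient and the
    remainder of the total can be compared separately. *)
Lemma tableau_solutionP (x : nat -> bool) : tableau_solution x <->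
  \sum_(j < n) x j = G /\ forall r, r < 3 * G -> \sum_(j < n) x j * coef r j = C.
Proof.
have small r : \sum_(j < n) x j * coef r j <= tableau_weight.
  apply: leq_trans (coef_sum r); apply: leq_sum => j _.
  by case: (x j); rewrite ?mul1n.
have Cw : C <= tableau_weight by rewrite leq_pmull // !muln_gt0 TT0 PP0.
split=> [H|[H1 H2] r rG]; last by rewrite solution_split H1 H2.
have {}H r : r < 3 * G -> \sum_(j < n) x j = G /\ \sum_(j < n) x j * coef r j = C.
  move=> rG; have := H r rG; rewrite solution_split /tableau_total.
  move: (small r) Cw; rewrite /tableau_scale; move: (\sum_(j < n) x j * coef r j) (\sum_(j < n) x j) => k l.
  move: tableau_weight => w kw Cw E.
  have lG : l = G.
    apply/eqP; rewrite eqn_leq; apply/andP; split; rewrite leqNgt; apply/negP => LG.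
      have : (2 * w).+1 * G.+1 <= (2 * w).+1 * l by rewrite leq_mul2l LG orbT.
      by rewrite mulnS; lia.
    have : (2 * w).+1 * l.+1 <= (2 * w).+1 * G by rewrite leq_mul2l LG orbT.
    by rewrite mulnS; lia.
  by split=> //; move: E; rewrite lG => /addnI.
have G3 : 0 < 3 * G by rewrite muln_gt0 G_gt0.
by split=> [|r /H[]] //; have [] := H 0 G3.
Qed.

Definition picked (x : nat -> bool) (g : nat) : nat := find (fun i => x (g * m + i)) (iota 0 m).

Lemma one_hot (x : nat -> bool) g : \sum_(i < m) x (g * m + i) = 1 ->
  picked x g < m /\ forall u, dot x g u = u (picked x g).
Proof.
move=> /eqP /sum_nat_eq1 [i [_ xi H]].
have Hi j : j < m -> x (g * m + j) = (j == i :> nat).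
  move=> jm; case: eqP => [->|ji]; first by move: xi; case: (x _).
  have := H (Ordinal jm); rewrite -val_eqE /= => /(_ (introN eqP ji) isT).
  by case: (x _).
have E : picked x g = i.
  have hs : has (fun i => x (g * m + i)) (iota 0 m).
    by apply/hasP; exists (i : nat); rewrite ?mem_iota ?add0n //= Hi // eqxx.
  have := nth_find 0 hs; have := hs; rewrite has_find size_iota -/(picked x g) => pm.
  by rewrite nth_iota // add0n Hi // => /eqP.
rewrite E; split=> // u; rewrite /dot (bigD1 i) //= Hi // eqxx mul1n big1 ?addn0 //.
by move=> j ji; rewrite Hi // -[_ == _]/(j == i) (negPf ji).
Qed.

Lemma tableau_of_solution x : tableau_solution x -> exists s, tableau s.
Proof.
move=> /tableau_solutionP [cnt eqs].
have eq_at k g : k < 3 -> g < G -> dot x g (own_coef k g) +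
    (if has_neighbour k g then dot x (neighbour k g) (neighbour_coef k) else 0) = C.
  move=> k3 gG; rewrite -row_dot // eqs //.
  have : k.+1 * G <= 3 * G by rewrite leq_mul2r k3 orbT.
  by rewrite mulSn; lia.
(* The row with [k = 0] sums to [C > 0], so some allowed tile is chosen in each cell. *)
have exD g : g < G -> exists2 i, i < m & x (g * m + i) && dom (g %/ PP) (g %% PP) i.
  move=> gG; have := eq_at 0 g isT gG; rewrite /has_neighbour /= addn0 /dot => E.
  case: (pickP (fun i : 'I_m => x (g * m + i) && dom (g %/ PP) (g %% PP) i)) => [i Hi|H].
    by exists i.
  move: E C0; rewrite big1 => [<-|i _] //; rewrite /own_coef /=.
  by have := H i; case: (x _) => //= ->.
have ge1 g : g < G -> 1 <= \sum_(i < m) x (g * m + i).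
  move=> /exD [i im /andP[xi _]]; rewrite (bigD1 (Ordinal im)) //= xi.
  exact: leq_addr.
(* At least one tile in each of the [G] cells and [G] tiles in all leave exactly one per cell. *)
have eq1 g : g < G -> \sum_(i < m) x (g * m + i) = 1.
  move=> gG; apply/eqP; rewrite eqn_leq ge1 // andbT.
  move: cnt; rewrite (sum_ord_mul G m (fun j => x j)) (bigD1 (Ordinal gG)) //=.
  have : \sum_(h < G | h != Ordinal gG) 1 <= \sum_(h < G | h != Ordinal gG) \sum_(i < m) x (h * m + i).
    by apply: leq_sum => h _; apply: ge1.
  rewrite sum1_card.
  have -> : #|[pred h : 'I_G | h != Ordinal gG]| = G.-1.
    by have := cardC1 (Ordinal gG); rewrite card_ord => <-; apply: eq_card.
  move: (\sum_(h < G | _) _) => S; have := G_gt0; move: (\sum_(i < m) _) => S'; lia.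
have one g (gG : g < G) := one_hot (eq1 g gG).
pose s t p := picked x (t * PP + p).
exists s => t p tT pP; rewrite /s.
have cell t' : t' < TT -> t' * PP + p < G.
  move=> H; have : t'.+1 * PP <= G by rewrite leq_mul2r H orbT.
  by rewrite mulSn; lia.
have gG := cell t tT; set g := t * PP + p in gG *.
have [gm gu] := one g gG.
have gD : g %/ PP = t by rewrite /g divnMDl // divn_small // addn0.
have gM : g %% PP = p by rewrite /g modnMDl modn_small.
split=> // [|pP'|tT'].
- have := eq_at 0 g isT gG; rewrite /has_neighbour /= addn0 gu /own_coef /= gD gM.
  by case: ifP => // _ E; move: C0; rewrite -E.
- have hn : has_neighbour 1 g by rewrite /has_neighbour /= gM.
  have := eq_at 1 g isT gG; rewrite hn gu.
  have [_ ->] := one _ (neighbour_lt gG hn).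
  rewrite /own_coef hn /neighbour_coef /neighbour /= /g addnS.
  by have [_ + _ _] := fC (picked x (t * PP + p).+1); have [+ _ _ _] := fC (picked x (t * PP + p)); lia.
- have hn : has_neighbour 2 g.
    by rewrite /has_neighbour /=; have := cell _ tT'; rewrite mulSn /g; lia.
  have := eq_at 2 g isT gG; rewrite hn gu.
  have [_ ->] := one _ (neighbour_lt gG hn).
  rewrite /own_coef hn /neighbour_coef /neighbour /=.
  have -> : t.+1 * PP + p = g + PP by rewrite mulSn /g; lia.
  by have [_ _ _ +] := fC (picked x (g + PP)); have [_ _ + _] := fC (picked x g); lia.
Qed.

Lemma solution_of_tableau s : tableau s -> exists x, tableau_solution x.
Proof.
move=> Hs; pose f g := s (g %/ PP) (g %% PP).
have fP g : g < G -> [/\ f g < m, dom (g %/ PP) (g %% PP) (f g),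
    has_neighbour 1 g -> fE (f g) = fW (f g.+1) & has_neighbour 2 g -> fS (f g) = fN (f (g + PP))].
  move=> gG; have tT : g %/ PP < TT by rewrite ltn_divLR.
  have pP : g %% PP < PP by rewrite ltn_mod.
  have [H1 H2 H3 H4] := Hs _ _ tT pP; split=> // H.
    have {}H : (g %% PP).+1 < PP := H.
    rewrite /f H3 //; congr fW; congr s.
      by rewrite {2}(divn_eq g PP) -addnS divnMDl // [X in _ + X]divn_small ?addn0.
    by rewrite {2}(divn_eq g PP) -addnS modnMDl [RHS]modn_small.
  rewrite /f H4.
    by rewrite divnDr ?dvdnn // divnn PP0 addn1 modnDr.
  rewrite -(ltn_pmul2r PP0); move: H; rewrite /has_neighbour /= -/G mulSn.
  by have := leq_trunc_div g PP; lia.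
pose x j := j %% m == f (j %/ m).
have xE g i : i < m -> x (g * m + i) = (i == f g).
  by move=> im; rewrite /x modnMDl modn_small // divnMDl // divn_small // addn0.
have dotE g u : g < G -> dot x g u = u (f g).
  move=> gG; have [fm _ _ _] := fP g gG; rewrite /dot (bigD1 (Ordinal fm)) //= xE // eqxx mul1n.
  by rewrite big1 ?addn0 // => i; rewrite -val_eqE /= => ifg; rewrite xE // (negPf ifg).
exists x; apply/tableau_solutionP; split.
  rewrite (sum_ord_mul G m (fun j => x j)) (eq_bigr (fun=> 1)) ?sum1_card ?card_ord // => g _.
  rewrite -[RHS](dotE g (fun=> 1)) // /dot; apply: eq_bigr => i _; by rewrite muln1.
move=> r rG; have gG : r %% G < G by rewrite ltn_mod G_gt0.
rewrite (divn_eq r G) row_dot //; have [H1 H2 H3 H4] := fP _ gG.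
have k3 : r %/ G < 3 by rewrite ltn_divLR ?G_gt0.
set g := r %% G in gG H1 H2 H3 H4 *; rewrite dotE //.
case hn: (has_neighbour (r %/ G) g); last first.
  rewrite /own_coef hn H2 addn0; by case: ifP.
rewrite dotE ?neighbour_lt //; rewrite /own_coef hn.
case: (r %/ G) k3 hn => [|[|[|]]] // _ hn.
  rewrite /neighbour_coef /neighbour /= H3 // subnKC //.
  by have [] := fC (f g.+1).
rewrite /neighbour_coef /neighbour /= H4 // subnKC //.
by have [] := fC (f (g + PP)).
Qed.

End Tableau.

(* The tape contents at time [t] are read relative to the heads: position [c]
   is under the heads of all tapes at once. A tile holds the contents before the
   write, the contents after the write at the left neighbour, here and at the
   right neighbour, the state, and the scanned symbols. *)
Section MachineTableau.
Variable M : machine.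

Definition contents := {ffun 'I_(tapes M).+1 -> symbol M}.
Definition tileT := (contents * contents * contents * contents * state M * contents)%type.

Definition no_contents : contents := [ffun=> blank M].
Definition tile0 : tileT := (no_contents, no_contents, no_contents, no_contents, start M, no_contents).

Definition tl_before (z : tileT) : contents := z.1.1.1.1.1.
Definition tl_left (z : tileT) : contents := z.1.1.1.1.2.
Definition tl_here (z : tileT) : contents := z.1.1.1.2.
Definition tl_right (z : tileT) : contents := z.1.1.2.
Definition tl_state (z : tileT) : state M := z.1.2.
Definition tl_scan (z : tileT) : contents := z.2.

Definition ntiles := size (enum [set: tileT]).
Definition tile_of (i : nat) : tileT := nth tile0 (enum [set: tileT]) i.
Definition tile_rank (z : tileT) : nat := index z (enum [set: tileT]).

Lemma tile_rankK z : tile_of (tile_rank z) = z.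
Proof. by rewrite /tile_of nth_index // mem_enum inE. Qed.

Lemma tile_rank_lt z : tile_rank z < ntiles.
Proof. by rewrite index_mem mem_enum inE. Qed.

Lemma ntiles_gt0 : 0 < ntiles.
Proof. exact: leq_ltn_trans (tile_rank_lt tile0). Qed.

Lemma tile_rank_inj : injective tile_rank.
Proof. exact: can_inj tile_rankK. Qed.

(** As in [step], a halting configuration repeats itself, which lets the tableau have a fixed number
    of rows. *)
Definition written (q : state M) (sc : contents) : contents :=
  if halting q then sc else [ffun i => ((transition q sc).2 i).1].
Definition next_state (q : state M) (sc : contents) : state M :=
  if halting q then q else (transition q sc).1.
Definition moves (q : state M) (sc : contents) i : move :=
  if halting q then Stay else ((transition q sc).2 i).2.

(** The heads stay and the tapes shift: when a head moves left, every position receives what stood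
    at its left neighbour. *)
Definition next_contents (z : tileT) : contents :=
  [ffun i => match moves (tl_state z) (tl_scan z) i with
             | MoveLeft => tl_left z i
             | Stay => tl_here z i
             | MoveRight => tl_right z i
             end].

(** A colour is the rank of a tile whose other components are defaults, so colours are below
    [ntiles] and equal colours mean equal components. Horizontally the overlapping contents, the
    state and the scanned symbols must agree. *)
Definition east_color (z : tileT) : nat :=
  tile_rank (no_contents, no_contents, tl_here z, tl_right z, tl_state z, tl_scan z).
Definition west_color (z : tileT) : nat :=
  tile_rank (no_contents, no_contents, tl_left z, tl_here z, tl_state z, tl_scan z).
Definition south_color (z : tileT) : nat :=
  tile_rank (no_contents, no_contents, no_contents, next_contents z,
             next_state (tl_state z) (tl_scan z), no_contents).
Definition north_color (z : tileT) : nat :=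
  tile_rank (no_contents, no_contents, no_contents, tl_before z, tl_state z, no_contents).

Definition ok_center (z : tileT) : bool :=
  (tl_before z == tl_scan z) && (tl_here z == written (tl_state z) (tl_scan z)).
Definition ok_off (z : tileT) : bool := tl_here z == tl_before z.
Definition ok_left (z : tileT) : bool := tl_left z == no_contents.
Definition ok_right (z : tileT) : bool := tl_right z == no_contents.
Definition ok_start (z : tileT) : bool :=
  (tl_state z == start M) && [forall i : 'I_(tapes M).+1, (1 < i) ==> (tl_before z i == blank M)].
Definition ok_word (o : option bool) (z : tileT) : bool :=
  tl_before z ord0 == if o is Some b then @bit M b else blank M.
(* Tape 1 starts with a word followed by blanks only. *)
Definition ok_guess (z : tileT) : bool :=
  [forall i : 'I_(tapes M).+1, (i == 1 :> nat) ==>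
    ([exists b, tl_before z i == @bit M b] || ((tl_before z i == blank M) && (tl_right z i == blank M)))].
Definition ok_no_guess (z : tileT) : bool :=
  [forall i : 'I_(tapes M).+1, (i == 1 :> nat) ==> (tl_before z i == blank M)].
Definition ok_halt (z : tileT) : bool := halting (tl_state z).
(** The output is read up to the first blank, hence the condition on the cell to the right of the
    head, which the write leaves unchanged. *)
Definition ok_accept (z : tileT) : bool :=
  (tl_before z ord0 == @bit M true) && (tl_right z ord0 == blank M).

Definition allowed (x : seq bool) (Y T c t p : nat) (z : tileT) : bool :=
  [&& if p == c then ok_center z else ok_off z,
      (p == 0) ==> ok_left z, (p == c + c) ==> ok_right z,
      (t == 0) ==> [&& ok_start z,
         if (c <= p) && (p < c + size x)
         then if nth false x (p - c) then ok_word (Some true) z else ok_word (Some false) z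
         else ok_word None z
       & if (c <= p) && (p < c + Y) then ok_guess z else ok_no_guess z]
    & (t == T) ==> ok_halt z && ((p == c) ==> ok_accept z)].

Definition machine_tableau (x : seq bool) (Y T c : nat) (s : nat -> nat -> nat) : Prop :=
  tableau T.+1 (c + c).+1 ntiles (fun t p i => allowed x Y T c t p (tile_of i))
    (fun i => east_color (tile_of i)) (fun i => west_color (tile_of i))
    (fun i => south_color (tile_of i)) (fun i => north_color (tile_of i)) s.

Definition cell (c : nat) (tp : tape M) (p : nat) : symbol M :=
  if c <= p then nth (blank M) tp.2 (p - c) else nth (blank M) tp.1 (c.-1 - p).

Lemma cell_head c tp : cell c tp c = scan tp.
Proof. by rewrite /cell leqnn subnn /scan nth0. Qed.

Lemma nth_behead (T : Type) (d : T) s i : nth d (behead s) i = nth d s i.+1.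
Proof. by case: s => //=; rewrite nth_nil. Qed.

(** Relative to the head a move is a shift of the tape. For [p = 0] a left move brings in a cell
    from outside the window, whence the separate case. *)
Lemma cell_write_move c (tp : tape M) s mv p : 0 < c ->
  let old q := if q == c then s else cell c tp q in
  cell c (write_move tp (s, mv)) p =
  match mv with
  | MoveLeft => if p is p'.+1 then old p' else nth (blank M) tp.1 c
  | Stay => old p
  | MoveRight => old p.+1
  end.
Proof.
move=> c0 old; rewrite /old /cell /write_move; case: mv => /=.
- rewrite nth_behead; case: p => [|p].
    by rewrite leqNgt c0 /= subn0 prednK.
  case: (ltngtP c p) => H.
  + rewrite (leq_trans (ltnW H)) // subSn 1?ltnW //= -[p - c]prednK ?subn_gt0 //= nth_behead.
    by rewrite prednK ?subn_gt0.
  + case: (ltngtP c p.+1) => H' //; first by lia.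
      by congr nth; lia.
    by rewrite H' subnn /= -nth0; congr nth; lia.
  + by rewrite -H leqnSn subSnn /=.
- case: (ltngtP c p) => H //; last by rewrite H subnn.
  by rewrite -[p - c]prednK ?subn_gt0 //= nth_behead.
- rewrite nth_behead; case: (ltngtP c p) => H.
  + have -> : (p.+1 == c) = false by lia.
    have -> : (c <= p.+1) = true by lia.
    by congr nth; lia.
  + case: eqP => E; first by rewrite -E subnn.
    have -> : (c <= p.+1) = false by lia.
    have -> : c.-1 - p = (c.-1 - p.+1).+1 by lia.
    by [].
  + have -> : (p.+1 == c) = false by lia.
    have -> : (c <= p.+1) = true by lia.
    by congr nth; lia.
Qed.

Section Run.
Variables (x y : seq bool) (Y T c : nat).
Hypothesis yY : size y <= Y.
Hypothesis cE : T + size x + Y < c.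

Definition conf t := iter t (@step M) (initial M [:: x; y]).

Lemma confS t : conf t.+1 = step (conf t).
Proof. by []. Qed.
Arguments conf : simpl never.

Definition blank_beyond (l r : nat) (tp : tape M) : Prop :=
  (forall j, l <= j -> nth (blank M) tp.1 j = blank M) /\
  (forall j, r <= j -> nth (blank M) tp.2 j = blank M).

Lemma blank_beyond_move l r tp a : 0 < r -> blank_beyond l r tp ->
  blank_beyond l.+1 r.+1 (write_move tp a).
Proof.
case: a => s mv r0 [Hl Hr]; case: mv; split=> -[|j] //= lj; rewrite ?nth_behead;
  try (by apply: Hl; lia); try (by apply: Hr; lia).
by case: j lj => [|j] lj /=; [lia|rewrite nth_behead; apply: Hr; lia].
Qed.

(** A step extends the used part of a tape by at most one cell on either side. By [cE] the window of
    radius [c] therefore holds everything nonblank up to time [T]. *)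
Lemma conf_blank t i : blank_beyond t ((size x + Y).+1 + t) ((conf t).2 i).
Proof.
elim: t => [|t IH].
  rewrite /conf /= ffunE; split=> j; rewrite ?nth_nil // => Hj /=.
  rewrite nth_default // size_map; case: (i : nat) => [|[|k]] /=; try lia.
  by rewrite nth_nil.
have mono l r tp : blank_beyond l r tp -> blank_beyond l.+1 r.+1 tp.
  by case=> Hl Hr; split=> j ?; [apply: Hl|apply: Hr]; lia.
rewrite confS /step; case: ifP => _; first by rewrite addnS; apply: mono.
case: transition => q act; rewrite /= ffunE addnS; apply: blank_beyond_move => //; lia.
Qed.

Definition scanned t : contents := [ffun i => scan ((conf t).2 i)].
Definition row t p : contents := [ffun i => cell c ((conf t).2 i) p].
Definition row' t p : contents := if p == c then written (conf t).1 (scanned t) else row t p.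
Definition run_tile t p : tileT :=
  (row t p, if p is p'.+1 then row' t p' else no_contents, row' t p, row' t p.+1, (conf t).1, scanned t).

Lemma row_center t : row t c = scanned t.
Proof. by apply/ffunP => i; rewrite !ffunE cell_head. Qed.

Lemma row'_end t : t <= T -> row' t (c + c).+1 = no_contents.
Proof.
move=> tT; rewrite /row' ifF; last by lia.
apply/ffunP => i; rewrite !ffunE /cell ifT; last by lia.
by have [_ ->] := conf_blank t i => //; lia.
Qed.

Lemma next_contents_run t p : t < T -> next_contents (run_tile t p) = row t.+1 p.
Proof.
move=> tT; apply/ffunP => i; rewrite !ffunE /moves /tl_state /tl_scan /=.
rewrite confS /step; case: ifP => H.
  rewrite /tl_here /= /row' /written H; case: eqP => [->|_]; last by rewrite ffunE.
  by rewrite ffunE cell_head.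
rewrite -/(scanned t); case E : transition => [q act] /=; rewrite ffunE.
case Ea : (act i) => [s mv]; rewrite cell_write_move; last by lia.
have old k : row' t k i = if k == c then s else cell c ((conf t).2 i) k.
  by rewrite /row' /written H; case: eqP => _; rewrite ffunE ?E ?Ea.
case: mv {Ea}; rewrite /tl_left /tl_here /tl_right /=; last by rewrite old.
- case: p => [|p]; last by rewrite old.
  rewrite ffunE; have [-> //] := conf_blank t i; lia.
- by rewrite old.
Qed.

Lemma next_state_run t p : next_state (tl_state (run_tile t p)) (tl_scan (run_tile t p)) = (conf t.+1).1.
Proof.
rewrite /next_state /tl_state /tl_scan /=; case: ifP => H; rewrite confS /step H //.
by rewrite -/(scanned t); case: transition.
Qed.

Lemma run_tableau : halting (conf T).1 -> scan ((conf T).2 ord0) = @bit M true ->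
  nth (blank M) ((conf T).2 ord0).2 1 = blank M ->
  machine_tableau x Y T c (fun t p => tile_rank (run_tile t p)).
Proof.
move=> haltT headT nextT t p; rewrite !ltnS => tT pP.
split; rewrite ?tile_rankK; first exact: tile_rank_lt.
- apply/and5P; split.
  + rewrite /ok_center /ok_off /tl_here /tl_before /tl_scan /tl_state /= /row'.
    by case: (eqVneq p c) => [->|_]; rewrite ?row_center ?eqxx.
  + by apply/implyP => /eqP ->; rewrite /ok_left.
  + by apply/implyP => /eqP ->; rewrite /ok_right /tl_right /= row'_end.
  + apply/implyP => /eqP ->; apply/and3P; split.
    * rewrite /ok_start eqxx; apply/forallP => -[[|[|i]] Hi]; rewrite //= !ffunE /cell /= nth_nil.
      by rewrite !nth_nil /=; case: ifP.
    * have E o : ok_word o (run_tile 0 p) = (cell c ([::], map (@bit M) x) p == if o is Some b then @bit M b else blank M).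
        by rewrite /ok_word /tl_before /= !ffunE.
      rewrite !E /cell nth_nil /=; case: (leqP c p) => cp /=; last by rewrite eqxx.
      case: ltnP => px; last by rewrite nth_default ?eqxx // size_map; lia.
      by rewrite (nth_map false); [case: (nth _ _ _)|lia].
    * have E (i : 'I_(tapes M).+1) k : i = 1 :> nat -> row 0 k i = cell c ([::], map (@bit M) y) k.
        by move=> i1; rewrite !ffunE i1.
      case: ifP => [/andP[cp pY]|pN]; apply/forallP => i; apply/implyP => /eqP i1.
        rewrite /tl_before /tl_right /= /row' ifF; last by lia.
        rewrite !E // /cell cp (leq_trans cp) //.
        case: (ltnP (p - c) (size y)) => py.
          by apply/orP; left; apply/existsP; exists (nth false y (p - c)); rewrite (nth_map false).
        by apply/orP; right; rewrite !nth_default ?eqxx // size_map //=; lia.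
      rewrite /tl_before /= E // /cell nth_nil; case: (leqP c p) pN => // cp /= pN.
      by rewrite nth_default // size_map; lia.
  + apply/implyP => /eqP ->; rewrite /ok_halt /tl_state /= haltT; apply/implyP => /eqP ->.
    rewrite /ok_accept /tl_before /tl_right /= row_center ffunE headT eqxx /= /row' ifF; last by lia.
    by rewrite ffunE /cell leqnSn subSnn nextT.
- by move=> _; rewrite /east_color /west_color.
- by move=> tT'; rewrite /south_color /north_color next_contents_run // next_state_run.
Qed.

(** Each row of tiles is forced by the one above: vertical colours give contents and state, the
    central tile fixes the scanned symbols, horizontal agreement spreads them over the row, and the
    contents after the write follow. *)
Lemma tableau_run s : machine_tableau x Y T c s ->
  (forall p, p <= c + c -> tl_before (tile_of (s 0 p)) = row 0 p) ->
  halting (conf T).1 /\ scan ((conf T).2 ord0) = @bit M true.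
Proof.
move=> Hs H0.
have pc : c < (c + c).+1 by lia.
have tile_run t : t <= T -> (forall p, p <= c + c -> tl_before (tile_of (s t p)) = row t p) ->
    (forall p, p <= c + c -> tl_state (tile_of (s t p)) = (conf t).1) ->
    forall p, p <= c + c -> tile_of (s t p) = run_tile t p.
  move=> tT Hb Hq; pose z p := tile_of (s t p).
  have dom p : p <= c + c -> allowed x Y T c t p (z p).
    by move=> pP; have [] := Hs t p tT pP.
  have horiz p : p < c + c -> [/\ tl_here (z p) = tl_left (z p.+1),
      tl_right (z p) = tl_here (z p.+1) & tl_scan (z p) = tl_scan (z p.+1)].
    move=> pP; have [_ _ /(_ pP) + _] := Hs t p tT (ltnW pP).
    by move/tile_rank_inj => [].
  have scanE p : p <= c + c -> tl_scan (z p) = scanned t.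
    have scan_c : tl_scan (z c) = scanned t.
      have := dom c pc; rewrite /allowed eqxx => /and5P[/andP[/eqP <- _] _ _ _ _].
      by rewrite Hb // row_center.
    have up k : c + k <= c + c -> tl_scan (z (c + k)) = scanned t.
      elim: k => [|k IH] H; first by rewrite addn0.
      by rewrite addnS in H *; have [_ _ <-] := horiz _ H; apply: IH; apply: ltnW.
    have down k : k <= c -> tl_scan (z (c - k)) = scanned t.
      elim: k => [|k IH] H; first by rewrite subn0.
      have [|_ _ ->] := horiz (c - k.+1); first by lia.
      by rewrite subnSK // IH // ltnW.
    move=> pP; case: (leqP c p) => cp.
      by have := up (p - c); rewrite subnKC //; apply.
    by have := down (c - p); rewrite subKn ?(ltnW cp) //; apply; lia.
  have hereE p : p <= c + c -> tl_here (z p) = row' t p.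
    move=> pP; have := dom p pP; rewrite /allowed /row' => /and5P[+ _ _ _ _].
    case: eqP => [_ /andP[_ /eqP ->]|_ /eqP ->]; last exact: Hb.
    by rewrite scanE // Hq.
  move=> p pP; rewrite [LHS]surjective_pairing -/(tl_scan _) scanE //; congr pair.
  rewrite [LHS]surjective_pairing -/(tl_state _) Hq //; congr pair.
  rewrite [LHS]surjective_pairing -/(tl_right _); congr pair; last first.
    move: pP; rewrite leq_eqVlt => /orP[/eqP E|pP].
      rewrite E row'_end //; have := dom p; rewrite E leqnn => /(_ isT) /and5P[_ _ + _ _].
      by rewrite eqxx => /eqP; rewrite -E.
    by have [_ -> _] := horiz p pP; rewrite hereE.
  rewrite [LHS]surjective_pairing -/(tl_here _) hereE //; congr pair.
  rewrite [LHS]surjective_pairing -/(tl_left _) -/(tl_before _) Hb //; congr pair.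
  case: p pP => [|p] pP.
    by have := dom 0 pP => /and5P[_ /eqP].
  by have [<- _ _] := horiz p pP; rewrite hereE // ltnW.
have all_run t : t <= T -> forall p, p <= c + c -> tile_of (s t p) = run_tile t p.
  elim: t => [|t IH] tT; apply: tile_run => // p pP.
  - have [_ + _ _] := Hs 0 p (ltn0Sn T) pP; rewrite /allowed /= => /and5P[_ _ _ + _].
    by case/and3P => /andP[/eqP -> _].
  - have [_ _ _ /(_ tT) /tile_rank_inj []] := Hs t p (ltnW tT) pP.
    by rewrite IH ?(ltnW tT) // next_contents_run // => ->.
  - have [_ _ _ /(_ tT) /tile_rank_inj []] := Hs t p (ltnW tT) pP.
    by rewrite IH ?(ltnW tT) // next_state_run => _ ->.
have [_ + _ _] := Hs T c (leqnn _) pc.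
rewrite all_run // /allowed !eqxx => /and5P[_ _ _ _] /andP[haltT /andP[/eqP + _]].
by rewrite /tl_before /= row_center ffunE.
Qed.

End Run.

(** The word [y] is read off tape 1 in the first row, up to the first blank. From there on
    [ok_guess] propagates blanks to the right, and beyond [Y] [ok_no_guess] demands them. *)
Lemma tableau_guess x Y T c s : T + size x + Y < c -> machine_tableau x Y T c s ->
  exists2 y, size y <= Y & forall p, p <= c + c -> tl_before (tile_of (s 0 p)) = row x y c 0 p.
Proof.
move=> cE Hs; pose z p := tile_of (s 0 p).
(* A machine with a single tape has no tape 1; the default makes the guessed word empty. *)
pose cont p : symbol M := if insub 1 is Some i then tl_before (z p) i else blank M.
pose w := mkseq (fun j => cont (c + j)) Y.
pose bits_w := take (index (blank M) w) w.
pose y := map (fun a => a == @bit M true) bits_w.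
have dom p : p <= c + c -> [&& ok_start (z p),
         if (c <= p) && (p < c + size x)
         then if nth false x (p - c) then ok_word (Some true) (z p) else ok_word (Some false) (z p)
         else ok_word None (z p)
       & if (c <= p) && (p < c + Y) then ok_guess (z p) else ok_no_guess (z p)].
  move=> pP; have [_ + _ _] := Hs 0 p (ltn0Sn T) pP.
  by rewrite /allowed eqxx => /and5P[_ _ _ + _].
have horiz p : c <= p -> p < c + c -> tl_right (z p) = tl_before (z p.+1).
  move=> cp pP; have [_ _ /(_ pP) /tile_rank_inj [_ -> _ _] _] := Hs 0 p (ltn0Sn T) (ltnW pP).
  have [_ + _ _] := Hs 0 p.+1 (ltn0Sn T) pP; rewrite /allowed.
  by rewrite ifF; [move=> /and5P[/eqP -> _ _ _ _]|lia].
have contP p : c <= p -> p < c + Y ->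
    (exists b, cont p = @bit M b) \/ (cont p = blank M /\ cont p.+1 = blank M).
  move=> cp pY; rewrite /cont; case: insubP => [i _ i1|_]; last by right.
  have pP : p < c + c by lia.
  have /and3P[_ _] := dom p (ltnW pP); rewrite cp pY /= => /forallP /(_ i).
  rewrite i1 eqxx /= => /orP[/existsP[b /eqP ->]|/andP[/eqP -> /eqP]]; first by left; exists b.
  by rewrite horiz // => ->; right.
have contN p : p <= c + c -> ~~ ((c <= p) && (p < c + Y)) -> cont p = blank M.
  move=> pP pN; rewrite /cont; case: insubP => [i _ i1|_] //.
  have /and3P[_ _] := dom p pP; rewrite (negPf pN) => /forallP /(_ i).
  by rewrite i1 eqxx => /eqP.
have szw : size w = Y by rewrite size_mkseq.
have bitsE : map (@bit M) y = bits_w.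
  rewrite -[RHS]map_id /y -map_comp; apply/eq_in_map => a /=.
  case/(nthP (blank M)) => j; rewrite size_take_min => Hj <-.
  have jI : j < index (blank M) w by apply: leq_trans Hj (geq_minl _ _).
  have jY : j < Y by rewrite -szw; apply: leq_trans Hj (geq_minr _ _).
  rewrite nth_take // nth_mkseq //.
  case: (contP (c + j)) => [||[b ->]|[E _]]; try lia.
    by case: b; rewrite ?eqxx // (inj_eq (@bit_inj M)).
  by have := before_find (blank M) jI; rewrite nth_mkseq //= E eqxx.
have nth_w j : nth (blank M) (map (@bit M) y) j = nth (blank M) w j.
  rewrite bitsE; case: (ltnP j (index (blank M) w)) => H; first by rewrite nth_take.
  rewrite nth_default; last by rewrite size_take_min; apply: leq_trans (geq_minl _ _) H.
  case: (ltnP j Y) => jY; last by rewrite nth_default ?szw.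
  rewrite -(subnKC H) in jY *.
  elim: (j - _) jY => [|k IH] kY.
    by rewrite addn0 nth_index // -index_mem szw; move: kY; rewrite addn0.
  rewrite addnS in kY *; have {}IH := IH (ltnW kY).
  move: IH; rewrite !nth_mkseq ?(ltnW kY) // => E.
  case: (contP (c + (index (blank M) w + k))) => [||[b Eb]|[_ En]]; try lia.
    by have := bit_nonblank M b; rewrite -Eb -E eqxx.
  by rewrite addnS En.
exists y.
  by rewrite size_map size_take_min szw geq_minr.
move=> p pP; have /and3P[/andP[_ /forallP st] xs ys] := dom p pP.
apply/ffunP => i; rewrite !ffunE /cell nth_nil.
case: i st => -[|[|i]] Hi st.
- rewrite /= (_ : Ordinal Hi = ord0); last exact: ord_inj.
  move: xs; rewrite /ok_word; case: (leqP c p) => cp /= => [|/eqP] //.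
  case: ltnP => px; last first.
    by move=> /eqP ->; rewrite nth_default // size_map; lia.
  rewrite (nth_map false); last by lia.
  by case: (nth _ _ _) => /eqP.
- have contE : cont p = tl_before (z p) (Ordinal Hi).
    by rewrite /cont insubT.
  rewrite /= -contE; case: (leqP c p) => cp; last by apply: contN; lia.
  rewrite nth_w; case: (ltnP (p - c) Y) => pY; first by rewrite nth_mkseq // subnKC.
  by rewrite nth_default ?szw //; apply: contN; lia.
- have := st (Ordinal Hi); rewrite /= => /eqP ->; rewrite !nth_nil; by case: ifP.
Qed.

End MachineTableau.

(** * The reduction *)

Definition encode_bits (u : seq bool) : seq bool := flatten [seq [:: true; b] | b <- u] ++ [:: false].

Lemma encode_bits_prefix u v s t : encode_bits u ++ s = encode_bits v ++ t -> u = v /\ s = t.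
Proof.
elim: u v => [|a u IH] [|b v] //=; first by case.
by case=> -> /IH [-> ->].
Qed.

Lemma encode_nat_prefix a b s t : encode_nat a ++ s = encode_nat b ++ t -> a = b /\ s = t.
Proof.
by case/encode_bits_prefix => E ->; rewrite -(value_bits a) E value_bits.
Qed.

Lemma nseq_prefix a b s t :
  nseq a true ++ false :: s = nseq b true ++ false :: t -> a = b /\ s = t.
Proof. by elim: a b => [|a IH] [|b] //= [] => [->|/IH [-> ->]]. Qed.

Definition arc_code (V : finType) (E : {set V * V}) (w c : V * V -> nat) (e : V * V) : seq bool :=
  if e \in E then true :: encode_nat (w e) ++ encode_nat (c e) else [:: false].

Lemma arc_codes_prefix (V : finType) (E E' : {set V * V}) w w' c c' (L : seq (V * V)) s t :
  flatten (map (arc_code E w c) L) ++ s = flatten (map (arc_code E' w' c') L) ++ t ->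
  s = t /\ {in L, forall e, (e \in E) = (e \in E') /\ (e \in E -> w e = w' e /\ c e = c' e)}.
Proof.
elim: L => [|e L IH] //= H.
suff [He /IH [-> HL]] : ((e \in E) = (e \in E') /\ (e \in E -> w e = w' e /\ c e = c' e)) /\
   flatten (map (arc_code E w c) L) ++ s = flatten (map (arc_code E' w' c') L) ++ t.
  by split=> // d; rewrite in_cons => /orP[/eqP -> //|]; apply: HL.
have P a b l : (true :: encode_nat a ++ encode_nat b) ++ l = true :: (encode_nat a ++ (encode_nat b ++ l)).
  by rewrite cat_cons catA.
move: H; rewrite -[LHS]catA -[RHS]catA /arc_code; case: (e \in E); case: (e \in E') => //; rewrite ?P.
  by case=> /encode_nat_prefix [-> /encode_nat_prefix [-> ->]].
by case.
Qed.

Lemma encodeE (i : instance) : encode i = nseq (nvert i) true ++ false ::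
  flatten (map (arc_code (arcs i) (weight i) (cost i)) [seq (x, y) | x <- enum 'I_(nvert i), y <- enum 'I_(nvert i)]) ++
  encode_nat (budget i) ++ encode_nat (source i) ++ encode_nat (target i) ++ encode_nat (threshold i).
Proof. by rewrite map_allpairs. Qed.

(** A code determines the instance up to the junk values outside [arcs]. This is needed because
    membership of a word in the language may be witnessed by another instance than the one
    constructed. *)
Lemma encode_exceeds (i j : instance) : encode i = encode j ->
  interdiction_exceeds i -> interdiction_exceeds j.
Proof.
rewrite !encodeE; case: i => n E pE w c B B0 s t st k; case: j => n' E' pE' w' c' B' B0' s' t' st' k' /=.
case/nseq_prefix => nn'; subst n'; case/arc_codes_prefix.
case/encode_nat_prefix => EB; case/encode_nat_prefix => Es; case/encode_nat_prefix => Et.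
rewrite -[encode_nat k]cats0 -[encode_nat k']cats0 => /encode_nat_prefix [Ek _] H.
have {}H e : (e \in E) = (e \in E') /\ (e \in E -> w e = w' e /\ c e = c' e).
  by case: e => x y; apply: H; apply: allpairs_f; rewrite mem_enum.
move=> /interdiction_gtP /= [I [f [IE cI [f0 fk Hf]]]].
apply/interdiction_gtP => /=; exists I, f; split.
- by apply/subsetP => e eI; rewrite -(H e).1 (subsetP IE).
- rewrite -EB; apply: leq_trans cI; apply: leq_sum => e eI.
  by have [_ [|_ ->]] := H e => //; apply: (subsetP IE).
- rewrite -(ord_inj Es) -(ord_inj Et) -Ek; split=> // x y; rewrite in_setD -(H _).1 => /andP[NI xy].
  by have [_ [|<- _]] := H (x, y) => //; apply: Hf; rewrite in_setD NI xy.
Qed.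

(** The code of [grid_instance] in terms of natural numbers only, a form that [pt] can handle. *)
Definition grid_code (R n K w : nat) (a : nat -> nat -> nat) : seq bool :=
  let N := R.*2 * n.+1 in
  nseq N true ++ false ::
  flatten (flatten [seq [seq if grid_adj R n x y
     then true :: encode_nat (gweight n K w a x y) ++ encode_nat (gcost R n K a x y)
     else [:: false] | y <- iota 0 N] | x <- iota 0 N]) ++
  encode_nat (R * K) ++ encode_nat 0 ++ encode_nat n ++ encode_nat K.-1.

Lemma grid_codeE R n K w a (R2 : 1 < R) (n0 : 0 < n) (K0 : 0 < K) :
  encode (grid_instance w a R2 n0 K0) = grid_code R n K w a.
Proof.
rewrite encodeE /grid_code map_allpairs /=; congr (_ ++ _ :: flatten _ ++ _).
rewrite /allpairs_dep; set N := R.*2 * n.+1; rewrite -(val_enum_ord N) -map_comp.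
congr flatten; apply: eq_map => x /=; rewrite -map_comp; apply: eq_map => y /=.
by rewrite /arc_code inE.
Qed.

(** Each ordered pair of vertices contributes at least one symbol; this length is what keeps the
    numbers below the square of the size. *)
Lemma grid_code_size R n K w a : (R.*2 * n.+1) ^ 2 <= size (grid_code R n K w a).
Proof.
rewrite /grid_code; set N := R.*2 * n.+1; rewrite size_cat /= size_cat.
set L := flatten [seq _ | x <- _].
suff : N ^ 2 <= size (flatten L) by lia.
have -> : N ^ 2 = size L.
  rewrite /L size_flatten /shape -map_comp (eq_map (g := fun=> N)); last first.
    by move=> x /=; rewrite size_map size_iota.
  have H (l : seq nat) : sumn [seq N | _ <- l] = size l * N by elim: l => //= z l ->.
  by rewrite H size_iota.
have : all (fun s => 0 < size s) L.
  by apply/allP => s /flatten_mapP[x _ /mapP[y _ ->]]; case: ifP.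
elim: (L) => //= s l IH /andP[s0 /IH]; rewrite size_cat; lia.
Qed.

Lemma grid_max_number R n K w a (R2 : 1 < R) (n0 : 0 < n) (K0 : 0 < K) :
  w <= K -> (forall r c, c < n -> a r c <= K) ->
  max_number (grid_instance w a R2 n0 K0) <= (R * K).+1.
Proof.
move=> wK aK; have KR : K <= R * K by rewrite leq_pmull // ltnW.
have aR r c : c < n -> a r c <= (R * K).+1 by move=> cn; have := aK r c cn; lia.
rewrite /max_number /= !geq_max leqnSn /=; apply/andP; split; last by lia.
apply/bigmax_leqP => -[x y] _; rewrite geq_max /gweight /gcost /=; apply/andP; split.
  case: ifP => [/andP[xn _]|_]; first by case: ifP => // _; apply: aR.
  by case: ifP => _; [|case: ifP => _]; lia.
by case: ifP => // /and3P[xn _ _]; apply: aR.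
Qed.

Ltac pt_user ::=
  lazymatch goal with
  | |- polytime (fun x => bits (@?f x)) => apply: (@polytime_bits _ f)
  | |- polytime (fun x => add_bits (@?f x) (@?g x)) => apply: (@polytime_add_bits _ f g)
  | |- polytime (fun x => leq_bits (@?f x) (@?g x)) => apply: (@polytime_leq_bits _ f g)
  | |- polytime (fun x => eq_dart (@?f x) (@?g x)) => apply: (@polytime_eq_dart _ f g)
  end.

Lemma polytime_encode_bits (X : encType) (f : X -> seq bool) : polytime f ->
  polytime (fun x => encode_bits (f x)).
Proof. move=> Hf; rewrite /encode_bits; pt. Qed.

Lemma polytime_encode_nat (X : encType) (f : X -> nat) : polytime f ->
  polytime (fun x => encode_nat (f x)).
Proof. by move=> Hf; apply: (@polytime_encode_bits X (fun x => bits (f x))); pt. Qed.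

Lemma polytime_double (X : encType) (f : X -> nat) : polytime f -> polytime (fun x => (f x).*2).
Proof.
by move=> Hf; apply: (polytime_ext (f := fun x => f x + f x)) => [x|]; rewrite ?addnn //; pt.
Qed.

Ltac pt_user ::=
  lazymatch goal with
  | |- polytime (fun x => bits (@?f x)) => apply: (@polytime_bits _ f)
  | |- polytime (fun x => add_bits (@?f x) (@?g x)) => apply: (@polytime_add_bits _ f g)
  | |- polytime (fun x => leq_bits (@?f x) (@?g x)) => apply: (@polytime_leq_bits _ f g)
  | |- polytime (fun x => eq_dart (@?f x) (@?g x)) => apply: (@polytime_eq_dart _ f g)
  | |- polytime (fun x => encode_bits (@?f x)) => apply: (@polytime_encode_bits _ f)
  | |- polytime (fun x => encode_nat (@?f x)) => apply: (@polytime_encode_nat _ f)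
  | |- polytime (fun x => double (@?f x)) => apply: (@polytime_double _ f)
  end.

Section GridCode.
Variables (X : encType) (R n K w : X -> nat) (a : X -> nat -> nat -> nat).
Hypothesis (HR : polytime R) (Hn : polytime n) (HK : polytime K) (Hw : polytime w).
Hypothesis Ha : polytime (fun z : X * nat * nat => a z.1.1 z.1.2 z.2).

Lemma polytime_grid_code : polytime (fun x => grid_code (R x) (n x) (K x) (w x) (a x)).
Proof.
rewrite /grid_code /grid_adj /gweight /gcost; pt.
Qed.

End GridCode.

(** A fixed machine has finitely many tiles, so any function of a tile is a lookup in a constant
    list. *)
Lemma polytime_table (X : encType) (A : encType) M (g : tileT M -> A) (i : X -> nat) :
  polytime i -> polytime (fun x => g (tile_of M (i x))).
Proof.
move=> Hi; apply: (polytime_ext (f := fun x => nth (g (tile0 M)) (map g (enum [set: tileT M])) (i x))); last by pt.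
move=> x; rewrite /tile_of; case: (ltnP (i x) (size (enum [set: tileT M]))) => H.
  by rewrite (nth_map (tile0 M)).
by rewrite !nth_default ?size_map.
Qed.

Section Reduction.
Variables (M : machine) (p q : {poly nat}).

(** Here [q] bounds the length of the certificates and [p] the running time of the verifier;
    [red_center] is then just large enough for the window to contain the whole run. *)
Definition red_guess (x : seq bool) : nat := peval q (size x).
Definition red_time (x : seq bool) : nat := peval p (size x + red_guess x).
Definition red_center (x : seq bool) : nat := (red_time x + size x + red_guess x).+1.
Definition red_cells (x : seq bool) : nat := (red_time x).+1 * (red_center x + red_center x).+1.

Definition red_coef (x : seq bool) : nat -> nat -> nat :=
  coef (red_time x).+1 (red_center x + red_center x).+1 (ntiles M) (ntiles M)
    (fun t p i => allowed x (red_guess x) (red_time x) (red_center x) t p (tile_of M i))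
    (fun i => east_color (tile_of M i)) (fun i => west_color (tile_of M i))
    (fun i => south_color (tile_of M i)) (fun i => north_color (tile_of M i)).

Definition red_weight (x : seq bool) : nat := red_cells x * ntiles M * ntiles M.
Definition red_scale (x : seq bool) : nat := (2 * red_weight x).+1.
Definition red_total (x : seq bool) : nat := red_scale x * red_cells x + ntiles M.

(** Three rows per cell: allowed tile, agreement to the east, agreement to the south. *)
Definition reduction (x : seq bool) : seq bool :=
  grid_code (3 * red_cells x) (red_cells x * ntiles M) (red_total x) (red_weight x)
    (fun r j => red_scale x + red_coef x r j).

Lemma polytime_red_guess : polytime red_guess.
Proof. rewrite /red_guess; pt. Qed.

Lemma polytime_red_time : polytime red_time.
Proof. have H := polytime_red_guess; rewrite /red_time; pt. Qed.

Lemma polytime_red_center : polytime red_center.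
Proof. have H := polytime_red_guess; have H' := polytime_red_time; rewrite /red_center; pt. Qed.

Lemma polytime_red_cells : polytime red_cells.
Proof. have H := polytime_red_center; have H' := polytime_red_time; rewrite /red_cells; pt. Qed.

Lemma polytime_allowed (X : encType) (x : X -> seq bool) (t r i : X -> nat) :
  polytime x -> polytime t -> polytime r -> polytime i ->
  polytime (fun z => allowed (x z) (red_guess (x z)) (red_time (x z)) (red_center (x z)) (t z) (r z) (tile_of M (i z))).
Proof.
move=> Hx Ht Hr Hi; have H1 := polytime_red_guess; have H2 := polytime_red_time.
have H3 := polytime_red_center.
rewrite /allowed; pt; exact: polytime_table.
Qed.

Lemma polytime_red_coef : polytime (fun z : seq bool * nat * nat => red_coef z.1.1 z.1.2 z.2).
Proof.
have H1 := polytime_red_guess; have H2 := polytime_red_time; have H3 := polytime_red_center.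
rewrite /red_coef /coef /own_coef /neighbour_coef /has_neighbour /neighbour /=.
pt; try (apply: polytime_table; pt).
apply: polytime_allowed; pt.
Qed.

Lemma polytime_reduction : polytime reduction.
Proof.
have H1 := polytime_red_cells; have H2 := polytime_red_coef.
rewrite /reduction; apply: polytime_grid_code; rewrite /red_total /red_scale /red_weight; pt.
Qed.

Lemma color_le i : [/\ east_color (tile_of M i) <= ntiles M, west_color (tile_of M i) <= ntiles M,
  south_color (tile_of M i) <= ntiles M & north_color (tile_of M i) <= ntiles M].
Proof. by split; apply: ltnW; apply: tile_rank_lt. Qed.

Variable rel : seq bool -> seq bool -> bool.
Hypothesis M_rel : forall x y, outputs_within M [:: x; y] (peval p (size x + size y)) [:: rel x y].

Lemma outputs_later ws t t' w : t <= t' -> outputs_within M ws t w -> outputs_within M ws t' w.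
Proof. by move=> tt' [H1 H2]; rewrite /outputs_within -(subnK tt') iterD iter_halting. Qed.

Lemma tableau_accept x : (exists2 y, size y <= red_guess x & rel x y) <->
  exists s, machine_tableau M x (red_guess x) (red_time x) (red_center x) s.
Proof.
have out y : size y <= red_guess x -> outputs_within M [:: x; y] (red_time x) [:: rel x y].
  by move=> Hy; apply: outputs_later (M_rel x y); apply: peval_mono; rewrite leq_add2l.
have cE : red_time x + size x + red_guess x < red_center x by [].
split=> [[y Hy xy]|[s Hs]].
- have [haltT] := out y Hy; rewrite xy; set r := (_ ord0).2 => E.
  eexists; apply: (run_tableau Hy cE) => //; rewrite -/r.
    by move: E; rewrite /scan -/r; case: (r) => //= a l; case: eqP => //= _ [].
  move: E; rewrite -/r; case: (r) => [|a [|b l]] //=; case: eqP => //= _.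
  by case: eqP => [->|] //= _ [].
- have [y Hy Hrow] := tableau_guess cE Hs; exists y => //.
  have [haltT headT] := tableau_run Hy cE Hs Hrow.
  have [_] := out y Hy; move: headT; rewrite /scan /conf; set r := (_ ord0).2.
  case: (r) => [|a l] /= aT; first by have := bit_nonblank M true; rewrite -aT eqxx.
  rewrite aT (negPf (bit_nonblank M true)) /= => -[/bit_inj] //.
Qed.

Lemma reduction_instance x : exists2 i, encode i = reduction x &
  max_number i <= size (encode i) ^ 2 /\
  (interdiction_exceeds i <-> exists2 y, size y <= red_guess x & rel x y).
Proof.
set m := ntiles M; have m0 : 0 < m := ntiles_gt0 M.
set TT := (red_time x).+1; set PP := (red_center x + red_center x).+1.
have GE : red_cells x = TT * PP by [].
have G0 : 0 < red_cells x by rewrite GE muln_gt0.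
have R2 : 1 < 3 * red_cells x by lia.
have n0 : 0 < red_cells x * m by rewrite muln_gt0 G0.
have K0 : 0 < red_total x by rewrite /red_total addn_gt0 m0 orbT.
have fC := color_le.
pose a r j := red_scale x + red_coef x r j.
have coefC r j : red_coef x r j <= m by apply: coef_le.
have sc : red_scale x <= red_scale x * red_cells x by rewrite leq_pmulr.
exists (grid_instance (red_weight x) a R2 n0 K0); first exact: grid_codeE.
split.
  apply: leq_trans (grid_max_number _ _ _ _ _) _.
  - by move: sc; rewrite /red_total /red_scale; lia.
  - by move=> r c _; rewrite /a /red_total; apply: leq_add.
  (* With [g] cells and [l] tiles, [R * K] is at most [12 * g * (g * l) ^ 3], while the grid has
     [N = 6 * g * (g * l).+1] vertices and its code at least [N ^ 2] symbols. *)
  rewrite grid_codeE; apply: (@leq_trans ((((3 * red_cells x).*2 * (red_cells x * m).+1) ^ 2) ^ 2)).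
    rewrite /red_total /red_scale /red_weight -/m; move: G0 m0; move: (red_cells x) => G.
    move: (m) => k; clear; case: G => // G _; case: k => // k _.
    set g := G.+1; set l := k.+1.
    have gN : g <= g * l by rewrite leq_pmulr.
    have lN : l <= g * l by rewrite leq_pmull.
    have H1 : g * l * l <= (g * l) ^ 2 by rewrite -mulnn leq_mul2l lN orbT.
    have H2 : (2 * (g * l * l)).+1 * g + l <= 4 * (g * l) ^ 3.
      move: H1 gN lN; have : 0 < g * l by [].
      move: (g * l * l) => u; move: (g * l) => v v0 uv gv lv.
      have : (2 * u).+1 * g <= (2 * v ^ 2).+1 * v by apply: leq_mul; [lia|exact: gv].
      have : v <= v ^ 3 by rewrite -{1}[v]expn1 leq_pexp2l.
      have -> : (2 * v ^ 2).+1 * v = v + 2 * v ^ 3 by rewrite mulSn -mulnA -expnSr.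
      by move: (_.+1 * g) (v ^ 3) => k1 k2; lia.
    have H3 : (3 * g * (4 * (g * l) ^ 3)).+1 <= (((3 * g).*2 * (g * l).+1) ^ 2) ^ 2.
      rewrite -expnM expnMn; have : (g * l) ^ 3 < (g * l).+1 ^ (2 * 2).
        apply: (@leq_trans ((g * l).+1 ^ 3)); first by rewrite ltn_exp2r.
        by rewrite leq_exp2l.
      have : 3 * g * 4 <= (3 * g).*2 ^ (2 * 2) by rewrite !expnS expn0 -!mul2n; nia.
      move: (_ ^ 3) (_ ^ (2 * 2)) (_ ^ (2 * 2)) => u v w; nia.
    apply: leq_trans H3; rewrite ltnS leq_mul2l; apply/orP; right; exact: H2.
  by rewrite leq_exp2r //; apply: grid_code_size.
rewrite tableau_accept.
have sol : (exists v, row_solution (3 * red_cells x) (red_cells x * m) (red_total x) a v) <->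
    exists v, tableau_solution TT PP m m
      (fun t p i => allowed x (red_guess x) (red_time x) (red_center x) t p (tile_of M i))
      (fun i => east_color (tile_of M i)) (fun i => west_color (tile_of M i))
      (fun i => south_color (tile_of M i)) (fun i => north_color (tile_of M i)) v by [].
have aE r c : r < 3 * red_cells x -> c < red_cells x * m -> a r c = red_scale x + red_coef x r c by [].
have QE : 2 * red_weight x < red_scale x by [].
have wE r : r < 3 * red_cells x -> \sum_(c < red_cells x * m) red_coef x r c <= red_weight x.
  by move=> _; apply: coef_sum.
split=> [/(exceeds_solution aE QE wE) /sol [v /tableau_of_solution H]|[s Hs]].
  by apply: H.
have [v Hv] : exists v, row_solution (3 * red_cells x) (red_cells x * m) (red_total x) a v.
  by apply/sol; apply: (solution_of_tableau _ _ _ _ _ Hs).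
exact: (solution_exceeds R2 n0 K0 aE QE wE Hv).
Qed.

End Reduction.

(** * The verifier *)

Definition tree_head (t : tree) : tree := if t is Node a _ then a else Leaf.
Definition tree_tail (t : tree) : tree := if t is Node _ b then b else Leaf.
Definition tree_bool (t : tree) : bool := if t is Node _ _ then true else false.
Fixpoint tree_seq (t : tree) : seq tree := if t is Node a b then a :: tree_seq b else [::].
Definition tree_nat (t : tree) : nat := size (tree_seq t).
Definition tree_bits (t : tree) : seq bool := map tree_bool (tree_seq t).

Lemma tree_seqK (s : seq tree) : tree_seq (enc s) = s.
Proof. by elim: s => //= a s ->. Qed.

Lemma tree_natK (n : nat) : tree_nat (enc n) = n.
Proof. by rewrite /tree_nat; elim: n => //= n ->. Qed.

Lemma tree_bitsK (s : seq bool) : tree_bits (enc s) = s.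
Proof. by rewrite /tree_bits; elim: s => //= b s ->; case: b. Qed.

(** Codes are in prefix notation, so a scan from right to left evaluates them with a stack of trees.
    The default [Leaf] keeps the parser total on malformed words. *)
Definition parse_step (st : seq tree) (b : bool) : seq tree :=
  if b then Node (head Leaf st) (head Leaf (behead st)) :: behead (behead st)
  else Leaf :: st.

Definition parse_tree (y : seq bool) : tree := head Leaf (foldl parse_step [::] (rev y)).

Lemma parse_treeK t : parse_tree (code t) = t.
Proof.
suff H s st : foldl parse_step st (rev (code t ++ s)) = t :: foldl parse_step st (rev s).
  by rewrite /parse_tree -[code t]cats0 H.
elim: t s st => [|a IHa b IHb] s st /=; first by rewrite rev_cons -cats1 foldl_cat.
by rewrite rev_cons -cats1 foldl_cat -catA IHa IHb.
Qed.

Section TreeTime.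
Variable X : encType.
Implicit Types f g : X -> tree.

Lemma polytime_tree_head f : polytime f -> polytime (fun x => tree_head (f x)).
Proof. exact: polytime_comp polytime_head. Qed.
Lemma polytime_tree_tail f : polytime f -> polytime (fun x => tree_tail (f x)).
Proof. exact: polytime_comp polytime_tail. Qed.
Lemma polytime_tree_bool f : polytime f -> polytime (fun x => tree_bool (f x)).
Proof. exact: polytime_comp polytime_is_node. Qed.

Lemma polytime_tree_seq f : polytime f -> polytime (fun x => tree_seq (f x)).
Proof.
apply: polytime_comp; apply: polytime_enc => t.
by rewrite /enc /=; elim: t => //= a _ b ->.
Qed.

Lemma polytime_Node f g : polytime f -> polytime g -> polytime (fun x => Node (f x) (g x)).
Proof.
by move=> Hf Hg; apply: (polytime_cast (f := fun x => (f x, g x)) (i := id)) => //; apply: polytime_pair.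
Qed.

End TreeTime.

Lemma polytime_tree_bits (X : encType) (f : X -> tree) : polytime f -> polytime (fun x => tree_bits (f x)).
Proof.
move=> Hf; have Hs := polytime_tree_seq Hf; rewrite /tree_bits.
apply: (@polytime_map _ _ _ (fun w : X * tree => tree_bool w.2)) => //.
by apply: polytime_tree_bool; pt.
Qed.

Lemma polytime_tree_nat (X : encType) (f : X -> tree) : polytime f -> polytime (fun x => tree_nat (f x)).
Proof. by move=> Hf; have Hs := polytime_tree_seq Hf; rewrite /tree_nat; pt. Qed.

Lemma polytime_parse_tree (X : encType) (f : X -> seq bool) : polytime f ->
  polytime (fun x => parse_tree (f x)).
Proof.
apply: polytime_comp.
suff H : polytime (fun y : seq bool => foldl (fun st b => parse_step st b) [::] (rev y)).
  by rewrite /parse_tree; pt.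
apply: (@polytime_foldl_add _ _ _ (fun w : seq bool * seq tree * bool => parse_step w.1.2 w.2) _ _ (4%:P)%R); try pt.
- by rewrite /parse_step; pt; apply: polytime_Node; pt.
- exact: polytime_rev (polytime_id).
move=> x st b /=; rewrite pevalE; case: b; rewrite /parse_step; last by rewrite sz_cons /= /sz /=; lia.
by case: st => [|a [|b st]]; rewrite /sz //= ?size_cat /= ?size_cat /=; lia.
Qed.

Ltac pt_user ::=
  lazymatch goal with
  | |- polytime (fun x => bits (@?f x)) => apply: (@polytime_bits _ f)
  | |- polytime (fun x => add_bits (@?f x) (@?g x)) => apply: (@polytime_add_bits _ f g)
  | |- polytime (fun x => leq_bits (@?f x) (@?g x)) => apply: (@polytime_leq_bits _ f g)
  | |- polytime (fun x => eq_dart (@?f x) (@?g x)) => apply: (@polytime_eq_dart _ f g)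
  | |- polytime (fun x => encode_bits (@?f x)) => apply: (@polytime_encode_bits _ f)
  | |- polytime (fun x => encode_nat (@?f x)) => apply: (@polytime_encode_nat _ f)
  | |- polytime (fun x => double (@?f x)) => apply: (@polytime_double _ f)
  | |- polytime (fun x => tree_head (@?f x)) => apply: (@polytime_tree_head _ f)
  | |- polytime (fun x => tree_tail (@?f x)) => apply: (@polytime_tree_tail _ f)
  | |- polytime (fun x => tree_bool (@?f x)) => apply: (@polytime_tree_bool _ f)
  | |- polytime (fun x => tree_seq (@?f x)) => apply: (@polytime_tree_seq _ f)
  | |- polytime (fun x => tree_nat (@?f x)) => apply: (@polytime_tree_nat _ f)
  | |- polytime (fun x => tree_bits (@?f x)) => apply: (@polytime_tree_bits _ f)
  | |- polytime (fun x => @eq_op _ (@?f x) (@?g x)) => apply: (@polytime_eq_bits _ f g)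
  end.

Definition sum_bits (s : seq (seq bool)) : seq bool := foldl add_bits [::] s.

(** Sums are not normalized, but lengths merely add up, so summing a list stays linear in its
    size. *)
Lemma size_add_bits u v : size (add_bits u v) = (size u + size v).+1.
Proof.
rewrite /add_bits size_rev.
have H l r : size (foldl (add_step u v) r l).2 = size r.2 + size l.
  by elim: l r => [|i l IH] r /=; rewrite ?addn0 // IH /= addSnnS.
by rewrite H size_iota.
Qed.

Lemma value_sum_bits s : value (sum_bits s) = sumn (map value s).
Proof.
rewrite /sum_bits -[RHS]add0n -[X in X + _]/(value [::]).
by elim: s [::] => [|u s IH] v /=; rewrite ?addn0 // IH value_add addnA.
Qed.

Lemma sz_bits (u : seq bool) : 2 * size u + 1 <= sz u <= 4 * size u + 1.
Proof. by elim: u => // b u IH; rewrite sz_cons /=; case: b; rewrite {1 3}/sz /=; lia. Qed.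

Lemma polytime_sum_bits (X : encType) (f : X -> seq (seq bool)) : polytime f ->
  polytime (fun x => sum_bits (f x)).
Proof.
apply: polytime_comp.
apply: (@polytime_foldl _ _ _ (fun w : seq (seq bool) * seq bool * seq bool => add_bits w.1.2 w.2) _ _ (4%:P * 'X + 1%:P)%R); try pt.
move=> s i; rewrite !pevalE /=.
have H (l : seq (seq bool)) u : size (foldl (fun b a => add_bits b a) u l) <= size u + sz l.
  elim: l u => [|v l IH] u /=; first exact: leq_addr.
  apply: leq_trans (IH _) _; rewrite size_add_bits sz_cons.
  by have := sz_bits v; lia.
apply: leq_trans (andP (sz_bits _)).2 _; rewrite leq_add2r leq_mul2l /=.
have := H (take i s) [::]; rewrite add0n => h; exact: leq_trans h (sz_take s i).
Qed.

(** * Verification of a rotation system *)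

Definition darts (n : nat) : seq dart := flatten [seq [seq (i, j) | j <- iota 0 n] | i <- iota 0 n].

Section Nat_ord_darts.
Variable n : nat.
Local Notation T := ('I_n * 'I_n)%type.

Definition dart_nat (d : T) : dart := (nat_of_ord d.1, nat_of_ord d.2).

Lemma dart_nat_inj : injective dart_nat.
Proof. by move=> [a b] [c d] [/ord_inj -> /ord_inj ->]. Qed.

Lemma dartsE : darts n = map dart_nat (enum [set: T]).
Proof.
rewrite (eq_enum (in_setT (T := T))) enumT unlock /= /prod_enum map_allpairs /darts /allpairs_dep.
rewrite -(val_enum_ord n) -map_comp.
congr flatten; apply: eq_map => i /=; rewrite -map_comp; exact: eq_map.
Qed.

Lemma mem_darts d : dart_nat d \in darts n.
Proof. by rewrite dartsE map_f // mem_enum inE. Qed.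

Lemma dartsP d : reflect (exists d', d = dart_nat d') (d \in darts n).
Proof.
rewrite dartsE; apply: (iffP mapP) => [[d' _ ->]|[d' ->]]; first by exists d'.
by exists d' => //; rewrite mem_enum inE.
Qed.

Lemma all_darts (P : pred dart) : all P (darts n) = [forall d : T, P (dart_nat d)].
Proof.
apply/allP/forallP => [H d|H d /dartsP[d' ->]]; [exact/H/mem_darts|exact: H].
Qed.

Lemma count_darts (P : pred dart) : count P (darts n) = #|[pred d : T | P (dart_nat d)]|.
Proof.
rewrite dartsE count_map cardE /enum_mem -size_filter; congr size.
rewrite -filter_predI; apply: eq_filter => d.
by rewrite -[LHS]/(P (dart_nat d) && (d \in [set: T])) in_setT andbT.
Qed.

Lemma size_darts : size (darts n) = #|{: T}|.
Proof. by rewrite dartsE size_map -cardE cardsT. Qed.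

(** After [k] rounds the set holds the ends of the paths with at most [k] steps, and a simple path
    has fewer steps than there are darts. *)
Lemma connectedE (e : rel dart) (e' : rel T) : (forall d d', e (dart_nat d) (dart_nat d') = e' d d') ->
  forall d d', connected (darts n) e (dart_nat d) (dart_nat d') = connect e' d d'.
Proof.
move=> eE d d'; pose S k := iter k (fun S => [seq y <- darts n | has (fun x => eq_dart x y || e x y) S]) [:: dart_nat d].
have SE k : (forall y, y \in S k -> exists z, y = dart_nat z) /\
    forall z, (dart_nat z \in S k) <-> exists p, [/\ path e' d p, last d p = z & size p <= k].
  elim: k => [|k [IH1 IH2]].
    split=> [y|z]; rewrite mem_seq1; first by move=> /eqP ->; exists d.
    split=> [/eqP /dart_nat_inj ->|[p [_ <-]]]; first by exists [::].
    by rewrite leqn0 => /nilP ->.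
  have hasE z : has (fun x => eq_dart x (dart_nat z) || e x (dart_nat z)) (S k) <->
      exists2 u, dart_nat u \in S k & (u == z) || e' u z.
    split=> [/hasP[x xS]|[u uS uz]].
      by have [u E] := IH1 x xS; rewrite E eq_dartP (inj_eq dart_nat_inj) eE in xS * => uz; exists u.
    by apply/hasP; exists (dart_nat u); rewrite // eq_dartP (inj_eq dart_nat_inj) eE.
  split=> [y|z]; rewrite /S iterS -/(S k) mem_filter; first by case/andP=> _ /dartsP[z ->]; exists z.
  rewrite mem_darts andbT; split=> [/hasE[u /IH2[p [Hp Hl Hs]] /orP[/eqP <-|uz]]|[p [Hp Hl Hs]]].
  - by exists p; split=> //; apply: leqW.
  - by exists (rcons p z); rewrite rcons_path last_rcons size_rcons Hp Hl uz.
  - apply/hasE; case/lastP: p Hp Hl Hs => [|p u]; first by move=> _ <- _; exists d; rewrite ?eqxx //; apply/IH2; exists [::].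
    rewrite rcons_path last_rcons size_rcons ltnS => /andP[Hp pu] <- Hs.
    by exists (last d p); rewrite ?pu ?orbT //; apply/IH2; exists p.
rewrite /connected /reach -/(S _).
have -> : has (fun y => eq_dart y (dart_nat d')) (S (size (darts n))) = (dart_nat d' \in S (size (darts n))).
  by apply/hasP/idP => [[y yS]|dS]; [rewrite eq_dartP => /eqP <-|exists (dart_nat d'); rewrite // eq_dartP].
apply/idP/idP => [/(SE _).2 [p [Hp Hl _]]|/connectP[p Hp Hl]]; first by apply/connectP; exists p.
apply/(SE _).2; case/shortenP: Hp Hl => p' Hp' Hu _ Hl; exists p'; split=> //.
rewrite size_darts; apply: ltnW; rewrite -[(size p').+1]/(size (d :: p')) -(card_uniqP Hu); exact: max_card.
Qed.

Lemma lex_leqE (d d' : T) : lex_leq (dart_nat d) (dart_nat d') = (d.1 * n + d.2 <= d'.1 * n + d'.2).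
Proof.
case: d d' => [a b] [c d]; rewrite /lex_leq /=; have := ltn_ord b; have := ltn_ord d => dn bn.
case: (ltngtP a c) => H /=.
- have : a.+1 * n <= c * n by rewrite leq_mul2r H orbT.
  by rewrite mulSn; lia.
- have : c.+1 * n <= a * n by rewrite leq_mul2r H orbT.
  by rewrite mulSn; lia.
- by rewrite H leq_add2l.
Qed.

(** The lexicographic order is that of the row-major index, which is injective, so the minima of the
    classes form a transversal. *)
Lemma componentsE (e : rel dart) (a : pred dart) (e' : rel T) (a' : {pred T}) :
  (forall d d', e (dart_nat d) (dart_nat d') = e' d d') -> (forall d, a (dart_nat d) = (d \in a')) ->
  connect_sym e' -> closed e' a' -> components (darts n) e a = n_comp e' a'.
Proof.
move=> eE aE symE cl; rewrite /components count_darts.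
pose ix (d : T) := d.1 * n + d.2.
pose B := [pred d : T | (d \in a') && [forall d', connect e' d d' ==> (ix d <= ix d')]].
rewrite (@eq_card _ _ B); last first.
  move=> d; rewrite !inE aE all_darts; congr (_ && _); apply: eq_forallb => d'.
  by rewrite (connectedE eE) lex_leqE.
rewrite (n_comp_transversal (B := B)) //.
- by move=> d /andP[].
- move=> x xa; have [y xy ymin] := arg_minnP ix (connect0 e' x); exists y => //.
  rewrite inE -(closed_connect cl xy) xa /=; apply/forallP => z; apply/implyP => yz.
  by apply: ymin; apply: connect_trans xy yz.
- move=> y z; rewrite !inE => /andP[_ /forallP /(_ z) /implyP Hy] /andP[_ /forallP /(_ y) /implyP Hz] yz.
  have {}Hy := Hy yz; have {}Hz : ix z <= ix y by apply: Hz; rewrite symE.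
  have E : ix y = ix z by apply/eqP; rewrite eqn_leq Hy.
  have [yn zn] := (ltn_ord y.2, ltn_ord z.2).
  have n0 : 0 < n by apply: leq_ltn_trans yn.
  have E1 := congr1 (divn^~ n) E; have E2 := congr1 (modn^~ n) E.
  rewrite /ix !divnMDl ?[_ %/ n]divn_small ?addn0 in E1 => //.
  rewrite /ix !modnMDl !modn_small in E2 => //.
  by apply: dart_nat_inj; rewrite /dart_nat E1 E2.
Qed.

End Nat_ord_darts.

Definition swap_nat (d : dart) : dart := (d.2, d.1).

Definition node_rel (nd : dart -> dart) : rel dart := fun d d' => eq_dart (nd d) d'.
Definition face_rel (nd : dart -> dart) : rel dart := fun d d' => eq_dart (nd (swap_nat d)) d'.
Definition link_rel (nd : dart -> dart) : rel dart :=
  fun d d' => eq_dart d' (swap_nat d) || eq_dart d' (nd d).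

Definition orbit_check (n : nat) (nd : dart -> dart) (adj : pred dart) : bool :=
  all (fun d => adj d ==> all (fun d' => connected (darts n) (node_rel nd) d d' ==
     (adj d' && (d'.1 == d.1))) (darts n)) (darts n).

Definition euler_check (n : nat) (nd : dart -> dart) (adj : pred dart) : bool :=
  components (darts n) (node_rel nd) adj + components (darts n) (node_rel swap_nat) adj +
  components (darts n) (face_rel nd) adj ==
  count adj (darts n) + 2 * components (darts n) (link_rel nd) adj.

(** An injective map of a finite set into itself is a permutation, so these two tests turn the table
    of the certificate into one. *)
Definition perm_check (n : nat) (nd : dart -> dart) : bool :=
  all (fun d => ((nd d).1 < n) && ((nd d).2 < n)) (darts n) &&
  all (fun d => all (fun d' => eq_dart (nd d) (nd d') ==> eq_dart d d') (darts n)) (darts n).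

Section PlanarCheck.
Variables (n : nat) (nd : dart -> dart) (adj : pred dart).
Local Notation T := ('I_n * 'I_n)%type.
Hypothesis adj_sym : forall d, adj (swap_nat d) = adj d.
Let adjr : rel 'I_n := fun x y => adj (nat_of_ord x, nat_of_ord y).
Let dartp := [pred d : T | adjr d.1 d.2].

Section Node.
Variable node : {perm T}.
Hypothesis nodeE : forall d : T, nd (dart_nat d) = dart_nat (node d).

Let node_relE (d d' : T) : node_rel nd (dart_nat d) (dart_nat d') = (frel node d d').
Proof. by rewrite /node_rel nodeE eq_dartP (inj_eq (@dart_nat_inj n)). Qed.

Let swapE (d : T) : swap_nat (dart_nat d) = dart_nat (swap_dart d).
Proof. by []. Qed.

Lemma orbit_checkP : orbit_check n nd adj <->
  forall d d' : T, dartp d -> fconnect node d d' = dartp d' && (d'.1 == d.1).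
Proof.
rewrite /orbit_check all_darts; split=> [/forallP H d d' dd|H].
  have := H d; rewrite [adj _]dd /= all_darts => /forallP /(_ d') /eqP <-.
  by rewrite (connectedE node_relE).
apply/forallP => d; apply/implyP => dd; rewrite all_darts; apply/forallP => d'.
by rewrite (connectedE node_relE) H.
Qed.

Hypothesis orbitP : forall d d' : T, dartp d -> fconnect node d d' = dartp d' && (d'.1 == d.1).

Lemma dartp_node d : dartp (node d) = dartp d.
Proof.
apply/idP/idP => H.
  have : fconnect node (node d) d by rewrite (fconnect_sym (@perm_inj _ node)) fconnect1.
  by rewrite orbitP // => /andP[].
by have := fconnect1 node d; rewrite orbitP // => /andP[].
Qed.

Lemma dartp_swap d : dartp (swap_dart d) = dartp d.
Proof. exact: (adj_sym (dart_nat d)). Qed.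

Lemma euler_checkE : euler_check n nd adj =
  (fcard node dartp + fcard (@swap_dart 'I_n) dartp + fcard (fun d => node (swap_dart d)) dartp ==
   #|dartp| + 2 * n_comp [rel d d' | (d' == swap_dart d) || (d' == node d)] dartp).
Proof.
rewrite /euler_check count_darts.
rewrite (@componentsE n _ _ (frel node) dartp node_relE) //; first last.
- by move=> x y /eqP <-; exact: esym (dartp_node x).
- exact: fconnect_sym (@perm_inj _ node).
rewrite (@componentsE n _ _ (frel (@swap_dart 'I_n)) dartp) //; first last.
- by move=> x y /eqP <-; exact: esym (dartp_swap x).
- exact: fconnect_sym (can_inj (@swap_dartK _)).
rewrite (@componentsE n _ _ (frel (fun d => node (swap_dart d))) dartp) //; first last.
- by move=> x y /eqP <-; exact: esym (etrans (dartp_node _) (dartp_swap x)).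
- by apply: fconnect_sym => x y /perm_inj /(can_inj (@swap_dartK _)).
- by move=> d d'; rewrite /face_rel swapE nodeE eq_dartP (inj_eq (@dart_nat_inj n)).
rewrite (@componentsE n _ _ [rel d d' | (d' == swap_dart d) || (d' == node d)] dartp) //; first last.
- by move=> x y /orP[] /eqP ->; [exact: esym (dartp_swap x)|exact: esym (dartp_node x)].
- exact: link_sym.
- by move=> d d'; rewrite /link_rel swapE nodeE !eq_dartP !(inj_eq (@dart_nat_inj n)).
Qed.

End Node.

Lemma planar_check_sound : perm_check n nd -> orbit_check n nd adj -> euler_check n nd adj ->
  planar adjr.
Proof.
case/andP; rewrite !all_darts => /forallP ltn /forallP inj orb eul.
have l1 (d : T) : (nd (dart_nat d)).1 < n by have /andP[] := ltn d.
have l2 (d : T) : (nd (dart_nat d)).2 < n by have /andP[] := ltn d.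
pose f (d : T) : T := (Ordinal (l1 d), Ordinal (l2 d)).
have fE (d : T) : nd (dart_nat d) = dart_nat (f d) by rewrite /f /dart_nat -surjective_pairing.
have finj : injective f.
  move=> d d' E; have := inj d; rewrite all_darts => /forallP /(_ d').
  by rewrite !fE E eq_dartP eqxx /= eq_dartP => /eqP /dart_nat_inj.
have pE (d : T) : nd (dart_nat d) = dart_nat (perm finj d) by rewrite permE.
have /(orbit_checkP pE) O := orb.
exists (perm finj); split; first exact: O.
by move: eul; rewrite (euler_checkE pE O) => /eqP.
Qed.

Lemma planar_check_complete (node : {perm T}) :
  (forall d : T, nd (dart_nat d) = dart_nat (node d)) ->
  (forall d d' : T, dartp d -> fconnect node d d' = dartp d' && (d'.1 == d.1)) ->
  fcard node dartp + fcard (@swap_dart 'I_n) dartp + fcard (fun d => node (swap_dart d)) dartp =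
   #|dartp| + 2 * n_comp [rel d d' | (d' == swap_dart d) || (d' == node d)] dartp ->
  [&& perm_check n nd, orbit_check n nd adj & euler_check n nd adj].
Proof.
move=> nE O E; apply/and3P; split; last by rewrite (euler_checkE nE O) E.
  apply/andP; split; rewrite all_darts; apply/forallP => d; first by rewrite nE /= !ltn_ord.
  rewrite all_darts; apply/forallP => d'; rewrite !nE !eq_dartP !(inj_eq (@dart_nat_inj n)).
  by apply/implyP => /eqP /perm_inj ->.
exact/(orbit_checkP nE).
Qed.

End PlanarCheck.

(** * Certificates *)

Definition item (k : nat) (z : tree) : tree := nth Leaf (tree_seq z) k.
Definition c_size (z : tree) : nat := tree_nat (item 0 z).
(** Tables over pairs of vertices are stored row by row: item 1 for the arcs, 6 for the rotation
    system, 7 for the cut. Entries missing from a malformed certificate read as [Leaf]. *)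
Definition c_cell (k : nat) (z : tree) (d : dart) : tree :=
  nth Leaf (tree_seq (item k z)) (d.1 * c_size z + d.2).
Definition c_arc (z : tree) (d : dart) : bool := tree_bool (c_cell 1 z d).
Definition c_weight (z : tree) (d : dart) : seq bool := tree_bits (tree_head (c_cell 1 z d)).
Definition c_cost (z : tree) (d : dart) : seq bool := tree_bits (tree_tail (c_cell 1 z d)).
Definition c_budget (z : tree) : seq bool := tree_bits (item 2 z).
Definition c_source (z : tree) : nat := tree_nat (item 3 z).
Definition c_target (z : tree) : nat := tree_nat (item 4 z).
Definition c_threshold (z : tree) : seq bool := tree_bits (item 5 z).
Definition c_node (z : tree) (d : dart) : dart :=
  (tree_nat (tree_head (c_cell 6 z d)), tree_nat (tree_tail (c_cell 6 z d))).
Definition c_cut (z : tree) (d : dart) : bool := tree_bool (c_cell 7 z d).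
Definition c_potential (z : tree) (i : nat) : seq bool := tree_bits (nth Leaf (tree_seq (item 8 z)) i).
Definition c_adj (z : tree) (d : dart) : bool :=
  ~~ (d.1 == d.2) && (c_arc z d || c_arc z (swap_nat d)).

(** The input is never decoded: the verifier encodes the instance held by the certificate and
    compares words. *)
Definition c_code (z : tree) : seq bool :=
  nseq (c_size z) true ++ false ::
  flatten [seq if c_arc z d then true :: encode_bits (c_weight z d) ++ encode_bits (c_cost z d)
               else [:: false] | d <- darts (c_size z)] ++
  encode_bits (c_budget z) ++ encode_nat (c_source z) ++ encode_nat (c_target z) ++
  encode_bits (c_threshold z).

(** The predicate [canonical], expressed by functions that [pt] knows. *)
Definition is_canonical (u : seq bool) : bool := head true (rev u).

Definition square_bits (x : seq bool) : seq bool := bits (size x * size x).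

(* [z] certifies that [x] encodes an instance with a positive answer and, when
   [b] holds, with all numbers at most the square of the size of [x]. *)
Definition check (b : bool) (x : seq bool) (z : tree) : bool :=
  [&& x == c_code z,
      [&& c_source z < c_size z, c_target z < c_size z & ~~ (c_source z == c_target z)],
      [&& is_canonical (c_budget z), 0 < size (c_budget z) & is_canonical (c_threshold z)],
      all (fun d => c_arc z d ==> [&& is_canonical (c_weight z d), is_canonical (c_cost z d) &
         b ==> leq_bits (c_weight z d) (square_bits x) && leq_bits (c_cost z d) (square_bits x)])
        (darts (c_size z)),
      b ==> leq_bits (c_budget z) (square_bits x) && leq_bits (c_threshold z) (square_bits x),
      [&& perm_check (c_size z) (c_node z), orbit_check (c_size z) (c_node z) (c_adj z) &
          euler_check (c_size z) (c_node z) (c_adj z)],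
      leq_bits (sum_bits [seq c_cost z d | d <- [seq d <- darts (c_size z) | c_arc z d && c_cut z d]])
        (c_budget z),
      leq_bits (c_potential z (c_source z)) [::],
      ~~ leq_bits (c_potential z (c_target z)) (c_threshold z) &
      all (fun d => c_arc z d && ~~ c_cut z d ==>
         leq_bits (c_potential z d.2) (add_bits (c_potential z d.1) (c_weight z d))) (darts (c_size z))].

Section CheckTime.
Variable X : encType.
Variables (f : X -> tree) (d : X -> dart) (i : X -> nat).
Hypothesis (Hf : polytime f) (Hd : polytime d) (Hi : polytime i).

Lemma polytime_item k : polytime (fun x => item k (f x)).
Proof. rewrite /item; pt. Qed.

Lemma polytime_c_size : polytime (fun x => c_size (f x)).
Proof. have H := polytime_item 0; rewrite /c_size; pt. Qed.

Lemma polytime_c_cell k : polytime (fun x => c_cell k (f x) (d x)).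
Proof. have H := polytime_item k; have H' := polytime_c_size; rewrite /c_cell; pt. Qed.

Lemma polytime_c_arc : polytime (fun x => c_arc (f x) (d x)).
Proof. have H := polytime_c_cell 1; rewrite /c_arc; pt. Qed.

Lemma polytime_c_weight : polytime (fun x => c_weight (f x) (d x)).
Proof. have H := polytime_c_cell 1; rewrite /c_weight; pt. Qed.

Lemma polytime_c_cost : polytime (fun x => c_cost (f x) (d x)).
Proof. have H := polytime_c_cell 1; rewrite /c_cost; pt. Qed.

Lemma polytime_c_node : polytime (fun x => c_node (f x) (d x)).
Proof. have H := polytime_c_cell 6; rewrite /c_node; pt. Qed.

Lemma polytime_c_cut : polytime (fun x => c_cut (f x) (d x)).
Proof. have H := polytime_c_cell 7; rewrite /c_cut; pt. Qed.

Lemma polytime_c_potential : polytime (fun x => c_potential (f x) (i x)).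
Proof. have H := polytime_item 8; rewrite /c_potential; pt. Qed.

Lemma polytime_darts : polytime (fun x => darts (i x)).
Proof. rewrite /darts; pt. Qed.

End CheckTime.

Ltac pt_user ::=
  lazymatch goal with
  | |- polytime (fun x => bits (@?f x)) => apply: (@polytime_bits _ f)
  | |- polytime (fun x => add_bits (@?f x) (@?g x)) => apply: (@polytime_add_bits _ f g)
  | |- polytime (fun x => leq_bits (@?f x) (@?g x)) => apply: (@polytime_leq_bits _ f g)
  | |- polytime (fun x => eq_dart (@?f x) (@?g x)) => apply: (@polytime_eq_dart _ f g)
  | |- polytime (fun x => encode_bits (@?f x)) => apply: (@polytime_encode_bits _ f)
  | |- polytime (fun x => encode_nat (@?f x)) => apply: (@polytime_encode_nat _ f)
  | |- polytime (fun x => tree_bits (@?f x)) => apply: (@polytime_tree_bits _ f)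
  | |- polytime (fun x => tree_nat (@?f x)) => apply: (@polytime_tree_nat _ f)
  | |- polytime (fun x => sum_bits (@?f x)) => apply: (@polytime_sum_bits _ f)
  | |- polytime (fun x => item ?k (@?f x)) => apply: (@polytime_item _ f)
  | |- polytime (fun x => c_size (@?f x)) => apply: (@polytime_c_size _ f)
  | |- polytime (fun x => c_arc (@?f x) (@?g x)) => apply: (@polytime_c_arc _ f g)
  | |- polytime (fun x => c_weight (@?f x) (@?g x)) => apply: (@polytime_c_weight _ f g)
  | |- polytime (fun x => c_cost (@?f x) (@?g x)) => apply: (@polytime_c_cost _ f g)
  | |- polytime (fun x => c_node (@?f x) (@?g x)) => apply: (@polytime_c_node _ f g)
  | |- polytime (fun x => c_cut (@?f x) (@?g x)) => apply: (@polytime_c_cut _ f g)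
  | |- polytime (fun x => c_potential (@?f x) (@?g x)) => apply: (@polytime_c_potential _ f g)
  | |- polytime (fun x => darts (@?f x)) => apply: (@polytime_darts _ f)
  | |- polytime (fun x => @eq_op _ (@?f x) (@?g x)) => apply: (@polytime_eq_bits _ f g)
  end.

Lemma polytime_c_adj (X : encType) (f : X -> tree) (d : X -> dart) : polytime f -> polytime d ->
  polytime (fun x => c_adj (f x) (d x)).
Proof. move=> Hf Hd; rewrite /c_adj /swap_nat; pt. Qed.

Lemma polytime_check (b : bool) : polytime (fun w : seq bool * tree => check b w.1 w.2).
Proof.
pose L z := darts (c_size z).
have HL : polytime L by rewrite /L; pt.
have Hnode : polytime (fun w : tree * dart * dart => node_rel (c_node w.1.1) w.1.2 w.2).
  by rewrite /node_rel; pt.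
have Hswap : polytime (fun w : tree * dart * dart => node_rel swap_nat w.1.2 w.2).
  by rewrite /node_rel /swap_nat; pt.
have Hface : polytime (fun w : tree * dart * dart => face_rel (c_node w.1.1) w.1.2 w.2).
  by rewrite /face_rel /swap_nat; pt.
have Hlink : polytime (fun w : tree * dart * dart => link_rel (c_node w.1.1) w.1.2 w.2).
  by rewrite /link_rel /swap_nat; pt.
have Hadj : polytime (fun w : tree * dart => c_adj w.1 w.2) by apply: polytime_c_adj; pt.
have C1 := polytime_components (e := fun z => node_rel (c_node z)) HL Hnode Hadj.
have C2 := polytime_components (e := fun=> node_rel swap_nat) HL Hswap Hadj.
have C3 := polytime_components (e := fun z => face_rel (c_node z)) HL Hface Hadj.
have C4 := polytime_components (e := fun z => link_rel (c_node z)) HL Hlink Hadj.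
have Eul : polytime (fun z => euler_check (c_size z) (c_node z) (c_adj z)).
  rewrite /euler_check; pt; try first [exact: C1|exact: C2|exact: C3|exact: C4].
  by apply: (@polytime_count _ _ (fun w : tree * dart => c_adj w.1 w.2)); pt.
have Prm : polytime (fun z => perm_check (c_size z) (c_node z)).
  by rewrite /perm_check; pt.
have Orb : polytime (fun z => orbit_check (c_size z) (c_node z) (c_adj z)).
  rewrite /orbit_check; pt.
  by apply: (polytime_connected (e := fun z => node_rel (c_node z)) HL Hnode); pt.
rewrite /check /c_code /is_canonical /square_bits /c_budget /c_source /c_target /c_threshold; pt.
- exact: polytime_comp Prm polytime_snd.
- exact: polytime_comp Orb polytime_snd.
- exact: polytime_comp Eul polytime_snd.
Qed.

Lemma is_canonicalE u : is_canonical u = canonical u.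
Proof. by rewrite /is_canonical /canonical; case/lastP: u => // u b; rewrite rev_rcons last_rcons. Qed.

Lemma darts_allpairs n :
  darts n = map (@dart_nat n) [seq (x, y) | x <- enum 'I_n, y <- enum 'I_n].
Proof.
rewrite map_allpairs /darts /allpairs_dep -(val_enum_ord n) -map_comp.
congr flatten; apply: eq_map => i /=; rewrite -map_comp; exact: eq_map.
Qed.

Lemma sum_darts n (P : pred dart) (F : dart -> nat) :
  sumn [seq F d | d <- [seq d <- darts n | P d]] = \sum_(e : 'I_n * 'I_n | P (dart_nat e)) F (dart_nat e).
Proof.
rewrite sumnE big_map big_filter dartsE big_map big_enum_cond /=.
by apply: eq_bigl => e; rewrite in_setT.
Qed.

Lemma c_adj_sym z d : c_adj z (swap_nat d) = c_adj z d.
Proof. by rewrite /c_adj /= eq_sym orbC; case: d. Qed.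

Lemma underlying_adj n (E : {set 'I_n * 'I_n}) z :
  (forall e : 'I_n * 'I_n, c_arc z (dart_nat e) = (e \in E)) ->
  underlying E =2 (fun x y : 'I_n => c_adj z (nat_of_ord x, nat_of_ord y)).
Proof.
move=> H x y; rewrite /underlying /c_adj /=; congr (_ && _).
by rewrite -(H (x, y)) -(H (y, x)).
Qed.

Lemma check_sound b x z : check b x z -> exists i : instance,
  [/\ encode i = x, interdiction_exceeds i & b -> max_number i <= size x ^ 2].
Proof.
rewrite /check !is_canonicalE; set n := c_size z.
move=> /andP[/eqP xE] /andP[/and3P[sn tn st]] /andP[/and3P[cB B0 ck]] /andP[Hd] /andP[Hb].
move=> /andP[/and3P[perm orb eul]] /andP[cost0] /andP[pot_s] /andP[pot_t pot_step].
rewrite !all_darts in Hd pot_step; move/forallP in Hd; move/forallP in pot_step.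
pose E := [set e : 'I_n * 'I_n | c_arc z (dart_nat e)].
have EE e : c_arc z (dart_nat e) = (e \in E) by rewrite inE.
have planarE : planar (underlying E).
  apply: planar_ext (planar_check_sound (c_adj_sym z) perm orb eul) => u v.
  by rewrite (underlying_adj EE).
have can e : e \in E -> canonical (c_weight z (dart_nat e)) /\ canonical (c_cost z (dart_nat e)).
  by move=> eE; have := Hd e; rewrite EE eE !is_canonicalE => /and3P[].
have v0 : 0 < value (c_budget z) by apply: value_gt0 => //; rewrite -size_eq0 -lt0n.
have st' : Ordinal sn != Ordinal tn by [].
pose i := @Instance n E planarE (fun e => value (c_weight z (dart_nat e)))
  (fun e => value (c_cost z (dart_nat e))) (value (c_budget z)) v0 _ _ st' (value (c_threshold z)).
(* Without leading zeros, the words of the certificate are exactly those that [encode_nat] produces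
   for their values. *)
have nat_code u : canonical u -> encode_nat (value u) = encode_bits u.
  by move=> cu; rewrite -[in RHS](bits_value cu).
exists i; split.
- rewrite encodeE xE /c_code /= !nat_code // darts_allpairs -map_comp; congr (_ ++ _ :: flatten _ ++ _).
  apply: eq_map => e /=; rewrite /arc_code -EE; case: ifP => // eE.
  by have [] := can e; rewrite -?EE // => c1 c2; rewrite !nat_code.
- apply/interdiction_gtP => /=.
  exists [set e | c_arc z (dart_nat e) && c_cut z (dart_nat e)], (fun v => value (c_potential z v)); split.
  + by apply/subsetP => e; rewrite !inE => /andP[].
  + move: cost0; rewrite leq_bitsP value_sum_bits -map_comp sum_darts; apply: leq_trans.
    by rewrite leq_eqVlt; apply/orP; left; apply/eqP; apply: eq_bigl => e; rewrite inE.
  + split=> /=; first by move: pot_s; rewrite leq_bitsP leqn0 => /eqP.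
      by move: pot_t; rewrite leq_bitsP -ltnNge.
    move=> u v; rewrite !inE => /andP[NI uv]; rewrite -value_add -leq_bitsP.
    have := pot_step (u, v); rewrite /= uv => /implyP; apply.
    by move: NI; rewrite uv.
- move=> bT; have sq : value (square_bits x) = size x ^ 2 by rewrite value_bits -mulnn.
  rewrite /max_number /= !geq_max.
  move: Hb; rewrite bT /= !leq_bitsP sq => /andP[-> ->]; rewrite !andbT.
  apply/bigmax_leqP => e; rewrite inE => eE; rewrite geq_max.
  by have := Hd e; rewrite eE bT /= !leq_bitsP sq => /and3P[].
Qed.

Definition tabulate (n : nat) (g : 'I_n * 'I_n -> tree) : seq tree :=
  mkseq (fun j => match insub (j %/ n), insub (j %% n) with
                  | Some a, Some b => g (a, b)
                  | _, _ => Leaf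
                  end) (n * n).

Lemma nth_tabulate n (g : 'I_n * 'I_n -> tree) (e : 'I_n * 'I_n) :
  nth Leaf (tabulate g) (e.1 * n + e.2) = g e.
Proof.
case: e => a b /=; have n0 : 0 < n by apply: leq_ltn_trans (ltn_ord a).
rewrite nth_mkseq; last first.
  have : a.+1 * n <= n * n by rewrite leq_mul2r ltn_ord orbT.
  by rewrite mulSn; have := ltn_ord b; lia.
by rewrite divnMDl // divn_small // addn0 modnMDl modn_small // !valK.
Qed.

Section Certificate.
Variables (n : nat) (E : {set 'I_n * 'I_n}) (w c : 'I_n * 'I_n -> nat) (B s t k : nat).
Variables (node : {perm 'I_n * 'I_n}) (I : {set 'I_n * 'I_n}) (f : 'I_n -> nat).

Definition certificate : seq tree :=
  [:: enc n;
      enc (tabulate (fun e => if e \in E then Node (enc (bits (w e))) (enc (bits (c e))) else Leaf));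
      enc (bits B); enc s; enc t; enc (bits k);
      enc (tabulate (fun e => Node (enc (nat_of_ord (node e).1)) (enc (nat_of_ord (node e).2))));
      enc (tabulate (fun e => enc (e \in I)));
      enc (mkseq (fun i => if insub i is Some v then enc (bits (f v)) else Leaf) n)].

Let z : tree := enc certificate.

Lemma itemE j : item j z = nth Leaf certificate j.
Proof. by rewrite /item tree_seqK. Qed.

Lemma cert_size : c_size z = n.
Proof. by rewrite /c_size itemE tree_natK. Qed.

Lemma cert_arc e : c_arc z (dart_nat e) = (e \in E).
Proof.
by rewrite /c_arc /c_cell itemE cert_size tree_seqK nth_tabulate; case: ifP.
Qed.

Lemma cert_weight e : e \in E -> c_weight z (dart_nat e) = bits (w e).
Proof.
by move=> eE; rewrite /c_weight /c_cell itemE cert_size tree_seqK nth_tabulate eE tree_bitsK.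
Qed.

Lemma cert_cost e : e \in E -> c_cost z (dart_nat e) = bits (c e).
Proof.
by move=> eE; rewrite /c_cost /c_cell itemE cert_size tree_seqK nth_tabulate eE tree_bitsK.
Qed.

Lemma cert_node e : c_node z (dart_nat e) = dart_nat (node e).
Proof.
by rewrite /c_node /c_cell itemE cert_size tree_seqK nth_tabulate /= !tree_natK.
Qed.

Lemma cert_cut e : c_cut z (dart_nat e) = (e \in I).
Proof.
by rewrite /c_cut /c_cell itemE cert_size tree_seqK nth_tabulate; case: (e \in I).
Qed.

Lemma cert_potential (v : 'I_n) : c_potential z v = bits (f v).
Proof. by rewrite /c_potential itemE tree_seqK nth_mkseq // valK tree_bitsK. Qed.

Lemma cert_budget : c_budget z = bits B.
Proof. by rewrite /c_budget itemE tree_bitsK. Qed.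

Lemma cert_threshold : c_threshold z = bits k.
Proof. by rewrite /c_threshold itemE tree_bitsK. Qed.

Lemma cert_source : c_source z = s.
Proof. by rewrite /c_source itemE tree_natK. Qed.

Lemma cert_target : c_target z = t.
Proof. by rewrite /c_target itemE tree_natK. Qed.

Lemma sz_seq_le (A : encType) (l : seq A) (m : nat) :
  (forall j, j < size l -> forall d, sz (nth d l j) <= m) -> sz l <= size l * m.+1 + 1.
Proof.
elim: l => [|a l IH] H //; rewrite sz_cons /=.
have := H 0 isT a; have := IH (fun j Hj d => H j.+1 Hj d); rewrite /= mulSn; lia.
Qed.

Lemma sz_tabulate g m : (forall e, sz (g e) <= m) -> 0 < m -> sz (tabulate (n := n) g) <= n * n * m.+1 + 1.
Proof.
move=> Hm m0; rewrite -[X in X * _](size_mkseq (fun j => match insub (j %/ n), insub (j %% n) with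
                  | Some a, Some b => g (a, b)
                  | _, _ => Leaf
                  end) (n * n)).
apply: sz_seq_le => j; rewrite size_mkseq => Hj d; rewrite nth_mkseq //.
by case: insub => [a|] //; case: insub.
Qed.

(** Nine items, each of size at most [(N * N + N + 1) * (8 * N + 12)]: a table has at most [N * N]
    entries, and [8 * N + 11] leaves room for two words of [N] bits or two unary numbers up to
    [N]. *)
Lemma certificate_size N : n <= N -> s <= N -> t <= N ->
  (forall e, e \in E -> size (bits (w e)) <= N /\ size (bits (c e)) <= N) ->
  size (bits B) <= N -> size (bits k) <= N -> (forall v, size (bits (f v)) <= N.+1) ->
  sz certificate <= 9 * ((N * N + N + 1) * (8 * N + 12)).+1 + 1.
Proof.
move=> nN sN tN HE BN kN fN.
have sb m : sz (bits m) <= 4 * size (bits m) + 1 by have /andP[] := sz_bits (bits m).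
have nn : n * n <= N * N by apply: leq_mul.
have tab (g : 'I_n * 'I_n -> tree) : (forall e, sz (g e) <= 8 * N + 11) ->
    sz (tabulate g) <= (N * N + N + 1) * (8 * N + 12).
  move=> Hg; have m0 : 0 < 8 * N + 11 by rewrite addn_gt0 orbT.
  apply: leq_trans (sz_tabulate Hg m0) _.
  have : n * n * (8 * N + 11).+1 <= N * N * (8 * N + 12) by apply: leq_mul; rewrite ?addnS.
  by rewrite !mulnDl; lia.
have big m : m <= 8 * N + 12 -> m <= (N * N + N + 1) * (8 * N + 12).
  by move=> H; apply: leq_trans H _; rewrite leq_pmull // addn1.
apply: (@sz_seq_le _ certificate) => j.
case: j => [|[|[|[|[|[|[|[|[|j]]]]]]]]] // _ d.
- by rewrite -[sz _]/(sz n); apply: big; rewrite sz_nat; lia.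
- rewrite -[sz _]/(sz (tabulate _)); apply: tab => e; case: ifP => [eE|_]; last by rewrite /sz /=; lia.
  have [h1 h2] := HE e eE; rewrite -[sz _]/(sz (bits (w e), bits (c e))) sz_pair.
  have := sb (w e); have := sb (c e); lia.
- by rewrite -[sz _]/(sz (bits B)); apply: big; have := sb B; lia.
- by rewrite -[sz _]/(sz s); apply: big; rewrite sz_nat; lia.
- by rewrite -[sz _]/(sz t); apply: big; rewrite sz_nat; lia.
- by rewrite -[sz _]/(sz (bits k)); apply: big; have := sb k; lia.
- rewrite -[sz _]/(sz (tabulate _)); apply: tab => e; set a := (node e).1; set b := (node e).2.
  rewrite -[sz _]/(sz (nat_of_ord a, nat_of_ord b)) sz_pair !sz_nat.
  have := ltn_ord a; have := ltn_ord b; lia.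
- rewrite -[sz _]/(sz (tabulate _)); apply: tab => e; rewrite -[sz _]/(sz (e \in I)).
  have := sz_bool (e \in I); lia.
- rewrite -[sz _]/(sz (mkseq _ n)); apply: leq_trans (_ : n * (4 * N + 6).+1 + 1 <= _); last first.
    have : n * (4 * N + 6).+1 <= N * (8 * N + 12) by apply: leq_mul => //; lia.
    by rewrite !mulnDl; lia.
  rewrite -[X in X * _](size_mkseq (fun i => if insub i is Some v then enc (bits (f v)) else Leaf) n).
  apply: sz_seq_le => i; rewrite size_mkseq => Hi d'; rewrite nth_mkseq //.
  case: insub => [v|]; last by rewrite /sz /=; lia.
  rewrite -[sz _]/(sz (bits (f v))); have := sb (f v); have := fN v; lia.
Qed.

End Certificate.

(** Meant for [m] at most [n.+1]: a potential truncated just above the threshold needs at most one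
    digit more than the threshold. *)
Lemma size_bits_le m n : m <= n.*2.+1 -> size (bits m) <= (size (bits n)).+1.
Proof.
rewrite !size_mkseq => mn; apply: up_log_min => //; rewrite expnS.
have := @up_logP 2 n.+1 isT; lia.
Qed.

Lemma size_encode_nat n : size (encode_nat n) = (size (bits n)).*2.+1.
Proof.
rewrite size_cat /= addn1; congr _.+1.
by elim: (bits n) => //= a l ->; rewrite doubleS.
Qed.

Lemma size_encode_arc (i : instance) e : e \in arcs i ->
  size (encode_nat (weight i e)) + size (encode_nat (cost i e)) <= size (encode i).
Proof.
move=> eE; rewrite encodeE size_cat /= size_cat.
set L := [seq (x, y) | x <- _, y <- _].
have eL : e \in L by case: (e) => x y; apply: allpairs_f; rewrite mem_enum.
suff H : size (encode_nat (weight i e)) + size (encode_nat (cost i e)) <=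
    size (flatten (map (arc_code (arcs i) (weight i) (cost i)) L)).
  apply: leq_trans H _; apply: leq_trans (leq_addl _ _); exact: leqW (leq_addr _ _).
elim: L eL => //= d L IH; rewrite in_cons size_cat => /orP[/eqP <-|/IH]; last by lia.
by rewrite /arc_code eE /= size_cat; lia.
Qed.

Lemma check_complete (b : bool) (i : instance) : interdiction_exceeds i ->
  (b -> max_number i <= size (encode i) ^ 2) ->
  exists2 z, check b (encode i) z &
    sz z <= 9 * ((size (encode i) * size (encode i) + size (encode i) + 1) * (8 * size (encode i) + 12)).+1 + 1.
Proof.
move=> ex Hb; set N := size (encode i).
have NE : N = nvert i + (size (flatten (map (arc_code (arcs i) (weight i) (cost i)) [seq (x, y) | x <- enum 'I_(nvert i), y <- enum 'I_(nvert i)])) +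
  (size (encode_nat (budget i)) + (size (encode_nat (source i)) + (size (encode_nat (target i)) + size (encode_nat (threshold i)))))).+1.
  by rewrite /N {1}encodeE size_cat size_nseq /= !size_cat.
have arcN e : e \in arcs i -> size (bits (weight i e)) <= N /\ size (bits (cost i e)) <= N.
  by move/size_encode_arc; rewrite !size_encode_nat -/N; lia.
rewrite !size_encode_nat in NE.
have sq : value (square_bits (encode i)) = N ^ 2 by rewrite value_bits -mulnn.
have maxN : b -> budget i <= N ^ 2 /\ threshold i <= N ^ 2.
  by move/Hb; rewrite /max_number !geq_max -/N => /and3P[_ -> ->].
have arcmax e : b -> e \in arcs i -> weight i e <= N ^ 2 /\ cost i e <= N ^ 2.
  move=> bT eE; move: (Hb bT); rewrite /max_number geq_max -/N => /andP[/bigmax_leqP H _].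
  by have := H e eE; rewrite geq_max => /andP[].
move: ex => /interdiction_gtP [I [f [IE cI [f0 fk fE]]]].
have [node [orb eul]] := arcs_planar i.
(* Truncation preserves the inequalities along arcs, and it bounds the length of the potential by
   that of the threshold, which is part of the code. *)
pose g v := minn (f v) (threshold i).+1.
pose z : tree := enc (certificate (arcs i) (weight i) (cost i) (budget i) (source i) (target i) (threshold i) node I g).
have zarc e : c_arc z (dart_nat e) = (e \in arcs i) by apply: cert_arc.
exists z; last first.
  apply: certificate_size => //; try lia.
  - by have := ltn_ord (source i); lia.
  - by have := ltn_ord (target i); lia.
  - move=> v; apply: leq_trans (_ : (size (bits (threshold i))).+1 <= _); last by lia.
    by apply: size_bits_le; rewrite /g; lia.
have pl := planar_with_ext (underlying_adj zarc) (conj orb eul).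
rewrite /check !is_canonicalE cert_size cert_source cert_target cert_budget cert_threshold -/z !ltn_ord !canonical_bits /=.
have -> : encode i == c_code z.
  rewrite encodeE /c_code cert_size cert_source cert_target cert_budget cert_threshold darts_allpairs -map_comp.
  apply/eqP; congr (_ ++ _ :: flatten _ ++ _); apply: eq_map => e /=.
  by rewrite /arc_code zarc; case: ifP => // eE; rewrite cert_weight ?cert_cost.
have -> : 0 < size (bits (budget i)).
  by rewrite lt0n size_eq0; apply: contraTneq (budget_gt0 i) => E0; rewrite -(value_bits (budget i)) E0.
have zg v : c_potential z (nat_of_ord v) = bits (g v) by apply: cert_potential.
rewrite [nat_of_ord _ == nat_of_ord _](negPf (source_neq_target i)) !zg !leq_bitsP sq !value_bits.
rewrite /= !all_darts; apply/and5P; split.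
- apply/forallP => e; rewrite zarc; apply/implyP => eE; rewrite /z cert_weight ?cert_cost // !is_canonicalE !canonical_bits.
  by apply/implyP => bT; rewrite !leq_bitsP sq !value_bits; have [-> ->] := arcmax e bT eE.
- by apply/implyP => /maxN[-> ->].
- apply: (planar_check_complete (c_adj_sym z) _ pl.1 pl.2) => d; exact: cert_node.
- rewrite value_sum_bits -map_comp sum_darts; apply: leq_trans cI.
  rewrite leq_eqVlt; apply/orP; left; apply/eqP; apply: eq_big => e.
    rewrite zarc cert_cut andbC; case eI: (e \in I) => //=; exact: (subsetP IE).
  by rewrite zarc => /andP[eE _]; rewrite /= cert_cost // value_bits.
rewrite /g f0 min0n leqnn -ltnNge leq_min fk leqnn /=; apply/forallP => -[u v].
apply/implyP; rewrite zarc cert_cut => /andP[uvE uvI].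
rewrite leq_bitsP value_add /z cert_weight // -/z !zg !value_bits.
have := fE u v; rewrite in_setD uvE uvI => /(_ isT); rewrite /g.
move: (f u) (f v) (weight i (u, v)) (threshold i) => fu fv wuv k; lia.
Qed.

(** The flag [b] lets one verifier serve both membership claims of strong completeness, without and
    with the bound on the numbers. *)
Lemma interdiction_NP (b : bool) : NP (language_of encode
  (fun i => interdiction_exceeds i /\ (b -> max_number i <= size (encode i) ^ 2))).
Proof.
pose q : {poly nat} := (9%:P * (('X * 'X + 'X + 1%:P) * (8%:P * 'X + 12%:P) + 1%:P) + 1%:P)%R.
have qE n : q.[n]%R = 9 * ((n * n + n + 1) * (8 * n + 12)).+1 + 1.
  by rewrite -[LHS]/(peval q n) /q !pevalE !addn1.
exists (fun x y => check b x (parse_tree y)), q; split=> [|x].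
  apply: polytime_relation_intro.
  apply: (polytime_comp (f := fun xy : seq bool * seq bool => (xy.1, parse_tree xy.2)) (polytime_check b)).
  apply: polytime_pair polytime_fst _; exact: polytime_parse_tree polytime_snd.
split=> [[i [<- [ex num]]]|[y [_ /check_sound [i [ix ex num]]]]].
  by have [z z1 z2] := check_complete ex num; exists (code z); rewrite qE parse_treeK.
by exists i; rewrite ix.
Qed.

Lemma NP_ext (L L' : language) : (forall x, L x <-> L' x) -> NP L -> NP L'.
Proof.
by move=> H [R [q [PR HR]]]; exists R, q; split=> // x; rewrite -H.
Qed.

Lemma bounded_interdiction_NP_hard : NP_hard (language_of encode
  (fun i => interdiction_exceeds i /\ max_number i <= size (encode i) ^ 2)).
Proof.
move=> L [R [q [[M [p MR]] LR]]]; exists (reduction M p q).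
split=> [|x]; first exact: polytime_function_intro (polytime_reduction M p q).
have [i ix [num ex]] := reduction_instance q MR x.
rewrite LR; split=> [[y [ys Rxy]]|[j [jx [exj _]]]].
  exists i; split=> //; split=> //; apply/ex.
  exists y; [exact: ys|exact: Rxy].
(* The word is known to encode some positive instance [j]; having the same code, the constructed
   instance [i] is positive too. *)
have exi : interdiction_exceeds i by apply: encode_exceeds exj; rewrite jx ix.
have /ex [y ys Rxy] := exi; exists y; split; [exact: ys|exact: Rxy].
Qed.

Theorem theorem3 :
  strongly_NP_complete encode max_number interdiction_exceeds.
Proof.
(* The polynomial bounding the numbers is the square, the bound obtained in [reduction_instance] and
   tested by [check]. *)
have sqE (n : nat) : ('X * 'X : {poly nat}).[n]%R = n ^ 2.
  by rewrite -[LHS]/(peval ('X * 'X) n) !pevalE mulnn.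
split.
  apply: NP_ext (interdiction_NP false) => x.
  by split=> [[i [ix [ex _]]]|[i [ix ex]]]; exists i.
exists ('X * 'X)%R; split.
  apply: NP_ext (interdiction_NP true) => x.
  by split=> -[i [ix [ex num]]]; exists i; split=> //; split=> //; rewrite ?sqE in num *; auto.
move=> L /bounded_interdiction_NP_hard [f [Pf Lf]]; exists f; split=> // x; rewrite Lf.
by split=> -[i [ix [ex num]]]; exists i; split=> //; split=> //; rewrite ?sqE in num *.
Qed.
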